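(* Let $d\ge 2$ be an integer, let $1\le p\le 2$, let $m>0$ be real, and let $p'=p/(p-1)$ (with $p'=\infty$ if $p=1$). There exists a finite constant $c=c(p,d,m)>0$ such that for all $f\in L^p(\mathbb{R}^d)$ $$\psi_{p',m}[\hat f](t)\le c\,\omega_{p,m,p'}[f](1/t),\qquad t>0.$$
   Context: Fourier transform: $\hat f(\xi)=\int_{\mathbb{R}^d}e^{-i\xi\cdot x}f(x)\,dx$, extended in the standard way to $f\in L^p(\mathbb{R}^d)$, $1\le p\le 2$, so that $\hat f\in L^{p'}(\mathbb{R}^d)$. $\|\cdot\|_{p,\mathbb{R}^d}$ is the $L^p(\mathbb{R}^d)$ norm. Differences: for $m\in\mathbb{N}$ and $x,y\in\mathbb{R}^d$, $\Delta_y^m f(x)=\sum_{k=0}^m(-1)^{m-k}\binom{m}{k}f(x+ky)$; its Fourier transform in $x$ is $(2i\sin(y\cdot\xi/2))^m e^{imy\cdot\xi/2}\hat f(\xi)$. For real $m>0$, $m\notin\mathbb{N}$, $\Delta_y^m f$ is defined as the inverse Fourier transform (in the variable $\xi$) of $(2i\sin(y\cdot\xi/2))^m e^{imy\cdot\xi/2}\hat f(\xi)$, where the power $(2i\sin(y\cdot\xi/2))^m$ is taken with the principal branch. Modulus of continuity: $\mathbb{S}^{d-1}$ is the unit sphere in $\mathbb{R}^d$ with its standard surface measure $dS$. For $h>0$, $$\omega_{p,m,q}[f](h)=\Big(\int_{\mathbb{S}^{d-1}}\|\Delta_{hy}^m f\|_{p,\mathbb{R}^d}^q\,dS_y\Big)^{1/q}\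 (1\le q<\infty),\qquad \omega_{p,m,\infty}[f](h)=\sup_{|y|\le h}\|\Delta_y^m f\|_{p,\mathbb{R}^d}.$$ Modified tail of the Fourier transform: for $t>0$, $$\psi_{p',m}[\hat f](t)=\Big(\int_{\mathbb{R}^d}\min\big(1,(|\xi|/t)^{mp'}\big)|\hat f(\xi)|^{p'}\,d\xi\Big)^{1/p'}\ (1\le p'<\infty),$$ $$\psi_{\infty,m}[\hat f](t)=\sup_{\xi\in\mathbb{R}^d}\Big(\min\big(1,(|\xi|/t)^m\big)|\hat f(\xi)|\Big).$$ *)

(* Defs.v *)
From HB Require Import structures.
From mathcomp Require Import all_boot all_order all_algebra.
From mathcomp Require Import all_classical all_reals all_analysis.
From mathcomp Require Import measurable_realfun complex.

Set Implicit Arguments.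
Unset Strict Implicit.
Unset Printing Implicit Defensive.
Import Order.TTheory GRing.Theory Num.Def Num.Theory.
Import numFieldNormedType.Exports.

Local Open Scope classical_set_scope.
Local Open Scope ring_scope.

(* The product sigma-algebra on row vectors, as the library does for tuples. *)
Section measurable_rV.
Context {d : measure_display} {T : sigmaRingType d}.
Variable n : nat.

Let coors : 'I_n -> 'rV[T]_n -> T := fun i x => x ord0 i.

Let rV_set0 : g_sigma_preimage coors set0.
Proof. exact: sigma_algebra0. Qed.

Let rV_setC A : g_sigma_preimage coors A -> g_sigma_preimage coors (~` A).
Proof. exact: sigma_algebraC. Qed.

Let rV_bigcup (F : _^nat) : (forall i, g_sigma_preimage coors (F i)) ->
  g_sigma_preimage coors (\bigcup_i (F i)).
Proof. exact: sigma_algebra_bigcup. Qed.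

HB.instance Definition _ := @isMeasurable.Build (measure_tuple_display d)
  'rV[T]_n (g_sigma_preimage coors) rV_set0 rV_setC rV_bigcup.

End measurable_rV.

Lemma measurable_coord d (T : sigmaRingType d) n (i : 'I_n) :
  measurable_fun [set: 'rV[T]_n] (fun x => x ord0 i).
Proof.
move=> _ Y mY; rewrite setTI; apply: sub_sigma_algebra => /=.
rewrite -bigcup_seq/=; exists i => /=; first by rewrite mem_index_enum.
by exists Y => //; rewrite setTI.
Qed.

Lemma measurable_fun_rV d d' (S : measurableType d) (T : measurableType d') n
    (f : S -> 'rV[T]_n) :
  (forall i, measurable_fun [set: S] (fun x => f x ord0 i)) ->
  measurable_fun [set: S] f.
Proof.
move=> mf _ Y mY; rewrite setTI.
have : preimage_set_system [set: S] f (@measurable _ 'rV[T]_n) `<=` measurable.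
  rewrite -g_sigma_preimageE.
  apply: smallest_sub; first exact: sigma_algebra_measurable.
  move=> _ [B + <-]; rewrite -bigcup_seq => -[i _ [C mC <-]].
  by rewrite setTI setTI; have := mf i measurableT _ mC; rewrite setTI.
by apply; exists Y => //; rewrite setTI.
Qed.

Lemma product_sigma_finite d1 d2 (T1 : measurableType d1)
    (T2 : measurableType d2) (R : realType)
    (m1 : {sigma_finite_measure set T1 -> \bar R})
    (m2 : {sigma_finite_measure set T2 -> \bar R}) :
  sigma_finite setT (m1 \x m2)%E.
Proof.
have /sigma_finiteP[F [TF ndF Foo]] := sigma_finiteT m1.
have /sigma_finiteP[G [TG ndG Goo]] := sigma_finiteT m2.
exists (fun n => F n `*` G n).
  rewrite -setXTT TF TG predeqE => -[x y]; split.
    move=> [/= [n _ Fnx] [k _ Gky]]; exists (maxn n k) => //; split.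
    - by move: x Fnx; exact/subsetPset/ndF/leq_maxl.
    - by move: y Gky; exact/subsetPset/ndG/leq_maxr.
  by move=> [n _ []/= ? ?]; split; exists n.
move=> k; have [? ?] := Foo k; have [? ?] := Goo k.
split; first exact: measurableX.
by rewrite product_measure1E// lte_mul_pinfty// ge0_fin_numE.
Qed.

Section lebesgue_rV.
Variable R : realType.

Definition cons_rV n (xv : measurableTypeR R * 'rV[R]_n) : 'rV[R]_n.+1 :=
  \row_i if unlift ord0 i is Some j then xv.2 ord0 j else xv.1.

Lemma measurable_cons_rV n : measurable_fun setT (@cons_rV n).
Proof.
apply: measurable_fun_rV => i.
under eq_fun do rewrite mxE.
case: unliftP => [j _|_]; last exact: measurable_fst.
exact: (measurableT_comp (measurable_coord j) measurable_snd).
Qed.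

Section step.
Variables (n : nat) (mu : {sigma_finite_measure set 'rV[R]_n -> \bar R}).

Definition lebesgue_step : set 'rV[R]_n.+1 -> \bar R :=
  pushforward (@lebesgue_measure R \x mu)%E (@cons_rV n).

HB.instance Definition _ := Measure.copy lebesgue_step
  (measure_function_pushforward__canonical__measure_function_Measure
    (@lebesgue_measure R \x mu)%E (@measurable_cons_rV n)).

Let lebesgue_step_sigma_finite : sigma_finite setT lebesgue_step.
Proof.
have [F FT mF] := product_sigma_finite (@lebesgue_measure R) mu.
pose tl (x : 'rV[R]_n.+1) : measurableTypeR R * 'rV[R]_n :=
  (x ord0 ord0, \row_i x ord0 (lift ord0 i)).
have mtl : measurable_fun setT tl.
  apply/measurable_fun_pair; first exact: (measurable_coord ord0).
  apply: measurable_fun_rV => i; under eq_fun do rewrite mxE.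
  exact: measurable_coord.
have consK xv : tl (cons_rV xv) = xv.
  case: xv => x v; congr pair; first by rewrite mxE unlift_none.
  by apply/rowP => i; rewrite !mxE liftK.
exists (fun i => tl @^-1` F i).
  by rewrite -preimage_bigcup -FT preimage_setT.
move=> i; have [mFi Fioo] := mF i; split.
  by rewrite -[X in measurable X]setTI; exact: mtl.
rewrite /lebesgue_step /pushforward.
by rewrite (_ : _ @^-1` _ = F i)//; apply/seteqP; split=> xv /=; rewrite consK.
Qed.

HB.instance Definition _ := Measure_isSigmaFinite.Build _ _ _ lebesgue_step
  lebesgue_step_sigma_finite.

End step.

(* Lebesgue measure on R^n, as an iterated product. *)
Fixpoint lebesgue_rV n : {sigma_finite_measure set 'rV[R]_n -> \bar R} :=
  match n with
  | 0 => \d_(0 : 'rV[R]_0)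
  | n'.+1 => lebesgue_step (lebesgue_rV n')
  end.

End lebesgue_rV.

Section euclidean.
Context {R : realType} {d : nat}.
Implicit Types x y : 'rV[R]_d.

Definition dotp x y : R := \sum_i x ord0 i * y ord0 i.

(* Not the norm `|x| of the library, which is the sup norm on row vectors. *)
Definition enorm x : R := Num.sqrt (dotp x x).

Definition sphere : set 'rV[R]_d := [set x | enorm x = 1].

Definition unit_ball : set 'rV[R]_d := [set x | enorm x <= 1].

Definition radial x : 'rV[R]_d := (enorm x)^-1 *: x.

Lemma measurable_enorm : measurable_fun setT enorm.
Proof.
have -> : enorm = (@powR R)^~ 2^-1 \o (fun x => dotp x x).
  apply/funext => x; rewrite /enorm /= powR12_sqrt//.
  by apply: sumr_ge0 => i _; rewrite -expr2 sqr_ge0.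
apply: measurableT_comp; first exact: measurable_powR.
by apply: measurable_sum => i; apply: measurable_funM; exact: measurable_coord.
Qed.

Lemma measurable_unit_ball : measurable unit_ball.
Proof.
rewrite -[X in measurable X]setTI.
have -> : unit_ball = enorm @^-1` `]-oo, 1].
  by apply/seteqP; split=> x /=; rewrite in_itv.
exact: measurable_enorm.
Qed.

Lemma measurable_radial : measurable_fun setT radial.
Proof.
apply: measurable_fun_rV => i; under eq_fun do rewrite mxE.
apply: measurable_funM; last exact: measurable_coord.
have -> : (fun x => (enorm x)^-1) = (@powR R)^~ (-1) \o enorm.
  by apply/funext => x; rewrite /= powR_inv1// sqrtr_ge0.
apply: measurableT_comp; first exact: measurable_powR.
exact: measurable_enorm.
Qed.

(* The surface measure of A is d times the volume of the cone over A, that is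
   of {r y : y in A, 0 <= r <= 1}; the point 0 has measure zero. *)
Definition surface_measure : set 'rV[R]_d -> \bar R :=
  pushforward (mscale d%:R%:nng
    (mrestr (lebesgue_rV R d) measurable_unit_ball)) radial.

HB.instance Definition _ := Measure.copy surface_measure
  (measure_function_pushforward__canonical__measure_function_Measure
    (mscale d%:R%:nng (mrestr (lebesgue_rV R d) measurable_unit_ball))
    measurable_radial).

End euclidean.
Arguments sphere : clear implicits.
Arguments surface_measure : clear implicits.

Section complex_power.
Context {R : realType}.
Implicit Types z : R[i].

Definition expi (t : R) : R[i] := Complex (cos t) (sin t).

(* The principal argument, in ]-pi, pi]. *)
Definition Arg z : R :=
  let t := acos (complex.Re z / Normc.normc z) in
  if 0 <= complex.Im z then t else - t.

Definition cpowR z (m : R) : R[i] :=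
  if z == 0 then 0 else (Normc.normc z `^ m)%:C%C * expi (m * Arg z).

End complex_power.

Section fourier_smoothness.
Context {R : realType} {d : nat}.
Implicit Types (f g G : 'rV[R]_d -> R[i]) (x y xi : 'rV[R]_d) (p q : \bar R).

Local Notation mu := (lebesgue_rV R d).

Definition Lpnorm p f : \bar R :=
  'N[mu]_p[EFin \o (@Normc.normc R) \o f].

Definition Lp p : set ('rV[R]_d -> R[i]) :=
  [set f | [/\ measurable_fun setT (fun x => complex.Re (f x)),
               measurable_fun setT (fun x => complex.Im (f x)) &
               (Lpnorm p f < +oo)%E]].

Definition cintegral f : R[i] :=
  Complex (\int[mu]_x complex.Re (f x)) (\int[mu]_x complex.Im (f x)).

Definition fourierL1 f xi : R[i] :=
  cintegral (fun x => expi (- dotp xi x) * f x).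

(* G is a version of the Fourier transform of f in L^p, 1 <= p <= 2: the
   extension from L^1 `&` L^p of fourierL1 by continuity from L^p to L^p'. *)
Definition is_fourier p f G : Prop :=
  [/\ Lp p f, Lp (hoelder_conjugate p) G &
    exists u : nat -> 'rV[R]_d -> R[i],
      [/\ forall n, (Lp 1%E `&` Lp p) (u n),
          Lpnorm p (fun x => u n x - f x) @[n --> \oo] --> 0%E &
          Lpnorm (hoelder_conjugate p) (fun xi => fourierL1 (u n) xi - G xi)
            @[n --> \oo] --> 0%E]].

(* For p = 1, this is the continuous representative. For p > 1, it is a choice
   among functions that are equal almost everywhere. *)
Definition fourier p f : 'rV[R]_d -> R[i] :=
  if p == 1%E then fourierL1 f else xget (fun=> 0) [set G | is_fourier p f G].

(* The versions of the inverse Fourier transform of G that are in L^p. *)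
Definition inverse_fourier p G : set ('rV[R]_d -> R[i]) :=
  [set g | is_fourier p g G].

Definition fdiff_nat (n : nat) y f x : R[i] :=
  \sum_(k < n.+1) (-1) ^+ (n - k) * 'C(n, k)%:R * f (x + k%:R *: y).

Definition fdiff_symbol (m : R) y xi : R[i] :=
  cpowR (Complex 0 (2 * sin (dotp y xi / 2))) m * expi (m * dotp y xi / 2).

(* The set of versions of the m-th difference of f with step y. *)
Definition fdiff p (m : R) y f : set ('rV[R]_d -> R[i]) :=
  if m \is a Num.nat then [set fdiff_nat (Num.truncn m) y f]
  else inverse_fourier p (fun xi => fdiff_symbol m y xi * fourier p f xi).

(* All versions have the same norm; as usual, the norm is +oo for a
   tempered distribution that is not a function in L^p. *)
Definition fdiff_norm p (m : R) y f : \bar R :=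
  ereal_inf (Lpnorm p @` fdiff p m y f).

(* The value at q = -oo is irrelevant. *)
Definition omega p (m : R) q f (h : R) : \bar R :=
  match q with
  | q%:E => ((\int[surface_measure R d]_(y in sphere R d)
                fdiff_norm p m (h *: y) f `^ q) `^ q^-1)%E
  | +oo%E => ereal_sup [set fdiff_norm p m y f | y in [set y | enorm y <= h]]
  | -oo%E => 0%E
  end.

Definition psi q (m : R) G (t : R) : \bar R :=
  match q with
  | q%:E => ((\int[mu]_xi
      (Num.min 1 ((enorm xi / t) `^ (m * q)) * Normc.normc (G xi) `^ q)%:E)
        `^ q^-1)%E
  | +oo%E => ereal_sup (range (fun xi =>
      (Num.min 1 ((enorm xi / t) `^ m) * Normc.normc (G xi))%:E))
  | -oo%E => 0%E
  end.

End fourier_smoothness.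

(* Main.v *)
Require Import Defs.
From mathcomp Require Import all_boot all_order all_algebra.
From mathcomp Require Import all_classical all_reals all_analysis.
From mathcomp Require Import measurable_realfun ess_sup_inf complex.
From mathcomp Require Import ring lra.

Set Implicit Arguments.
Unset Strict Implicit.
Unset Printing Implicit Defensive.
Import Order.TTheory GRing.Theory Num.Theory.
Import numFieldNormedType.Exports.
Local Open Scope classical_set_scope.
Local Open Scope ring_scope.

(** Write F for the Fourier transform of f, q for the exponent conjugate to p,
    and symbol m y xi = |2 sin (y.xi / 2)|^m for the modulus of the multiplier
    of the m-th difference with step y.

    The Hausdorff-Young inequality, applied to the difference, bounds the L^q
    norm of symbol m y * F by a constant times the L^p norm of the difference
    (fdiff_norm_ge). If 1 < p, raise this to the power q and integrate it over
    the directions y = h theta with h = 1/t. On the left, Tonelli leaves the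
    integral of |F xi|^q times the average of symbol (m q) (h theta) xi over
    theta. This average is at least a multiple of min (1, (h |xi|)^(m q)), which
    is the weight in psi (sphere_symbol_ge). For small h |xi| the reason is that
    the symbol is about (h |theta.xi|)^(m q), and for large h |xi| that h
    theta.xi / 2 stays away from the zeros of the sine for many theta; the proof
    treats both regimes at once, by comparing two directions at which the phases
    differ by a suitable amount (radial_dichotomy). If p = 1, then q is infinite
    and both sides are suprema: F is continuous, so that the essential supremum
    of symbol m y * F dominates every value (symbol_fourierL1_le), and y can be
    chosen depending on xi, namely parallel to it with y.xi = min (1, |xi|/t).

    The Hausdorff-Young inequality with some constant is proved by real
    interpolation. The two end points are the trivial bound from L^1 to the
    bounded functions, and a bound on L^2. For the latter (plancherel_le), the
    integral of |F|^2 against a window of width N equals the integral of f(x)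
    f(y) K_N(x - y), where K_N is the transform of the window; K_N is dominated
    by an approximate identity whose mass does not depend on N, so that Schur's
    test bounds the integral by a multiple of the integral of f^2, and N tends
    to infinity. Between the end points (marcinkiewicz_dual), f is truncated at
    a height that depends on the level lam at which F is examined, and the
    levels run through a dyadic sequence. Cosine and sine transforms of real
    functions are treated separately, and everything is first proved for
    integrable functions and then carried to L^p by the approximations in
    is_fourier (is_fourier_Lpnorm_le). *)

(** * Integration over row vectors *)

Section lebesgue_rV_integral.
Context {R : realType}.
Local Open Scope ereal_scope.

Lemma ge0_integral_rVS n (f : 'rV[R]_n.+1 -> \bar R) :
  measurable_fun setT f -> (forall x, 0 <= f x) ->
  \int[lebesgue_rV R n.+1]_x f x =
  \int[lebesgue_measure]_x \int[lebesgue_rV R n]_v f (cons_rV (x, v)).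
Proof.
move=> mf f0.
rewrite [LHS](ge0_integral_pushforward (@measurable_cons_rV R n))//.
rewrite preimage_setT fubini_tonelli1//; last by move=> x; exact: f0.
by apply: measurableT_comp => //; exact: measurable_cons_rV.
Qed.

(** The types select the Borel sigma-algebra, on which translation has to be
    measurable for the pushforward measures below. *)
Definition shiftR (a : R) : measurableTypeR R -> measurableTypeR R := fun x => (x + a)%R.

Lemma measurable_shift (a : R) : measurable_fun setT (shiftR a).
Proof. exact: measurable_funD. Qed.

Lemma lebesgue_shift (a : R) (A : set (measurableTypeR R)) : measurable A ->
  pushforward lebesgue_measure (shiftR a) A = lebesgue_measure A.
Proof.
pose mu := measure_function_pushforward__canonical__measure_function_Measure (@lebesgue_measure R) (measurable_shift a).
move=> mA.
suff : lebesgue_measure A = mu A by move=> ->.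
apply: (@lebesgue_measure_unique R mu) => // X [[x y] _ <-].
rewrite /= /pushforward.
have -> : (shiftR a) @^-1` `]x, y]%classic = `](x - a)%R, (y - a)%R]%classic.
  by apply/seteqP; split => z /=; rewrite !in_itv/= ltrBlDr lerBrDr.
rewrite !lebesgue_measure_itv/= !lte_fin ltrD2r.
by case: ifP => // _; rewrite !EFinN -!EFinB; congr EFin; lra.
Qed.

Lemma ge0_integral_shift (a : R) (f : measurableTypeR R -> \bar R) :
  measurable_fun setT f -> (forall x, 0 <= f x) ->
  \int[lebesgue_measure]_x f (x + a)%R = \int[lebesgue_measure]_x f x.
Proof.
move=> mf f0.
pose mu := measure_function_pushforward__canonical__measure_function_Measure (@lebesgue_measure R) (measurable_shift a).
have := ge0_integral_pushforward (measurable_shift a) (@lebesgue_measure R) measurableT mf (fun x _ => f0 x).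
rewrite preimage_setT => <-.
apply: (@eq_measure_integral _ _ _ _ _ mu) => A mA _.
exact: lebesgue_shift.
Qed.

Lemma ge0_integral_translate n (y : 'rV[R]_n) (f : 'rV[R]_n -> \bar R) :
  measurable_fun setT f -> (forall x, 0 <= f x) ->
  \int[lebesgue_rV R n]_x f (x + y)%R = \int[lebesgue_rV R n]_x f x.
Proof.
elim: n y f => [|n IH] y f mf f0.
  by apply: eq_integral => x _; congr f; apply/rowP => -[].
have madd : measurable_fun [set: 'rV[R]_n.+1] (fun x : 'rV[R]_n.+1 => (x + y)%R).
  apply: measurable_fun_rV => i; under eq_fun do rewrite mxE.
  by apply: measurable_funD => //; exact: measurable_coord.
rewrite !ge0_integral_rVS//; last exact: measurableT_comp.
pose tl : 'rV[R]_n := \row_i y ord0 (lift ord0 i).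
pose g (x : measurableTypeR R) := \int[lebesgue_rV R n]_v f (cons_rV (x, v)).
have mfc : measurable_fun setT (f \o @cons_rV R n).
  by apply: measurableT_comp => //; exact: measurable_cons_rV.
rewrite -[RHS](@ge0_integral_shift (y ord0 ord0) g); last 2 first.
- have := @measurable_fun_fubini_tonelli_F _ _ _ _ _ (lebesgue_rV R n) _ mfc.
  by apply => -[x v]; exact: f0.
- by move=> x; apply: integral_ge0.
apply: eq_integral => x _.
rewrite /g -(IH tl (fun v => f (cons_rV (_, v))))//; last first.
  apply: (measurableT_comp mfc); exact: pair1_measurable.
apply: eq_integral => v _; congr f.
apply/rowP => i; rewrite !mxE; case: unliftP => [j ->|->] //=.
by rewrite !mxE.
Qed.

End lebesgue_rV_integral.

Section lebesgue_rV_more.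
Context {R : realType}.
Implicit Types n : nat.
Local Open Scope ereal_scope.

Lemma measurable_rV_add n (y : 'rV[R]_n) :
  measurable_fun [set: 'rV[R]_n] (fun x : 'rV[R]_n => (x + y)%R).
Proof.
apply: measurable_fun_rV => i; under eq_fun do rewrite mxE.
by apply: measurable_funD => //; exact: measurable_coord.
Qed.

Lemma integral_translate n (y : 'rV[R]_n) (f : 'rV[R]_n -> \bar R) :
  measurable_fun setT f ->
  \int[lebesgue_rV R n]_x f (x + y)%R = \int[lebesgue_rV R n]_x f x.
Proof.
move=> mf; rewrite integralE [RHS]integralE; congr (_ - _).
- rewrite -(@ge0_integral_translate R n y (f^\+) (measurable_funepos mf) (funepos_ge0 _)).
  by apply: eq_integral => x _; rewrite !funeposE.
- rewrite -(@ge0_integral_translate R n y (f^\-) (measurable_funeneg mf) (funeneg_ge0 _)).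
  by apply: eq_integral => x _; rewrite !funenegE.
Qed.

Lemma lebesgue_rV_translate n (y : 'rV[R]_n) (A : set 'rV[R]_n) :
  measurable A ->
  lebesgue_rV R n [set x | A (x + y)%R] = lebesgue_rV R n A.
Proof.
move=> mA.
have mA' : measurable [set x | A (x + y)%R].
  by rewrite -[X in measurable X]setTI; exact: measurable_rV_add.
have mi : measurable_fun [set: 'rV[R]_n] (fun x => (\1_A x)%:E : \bar R).
  by apply/measurable_EFinP; exact: measurable_indic.
have h (B : set 'rV[R]_n) : measurable B ->
    lebesgue_rV R n B = \int[lebesgue_rV R n]_x (\1_B x)%:E.
  by move=> mB; rewrite integral_indic// setIT.
by rewrite !h// -[RHS](integral_translate y mi).
Qed.

Lemma measurable_prod_coord n (g : 'I_n -> measurableTypeR R -> R) :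
  (forall i, measurable_fun setT (g i)) ->
  measurable_fun setT (fun x : 'rV[R]_n => (\prod_i g i (x ord0 i))%R).
Proof.
move=> mg; apply: measurable_prod => i _.
exact: (measurableT_comp (mg i) (measurable_coord i)).
Qed.

(** The integral of a product of functions of one coordinate each factors. *)
Lemma ge0_integral_prod n (g : 'I_n -> measurableTypeR R -> R) (c : 'I_n -> R) :
  (forall i, measurable_fun setT (g i)) -> (forall i x, (0 <= g i x)%R) ->
  (forall i, \int[lebesgue_measure]_x (g i x)%:E = (c i)%:E) ->
  \int[lebesgue_rV R n]_x (\prod_i g i (x ord0 i))%:E = (\prod_i c i)%:E.
Proof.
elim: n g c => [|n IH] g c mg g0 gc.
  rewrite [X in integral X]/= integral_dirac// ?diracT ?mul1e; last first.
    by apply/measurable_EFinP; apply: measurable_prod => -[].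
  by rewrite !big_ord0.
have mp : measurable_fun setT (fun x : 'rV[R]_n.+1 => (\prod_i g i (x ord0 i))%R).
  exact: measurable_prod_coord.
rewrite ge0_integral_rVS; last 2 first.
- exact/measurable_EFinP.
- by move=> x; rewrite lee_fin prodr_ge0.
under eq_integral => x _.
  under eq_integral => v _.
    rewrite big_ord_recl/= mxE unlift_none/= EFinM.
    under eq_bigr => i _ do rewrite mxE liftK/=.
    over.
  rewrite ge0_integralZl//; last 3 first.
  - apply/measurable_EFinP.
    exact: (measurable_prod_coord (fun i => mg (lift ord0 i))).
  - by move=> v _; rewrite lee_fin prodr_ge0.
  - by rewrite lee_fin.
  rewrite (IH (fun i => g (lift ord0 i)) (fun i => c (lift ord0 i)))//.
  over.
rewrite ge0_integralZr//; last 3 first.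
- by apply/measurable_EFinP; exact: mg.
- by move=> x _; rewrite lee_fin.
- rewrite lee_fin; apply: prodr_ge0 => i _.
  by rewrite -lee_fin -gc; apply: integral_ge0 => x _; rewrite lee_fin.
by rewrite gc -EFinM big_ord_recl.
Qed.

End lebesgue_rV_more.

(** * Fubini for kernels dominated by a product *)
Section fubini_dominated.
Context {R : realType} d1 d2 (T1 : measurableType d1) (T2 : measurableType d2).
Variables (m1 : {sigma_finite_measure set T1 -> \bar R})
          (m2 : {sigma_finite_measure set T2 -> \bar R}).
Variables (f : T1 * T2 -> R) (g : T1 -> R) (h : T2 -> R).
Hypothesis mf : measurable_fun setT f.
Hypothesis ig : m1.-integrable setT (EFin \o g).
Hypothesis ih : m2.-integrable setT (EFin \o h).
Hypothesis fgh : forall x y, `|f (x, y)| <= g x * h y.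

Lemma integrable_slice1 x : m2.-integrable setT (fun y => (f (x, y))%:E).
Proof.
apply: (@le_integrable _ _ _ _ _ measurableT _ (fun y => (g x)%:E * (EFin \o h) y)%E).
- by apply/measurable_EFinP; apply: measurableT_comp => //; exact: pair1_measurable.
- move=> y _; rewrite /= lee_fin (le_trans (fgh x y))//.
  exact: ler_norm.
- exact: integrableZl.
Qed.

Lemma integrable_slice2 y : m1.-integrable setT (fun x => (f (x, y))%:E).
Proof.
apply: (@le_integrable _ _ _ _ _ measurableT _ (fun x => (EFin \o g) x * (h y)%:E)%E).
- by apply/measurable_EFinP; apply: measurableT_comp => //; exact: pair2_measurable.
- move=> x _; rewrite /= lee_fin (le_trans (fgh x y))//.
  exact: ler_norm.
- exact: integrableZr.
Qed.

Lemma integrable_dominated : (m1 \x m2)%E.-integrable setT (EFin \o f).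
Proof.
apply/integrable12ltyP; first exact/measurable_EFinP.
have ig' := integrable_abse ig. have ih' := integrable_abse ih.
have mgx : measurable_fun setT g by apply/measurable_EFinP; case/integrableP: ig.
have mhx : measurable_fun setT h by apply/measurable_EFinP; case/integrableP: ih.
apply: (@le_lt_trans _ _ (\int[m1]_x (`|g x|%:E * \int[m2]_y `|h y|%:E))%E).
  apply: ge0_le_integral => //.
  - by move=> x _; apply: integral_ge0 => y _; exact: abse_ge0.
  - apply: (@measurable_fun_fubini_tonelli_F _ _ _ _ _ m2 (fun z => `|(EFin \o f) z|%E)) => //.
    by apply: measurableT_comp => //; exact/measurable_EFinP.
  - apply: emeasurable_funM => //; apply/measurable_EFinP.
    exact: measurableT_comp.
  - move=> x _; rewrite -ge0_integralZl//; last first.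
      by apply/measurable_EFinP; exact: measurableT_comp.
    apply: ge0_le_integral => //.
    + apply: measurableT_comp => //; apply/measurable_EFinP.
      by apply: measurableT_comp => //; exact: pair1_measurable.
    + apply: emeasurable_funM => //; apply/measurable_EFinP.
      exact: measurableT_comp.
    + move=> y _; rewrite -EFinM lee_fin -normrM (le_trans (fgh x y))//.
      exact: ler_norm.
have hfin : (\int[m2]_y `|h y|%:E)%E \is a fin_num.
  exact: (integrable_fin_num measurableT ih').
rewrite ge0_integralZr//; last 2 first.
- by apply/measurable_EFinP; exact: measurableT_comp.
- by apply: integral_ge0.
rewrite lte_mul_pinfty//; first by apply: integral_ge0.
  exact: (integrable_fin_num measurableT ig').
by rewrite ltey_eq hfin.
Qed.

Lemma Rfubini_dominated :
  \int[m1]_x (\int[m2]_y f (x, y)) = \int[m2]_y (\int[m1]_x f (x, y)).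
Proof.
rewrite /Rintegral; congr fine.
have := Fubini integrable_dominated => /=.
move=> /= H; transitivity (\int[m1]_x \int[m2]_y (f (x, y))%:E)%E.
  apply: eq_integral => x _; rewrite fineK//.
  exact: (integrable_fin_num measurableT (integrable_slice1 x)).
rewrite H; apply: eq_integral => y _; rewrite fineK//.
exact: (integrable_fin_num measurableT (integrable_slice2 y)).
Qed.

Lemma Rintegral_prod_dominated :
  \int[(m1 \x m2)%E]_z f z = \int[m1]_x (\int[m2]_y f (x, y)).
Proof.
rewrite /Rintegral; congr fine.
rewrite -(integral12_prod_meas1 integrable_dominated).
apply: eq_integral => x _ /=; rewrite fineK//.
exact: (integrable_fin_num measurableT (integrable_slice1 x)).
Qed.

Lemma integrable_Rintegral1 : m1.-integrable setT (fun x => (\int[m2]_y f (x, y))%:E).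
Proof.
have := integrable_fubini_F integrable_dominated.
apply: eq_integrable => // x _; rewrite /fubini_F /= /Rintegral fineK//.
exact: (integrable_fin_num measurableT (integrable_slice1 x)).
Qed.

End fubini_dominated.

(** * The parabolic window in one variable *)
Section real_calculus.
Context {R : realType}.
Implicit Types (N z x : R) (f g F : R -> R).

(** A copy of is_derive that is not a class: type class resolution stays out of
    the way when derivatives are computed by backward application of the rules
    below, with the derivative left as an existential variable. *)
Definition isD x F (a : R) : Prop := is_derive x 1 F a.

Lemma isDM x f g (a b : R) : isD x f a -> isD x g b ->
  isD x (fun x => f x * g x) (a * g x + f x * b).
Proof.
rewrite /isD => fa gb; apply: (is_derive_eq (is_deriveM fa gb)).
by rewrite addrC; congr +%R; rewrite /GRing.scale/= mulrC.
Qed.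

Lemma isDD x f g (a b : R) : isD x f a -> isD x g b ->
  isD x (fun x => f x + g x) (a + b).
Proof. by rewrite /isD => fa gb; exact: (is_deriveD fa gb). Qed.

Lemma isDN x f (a : R) : isD x f a -> isD x (fun x => - f x) (- a).
Proof. by rewrite /isD => fa; exact: (is_deriveN fa). Qed.

Lemma isDcst x (c : R) : isD x (fun=> c) 0.
Proof. exact: is_derive_cst. Qed.

Lemma isDid x : isD x (fun x : R => x) 1.
Proof. exact: is_derive_id. Qed.

Lemma isD_lin x z : isD x (fun x => x * z) z.
Proof. by have := isDM (isDid x) (isDcst x z); rewrite mul1r mulr0 addr0. Qed.

Lemma isD_sin_lin x (z : R) : isD x (fun x => sin (x * z)) (z * cos (x * z)).
Proof. by rewrite mulrC; apply: (is_derive1_comp (is_derive_sin _) (isD_lin x z)). Qed.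

Lemma isD_cos_lin x (z : R) : isD x (fun x => cos (x * z)) (- (z * sin (x * z))).
Proof.
by rewrite mulrC -mulNr; apply: (is_derive1_comp (is_derive_cos _) (isD_lin x z)).
Qed.

Lemma isD_eq F x (a b : R) : isD x F a -> a = b -> isD x F b.
Proof. by move=> fa <-. Qed.

Lemma isD_continuous F x (a : R) : isD x F a -> {for x, continuous F}.
Proof.
rewrite /isD => H; apply: differentiable_continuous; apply/derivable1_diffP.
exact: ex_derive.
Qed.

Ltac isD_tac := repeat first
  [apply: isD_sin_lin | apply: isD_cos_lin | apply: isDcst | apply: isDid
  | apply: isDM | apply: isDD | apply: isDN].

Lemma FTC_is_derive f F (a b : R) : a < b -> (forall x, isD x F (f x)) ->
  continuous f -> \int[lebesgue_measure]_(x in `[a, b]) f x = F b - F a.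
Proof.
move=> ab dF cf; rewrite /Rintegral (continuous_FTC2 (F := F) ab)//.
- by apply: continuous_in_subspaceT => x _; exact: cf.
- have cF x : {for x, continuous F} by exact: isD_continuous (dF x).
  split.
  + by move=> x _; have := dF x; rewrite /isD => ?; exact: ex_derive.
  + by apply: cvg_at_right_filter; exact: cF.
  + by apply: cvg_at_left_filter; exact: cF.
- by move=> x _; rewrite derive1E; have := dF x; rewrite /isD => ?; exact: derive_val.
Qed.

Lemma continuous_cos_lin z : continuous (fun x : R => cos (x * z)).
Proof. by move=> x; exact: isD_continuous (isD_cos_lin x z). Qed.

Lemma continuous_sin_lin z : continuous (fun x : R => sin (x * z)).
Proof. by move=> x; exact: isD_continuous (isD_sin_lin x z). Qed.

Lemma normr_sin_le x : `|sin x| <= `|x|.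
Proof.
wlog x0 : x / 0 <= x.
  move=> H; case: (leP 0 x) => [|x0]; first exact: H.
  by rewrite -normrN -sinN -(normrN x); apply: H; rewrite oppr_ge0 ltW.
rewrite (ger0_norm x0); move: x0; rewrite le_eqVlt => /predU1P[<-|x0].
  by rewrite sin0 normr0.
have [c _] := MVT x0 (fun x _ => is_derive_sin x) (continuous_subspaceT (@continuous_sin R)).
rewrite sin0 !subr0 => ->; rewrite normrM (gtr0_norm x0) ler_piMl ?(ltW x0)//.
exact: cos_max.
Qed.

Lemma sin_ge_half x : 0 <= x -> x <= 1 -> x / 2 <= sin x.
Proof.
rewrite le_eqVlt => /predU1P[<-|x0 x1]; first by rewrite sin0 mul0r.
have [c + ] := MVT x0 (fun x _ => is_derive_sin x) (continuous_subspaceT (@continuous_sin R)).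
rewrite in_itv/= => /andP[c0 cx].
rewrite sin0 !subr0 => ->; rewrite mulrC ler_pM2r//.
have -> : c = (c / 2) *+ 2 by rewrite -mulr_natr; field.
rewrite cos_mulr2n cos2sin2.
have : sin (c / 2) ^+ 2 <= (c / 2) ^+ 2.
  rewrite -[leLHS]real_normK ?num_real// -[leRHS]real_normK ?num_real//.
  by rewrite ler_sqr ?nnegrE//; exact: normr_sin_le.
have cc : c * c <= 1 by apply: mulr_ile1; lra.
have -> : (c / 2) ^+ 2 = c * c / 4 by field.
by move: (sin _ ^+ 2) (c * c) cc => s t ? ?; rewrite -mulr_natr; lra.
Qed.

Lemma normr_sin_ge x : `|x| <= 1 -> `|x| / 2 <= `|sin x|.
Proof.
move=> x1; have [x0|x0] := leP 0 x.
  rewrite (ger0_norm x0) in x1 *.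
  by rewrite (le_trans (sin_ge_half x0 x1))// ler_norm.
rewrite (ltr0_norm x0) in x1 *; rewrite -normrN -sinN.
by rewrite (le_trans (sin_ge_half _ x1)) ?ler_norm// oppr_ge0 ltW.
Qed.

(** Two integrations by parts, written as an explicit primitive. *)
Lemma int_cos_wker N z : 0 < N -> z != 0 ->
  \int[lebesgue_measure]_(x in `[(- N), N]) ((1 - x * x / (N * N)) * cos (x * z))
  = 4 / (N * N * (z * z)) * (sin (N * z) / z - N * cos (N * z)).
Proof.
move=> N0 z0; have NN : - N < N by lra.
pose F x := ((1 - x * x * (N * N)^-1) * sin (x * z)) * z^-1
  - (2 * (N * N)^-1 * (z * z)^-1 * x) * cos (x * z)
  + (2 * (N * N)^-1 * (z * z * z)^-1) * sin (x * z).
have dF x : isD x F ((1 - x * x / (N * N)) * cos (x * z)).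
  rewrite /F; apply: isD_eq.
    isD_tac.
  by rewrite /=; field; rewrite z0 lt0r_neq0.
rewrite (FTC_is_derive NN dF).
- by rewrite /F !mulNr !sinN !cosN; field; rewrite z0 lt0r_neq0.
- by move=> x; apply: isD_continuous; isD_tac.
Qed.

Lemma int_sin_wker N z : 0 < N -> z != 0 ->
  \int[lebesgue_measure]_(x in `[(- N), N]) ((1 - x * x / (N * N)) * sin (x * z)) = 0.
Proof.
move=> N0 z0; have NN : - N < N by lra.
pose F x := - 1 * ((1 - x * x * (N * N)^-1) * cos (x * z)) * z^-1
  - (2 * (N * N)^-1 * (z * z)^-1 * x) * sin (x * z)
  - (2 * (N * N)^-1 * (z * z * z)^-1) * cos (x * z).
have dF x : isD x F ((1 - x * x / (N * N)) * sin (x * z)).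
  rewrite /F; apply: isD_eq.
    isD_tac.
  by rewrite /=; field; rewrite z0 lt0r_neq0.
rewrite (FTC_is_derive NN dF).
- by rewrite /F !mulNr !sinN !cosN; field; rewrite z0 lt0r_neq0.
- by move=> x; apply: isD_continuous; isD_tac.
Qed.

(** A cutoff that vanishes at the end points of [-N, N], so that its Fourier
    transform decays quadratically and is integrable; since it is polynomial in
    between, the transform is elementary. *)
Definition wker N x : R := Num.max 0 (1 - x * x / (N * N)).

(** An approximate identity: bker N is a dilate of 16 / (1 + z^2), so that its
    integral does not depend on N. *)
Definition bker N z : R := 16 * (N / (1 + z * N * (z * N))).

Lemma wkerE N : 0 < N ->
  wker N = (fun x => 1 - x * x / (N * N)) \_ `[(- N), N].
Proof.
move=> N0; apply/funext => x; rewrite /wker patchE.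
have NN : 0 < N * N by rewrite mulr_gt0.
have h : (0 <= 1 - x * x / (N * N)) = (`|x| <= N).
  rewrite subr_ge0 ler_pdivrMr// mul1r -!expr2 -[x ^+ 2]real_normK ?num_real//.
  by rewrite ler_sqr ?nnegrE// ltW.
case: ifPn; rewrite mem_setE in_itv/= -ler_norml -h => H.
  by rewrite max_r.
by rewrite max_l; [|rewrite ltW// ltNge].
Qed.

Lemma wker_ge0 N x : 0 <= wker N x.
Proof. by rewrite /wker le_max lexx. Qed.

Lemma wker_le1 N x : wker N x <= 1.
Proof.
rewrite /wker ge_max ler01/= gerBl mulr_ge0//; first by rewrite -expr2 sqr_ge0.
by rewrite invr_ge0 -expr2 sqr_ge0.
Qed.

Lemma measurable_wker N : measurable_fun [set: measurableTypeR R] (wker N).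
Proof.
apply: measurable_maxr => //; apply: measurable_funB => //.
by apply: measurable_funM => //; apply: measurable_funM.
Qed.

Lemma lebesgue_symitv N : 0 < N ->
  lebesgue_measure (`[(- N), N]%classic : set (measurableTypeR R)) = (N + N)%:E.
Proof.
move=> N0; rewrite lebesgue_measure_itv/= lte_fin ifT; last by lra.
by rewrite -EFinB opprK.
Qed.

Lemma integrable_wker N : 0 < N ->
  (@lebesgue_measure R).-integrable setT (EFin \o wker N).
Proof.
move=> N0.
have ii := @integrable_indic_itv R (- N) N true false.
apply: (le_integrable measurableT _ _ ii).
- by apply/measurable_EFinP; exact: measurable_wker.
- move=> x _; rewrite /= lee_fin ger0_norm ?wker_ge0// indicE wkerE// patchE.
  case: ifPn => [xN|_]; last by rewrite normr0.
  rewrite normr1 gerBl mulr_ge0//; first by rewrite -expr2 sqr_ge0.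
  by rewrite invr_ge0 -expr2 sqr_ge0.
Qed.

Lemma Rintegral_wker N (g : R -> R) : 0 < N ->
  \int[lebesgue_measure]_x (wker N x * g x) =
  \int[lebesgue_measure]_(x in `[(- N), N]) ((1 - x * x / (N * N)) * g x).
Proof.
move=> N0; rewrite [RHS]Rintegral_mkcond; apply: eq_Rintegral => x _.
by rewrite wkerE// !patchE; case: ifPn => // _; rewrite mul0r.
Qed.

Lemma Rintegral_wker_sin N z : 0 < N ->
  \int[lebesgue_measure]_x (wker N x * sin (x * z)) = 0.
Proof.
move=> N0; rewrite Rintegral_wker//.
have [->|z0] := eqVneq z 0; last exact: int_sin_wker.
under eq_Rintegral do rewrite mulr0 sin0 mulr0.
by rewrite Rintegral_cst// mul0r.
Qed.

(** For |z N| <= 1 the trivial bound 2 N suffices. Otherwise the explicit value of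
    the integral decays as 8 / (N z^2), because the window vanishes at the end
    points -N and N. *)
Lemma le_Rintegral_wker_cos N z : 0 < N ->
  `|\int[lebesgue_measure]_x (wker N x * cos (x * z))| <= bker N z.
Proof.
move=> N0; have N1 : `|\int[lebesgue_measure]_x (wker N x * cos (x * z))| <= 2 * N.
  have ii := @integrable_indic_itv R (- N) N true false.
  have ic : (@lebesgue_measure R).-integrable setT
      (EFin \o (fun x => wker N x * cos (x * z))).
    apply: (le_integrable measurableT _ _ (integrable_wker N0)).
      apply/measurable_EFinP; apply: measurable_funM; first exact: measurable_wker.
      exact: continuous_measurable_fun (@continuous_cos_lin z).
    by move=> x _; rewrite /= lee_fin normrM ler_piMr// cos_max.
  apply: (le_trans (le_normr_Rintegral _ ic)) => //.
  apply: (@le_trans _ _ (\int[lebesgue_measure]_x \1_(`[(- N), N]%classic) x)).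
    apply: le_Rintegral => //; first exact: (integrable_norm ic).
    move=> x _; rewrite /= indicE wkerE// patchE normrM.
    case: ifPn => [xN|_]; last by rewrite normr0 mul0r.
    have := wker_ge0 N x; have := wker_le1 N x; rewrite wkerE// patchE xN.
    by move=> ? ?; rewrite mulr_ile1// ?cos_max// ger0_norm.
  rewrite /Rintegral integral_indic// setIT [X in fine X]lebesgue_symitv//=.
  by rewrite mulr_natl mulr2n.
have NN : 0 < N * N by rewrite mulr_gt0.
have [zN|zN] := leP (`|z * N|) 1.
  apply: (le_trans N1); rewrite /bker -expr2.
  have d2 : (z * N) ^+ 2 <= 1 by rewrite -[leLHS]real_normK ?num_real// expr_le1.
  have d0 : 0 <= (z * N) ^+ 2 by exact: sqr_ge0.
  rewrite mulrA ler_pdivlMr; last by lra.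
  by move: (_ ^+ 2) d0 d2 => s s0 s1; nra.
have z0 : z != 0 by apply/eqP => z0; move: zN; rewrite z0 mul0r normr0 ltr10.
rewrite Rintegral_wker// int_cos_wker//.
have z2 : 0 < z * z by rewrite -expr2 exprn_even_gt0.
have e1 : `|sin (N * z) / z - N * cos (N * z)| <= 2 * N.
  apply: (le_trans (ler_normB _ _)); rewrite mulr_natl mulr2n lerD//.
    rewrite normrM normfV ler_pdivrMr ?normr_gt0//.
    by rewrite (le_trans (normr_sin_le _))// normrM (gtr0_norm N0).
  by rewrite normrM (gtr0_norm N0) ler_piMr ?(ltW N0)// cos_max.
rewrite normrM ger0_norm; last by rewrite divr_ge0// mulr_ge0 ?ltW.
apply: (@le_trans _ _ (4 / (N * N * (z * z)) * (2 * N))).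
  by rewrite ler_wpM2l// divr_ge0// mulr_ge0 ?ltW.
have d1 : 1 < (z * N) ^+ 2 by rewrite -[ltRHS]real_normK ?num_real// expr_gt1.
have -> : 4 / (N * N * (z * z)) * (2 * N) = 8 * N / (z * N) ^+ 2.
  by field; rewrite z0 lt0r_neq0.
rewrite /bker -expr2 mulrA ler_pdivrMr; last by lra.
rewrite mulrAC ler_pdivlMr; last by lra.
by move: (_ ^+ 2) d1 => s s1; nra.
Qed.

Lemma bker_ge0 N z : 0 <= N -> 0 <= bker N z.
Proof.
by move=> N0; rewrite mulr_ge0// divr_ge0// addr_ge0// -expr2 sqr_ge0.
Qed.

Lemma continuous_bker N : continuous (bker N).
Proof.
move=> x; rewrite /bker; apply: cvgM; first exact: cvg_cst.
apply: cvgM; first exact: cvg_cst.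
apply: cvgV; first by rewrite lt0r_neq0// ltr_pwDl// -expr2 sqr_ge0.
have : {for x, continuous (fun z => 1 + z * N * (z * N))}.
  by apply: isD_continuous; isD_tac.
by [].
Qed.

Lemma measurable_bker N : measurable_fun [set: measurableTypeR R] (bker N).
Proof. exact: continuous_measurable_fun (@continuous_bker N). Qed.

(** The function 16 * atan (N x) is a primitive of bker N. *)
Lemma integral_bker N (y : R) : 0 < N ->
  (\int[@lebesgue_measure R]_x (bker N (x - y))%:E = (16 * pi)%:E)%E.
Proof.
move=> N0; rewrite (@ge0_integral_shift R (- y) (EFin \o bker N)); last 2 first.
- by apply/measurable_EFinP; exact: measurable_bker.
- by move=> x; rewrite lee_fin bker_ge0// ltW.
rewrite ge0_symfun_integralT; last 3 first.
- by move=> x; rewrite bker_ge0// ltW.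
- exact: continuous_bker.
- by move=> x; rewrite /bker/= !mulNr mulrN opprK.
have -> : [set x : R | 0 <= x] = `[0, +oo[%classic.
  by apply/seteqP; split=> x /=; rewrite in_itv/= andbT.
have dF x : isD x (fun x => 16 * atan (x * N)) (bker N x).
  apply: isD_eq; first apply: isDM (isDcst _ _) _.
    exact: (is_derive1_comp (is_derive1_atan _) (isD_lin x N)).
  by rewrite /bker mul0r add0r mulrC expr2; ring.
rewrite (@ge0_continuous_FTC2y _ _ (fun x => 16 * atan (x * N)) 0 (16 * (pi / 2))).
- by rewrite mul0r atan0 mulr0 sube0 -EFinM; congr EFin; field.
- by move=> x _; rewrite bker_ge0// ltW.
- by apply: continuous_subspaceT; exact: continuous_bker.
- apply: cvgM; first exact: cvg_cst.
  apply: (@cvg_comp _ _ _ (fun x => x * N) atan _ (pinfty_nbhs R)); last exact: cvgy_atan.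
  by apply: gt0_cvgMly => //; exact: cvg_id.
- by move=> x _; have := dF x; rewrite /isD => ?; exact: ex_derive.
- by apply: cvg_at_right_filter; exact: isD_continuous (dF 0).
- by move=> x _; rewrite derive1E; have := dF x; rewrite /isD => ?; exact: derive_val.
Qed.
End real_calculus.

(** * The window on row vectors and its transform *)
Section window_rV.
Context {R : realType}.
Implicit Types (n : nat) (N : R).

Lemma Rintegral_rVS n (f : 'rV[R]_n.+1 -> R) (g : measurableTypeR R -> R) (h : 'rV[R]_n -> R) :
  measurable_fun setT f ->
  (@lebesgue_measure R).-integrable setT (EFin \o g) ->
  (lebesgue_rV R n).-integrable setT (EFin \o h) ->
  (forall x v, `|f (cons_rV (x, v))| <= g x * h v) ->
  \int[lebesgue_rV R n.+1]_x f x =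
  \int[lebesgue_measure]_x (\int[lebesgue_rV R n]_v f (cons_rV (x, v))).
Proof.
move=> mf ig ih fgh.
have mfc : measurable_fun setT (f \o @cons_rV R n).
  by apply: measurableT_comp => //; exact: measurable_cons_rV.
rewrite -(@Rintegral_prod_dominated R _ _ _ _ _ (lebesgue_rV R n) (f \o @cons_rV R n) g h)//.
rewrite /Rintegral; congr fine.
rewrite [LHS](@integral_pushforward _ _ _ _ _ _ (@measurable_cons_rV R n))//.
- exact/measurable_EFinP.
- by apply: (integrable_dominated (g := g) (h := h)).
Qed.

Lemma dotp_cons n (x : R) (v : 'rV[R]_n) (z : 'rV[R]_n.+1) :
  dotp (cons_rV (x, v)) z = x * z ord0 ord0 + dotp v (\row_i z ord0 (lift ord0 i)).
Proof.
rewrite /dotp big_ord_recl mxE unlift_none/=; congr (_ + _).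
by apply: eq_bigr => i _; rewrite !mxE liftK.
Qed.

Let prod_cons n (g : R -> R) (x : R) (v : 'rV[R]_n) :
  \prod_i g (cons_rV (x, v) ord0 i) = g x * \prod_i g (v ord0 i).
Proof.
rewrite big_ord_recl mxE unlift_none/=; congr (_ * _).
by apply: eq_bigr => i _; rewrite !mxE liftK.
Qed.

Lemma measurable_dotpl n (z : 'rV[R]_n) : measurable_fun setT (fun x : 'rV[R]_n => dotp x z).
Proof.
apply: measurable_sum => i; apply: measurable_funM => //.
exact: measurable_coord.
Qed.

Definition window n N (x : 'rV[R]_n) : R := \prod_i wker N (x ord0 i).

Lemma window_ge0 n N (x : 'rV[R]_n) : 0 <= window N x.
Proof. by apply: prodr_ge0 => i _; exact: wker_ge0. Qed.

Lemma measurable_window n N : measurable_fun [set: 'rV[R]_n] (@window n N).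
Proof. exact: (measurable_prod_coord (fun=> measurable_wker N)). Qed.

Lemma integrable_window n N : 0 < N ->
  (lebesgue_rV R n).-integrable setT (EFin \o @window n N).
Proof.
move=> N0; apply/integrableP; split; first by apply/measurable_EFinP; exact: measurable_window.
under eq_integral => x _ do rewrite gee0_abs ?lee_fin ?window_ge0//.
rewrite (@ge0_integral_prod R n (fun=> wker N)
  (fun=> \int[lebesgue_measure]_x wker N x)) ?ltry//.
- by move=> _; exact: measurable_wker.
- by move=> _ x; exact: wker_ge0.
- move=> _; rewrite /Rintegral fineK//.
  exact: (integrable_fin_num measurableT (integrable_wker N0)).
Qed.

(** The Fourier transform of the window wker N, which is real by parity. *)
Definition cker N (z : R) : R := \int[lebesgue_measure]_x (wker N x * cos (x * z)).

Lemma measurable_cos_dotp n (z : 'rV[R]_n) : measurable_fun setT (fun x : 'rV[R]_n => cos (dotp x z)).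
Proof.
apply: measurableT_comp; last exact: measurable_dotpl.
exact: continuous_measurable_fun (@continuous_cos R).
Qed.

Lemma measurable_sin_dotp n (z : 'rV[R]_n) : measurable_fun setT (fun x : 'rV[R]_n => sin (dotp x z)).
Proof.
apply: measurableT_comp; last exact: measurable_dotpl.
exact: continuous_measurable_fun (@continuous_sin R).
Qed.

Lemma window_cons n N (x : R) (v : 'rV[R]_n) :
  window N (cons_rV (x, v)) = wker N x * window N v.
Proof. exact: prod_cons. Qed.

Lemma integrableM1 d (T : measurableType d) (mu : {measure set T -> \bar R})
    (f g : T -> R) : mu.-integrable setT (EFin \o f) -> measurable_fun setT g ->
  (forall x, `|g x| <= 1) -> mu.-integrable setT (EFin \o (fun x => f x * g x)).
Proof.
move=> fi mg g1.
have mf : measurable_fun setT f by apply/measurable_EFinP; case/integrableP: fi.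
apply: (le_integrable measurableT _ _ fi).
  by apply/measurable_EFinP; exact: measurable_funM.
by move=> x _; rewrite /= lee_fin normrM ler_piMr.
Qed.

(** The addition formulas and the factorization of the window give both integrals
    by a common induction on the dimension. *)
Lemma Rintegral_window n N (z : 'rV[R]_n) : 0 < N ->
  \int[lebesgue_rV R n]_x (window N x * cos (dotp x z)) = \prod_i cker N (z ord0 i) /\
  \int[lebesgue_rV R n]_x (window N x * sin (dotp x z)) = 0.
Proof.
move=> N0; elim: n z => [|n IH] z.
  rewrite /Rintegral !integral_dirac// ?diracT ?mul1e/=; last 2 first.
    by apply/measurable_EFinP/measurable_funM; [exact: measurable_window|exact: measurable_sin_dotp].
    by apply/measurable_EFinP/measurable_funM; [exact: measurable_window|exact: measurable_cos_dotp].
  by rewrite /window /dotp !big_ord0 cos0 sin0 mulr0 mulr1.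
pose z' : 'rV[R]_n := \row_i z ord0 (lift ord0 i).
have iw := integrable_wker N0. have iW := integrable_window n N0.
have [IHc IHs] := IH z'.
have iWc : (lebesgue_rV R n).-integrable setT
    (EFin \o (fun x => window N x * cos (dotp x z'))).
  by apply: integrableM1 => //; [exact: measurable_cos_dotp|move=> x; exact: cos_max].
have iWs : (lebesgue_rV R n).-integrable setT
    (EFin \o (fun x => window N x * sin (dotp x z'))).
  by apply: integrableM1 => //; [exact: measurable_sin_dotp|move=> x; exact: sin_max].
have iwc : (@lebesgue_measure R).-integrable setT
    (EFin \o (fun x => wker N x * cos (x * z ord0 ord0))).
  apply: integrableM1 => //; last by move=> x; exact: cos_max.
  exact: continuous_measurable_fun (@continuous_cos_lin R (z ord0 ord0)).
have iws : (@lebesgue_measure R).-integrable setT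
    (EFin \o (fun x => wker N x * sin (x * z ord0 ord0))).
  apply: integrableM1 => //; last by move=> x; exact: sin_max.
  exact: continuous_measurable_fun (@continuous_sin_lin R (z ord0 ord0)).
have dom (g : R -> R) : (forall t, `|g t| <= 1) -> forall (x : R) (v : 'rV[R]_n),
    `|window N (cons_rV (x, v)) * g (dotp (cons_rV (x, v)) z)| <= wker N x * window N v.
  move=> g1 x v; rewrite normrM window_cons.
  have w0 : 0 <= wker N x * window N v by rewrite mulr_ge0 ?wker_ge0 ?window_ge0.
  by rewrite (ger0_norm w0) ler_piMr.
split.
- rewrite (Rintegral_rVS _ iw iW); last 2 first.
  + by apply: measurable_funM; [exact: measurable_window|exact: measurable_cos_dotp].
  + by apply: dom; exact: cos_max.
  under eq_Rintegral => x _.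
    under eq_Rintegral => v _.
      rewrite dotp_cons cosD window_cons.
      rewrite (_ : _ * _ = wker N x * cos (x * z ord0 ord0) * (window N v * cos (dotp v z'))
        - wker N x * sin (x * z ord0 ord0) * (window N v * sin (dotp v z'))); last by ring.
      over.
    rewrite RintegralB//; last 2 first.
    + exact: (integrableZl measurableT _ iWc).
    + exact: (integrableZl measurableT _ iWs).
    rewrite !RintegralZl// IHc IHs mulr0 subr0.
    over.
  rewrite RintegralZr// big_ord_recl; congr (_ * _).
  by apply: eq_bigr => i _; rewrite mxE.
- rewrite (Rintegral_rVS _ iw iW); last 2 first.
  + by apply: measurable_funM; [exact: measurable_window|exact: measurable_sin_dotp].
  + by apply: dom; exact: sin_max.
  under eq_Rintegral => x _.
    under eq_Rintegral => v _.
      rewrite dotp_cons sinD window_cons.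
      rewrite (_ : _ * _ = wker N x * sin (x * z ord0 ord0) * (window N v * cos (dotp v z'))
        + wker N x * cos (x * z ord0 ord0) * (window N v * sin (dotp v z'))); last by ring.
      over.
    rewrite RintegralD//; last 2 first.
    + exact: (integrableZl measurableT _ iWc).
    + exact: (integrableZl measurableT _ iWs).
    rewrite !RintegralZl// IHc IHs mulr0 addr0.
    over.
  by rewrite RintegralZr// Rintegral_wker_sin// mul0r.
Qed.

End window_rV.

(** * Cosine and sine transforms *)
Section parametric_Rintegral.
Context {R : realType} d1 d2 (T1 : measurableType d1) (T2 : measurableType d2).

Lemma measurable_Rintegral (m2 : {sigma_finite_measure set T2 -> \bar R}) (f : T1 * T2 -> R) :
  measurable_fun setT f -> measurable_fun setT (fun x => \int[m2]_y f (x, y)).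
Proof.
move=> mf; rewrite /Rintegral.
apply: (measurableT_comp (@fine_measurable R setT measurableT)).
have mf' : measurable_fun setT (EFin \o f) by exact/measurable_EFinP.
under eq_fun do rewrite integralE.
apply: emeasurable_funB.
- have := @measurable_fun_fubini_tonelli_F _ _ T1 T2 R m2 _ (measurable_funepos mf') (funepos_ge0 _).
  apply: eq_measurable_fun => x _; rewrite /fubini_F; apply: eq_integral => y _.
  by rewrite !funeposE.
- have := @measurable_fun_fubini_tonelli_F _ _ T1 T2 R m2 _ (measurable_funeneg mf') (funeneg_ge0 _).
  apply: eq_measurable_fun => x _; rewrite /fubini_F; apply: eq_integral => y _.
  by rewrite !funenegE.
Qed.

Lemma integrable_Rintegral2 (m1 : {sigma_finite_measure set T1 -> \bar R})
    (m2 : {sigma_finite_measure set T2 -> \bar R})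
    (f : T1 * T2 -> R) (g : T1 -> R) (h : T2 -> R) :
  measurable_fun setT f -> m1.-integrable setT (EFin \o g) ->
  m2.-integrable setT (EFin \o h) -> (forall x y, `|f (x, y)| <= g x * h y) ->
  m2.-integrable setT (fun y => (\int[m1]_x f (x, y))%:E).
Proof.
move=> mf ig ih fgh.
apply: (@integrable_Rintegral1 _ _ _ _ _ m2 m1 (fun z => f (z.2, z.1)) h g) => //.
- by apply: (measurableT_comp mf); exact: (measurable_fun_pair measurable_snd measurable_fst).
- by move=> y x; rewrite mulrC; exact: fgh.
Qed.

End parametric_Rintegral.

Section real_transforms.
Context {R : realType} {n : nat}.
Local Notation X := 'rV[R]_n.
Local Notation mu := (lebesgue_rV R n).
Implicit Types (a b : X -> R) (x y xi : X).

Lemma dotpC x y : dotp x y = dotp y x.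
Proof. by apply: eq_bigr => i _; rewrite mulrC. Qed.

Lemma dotpBr x y xi : dotp xi (x - y) = dotp xi x - dotp xi y.
Proof.
rewrite /dotp -sumrB; apply: eq_bigr => i _.
by rewrite !mxE mulrBr.
Qed.

Lemma dotpDr x y xi : dotp xi (x + y) = dotp xi x + dotp xi y.
Proof.
rewrite /dotp -big_split; apply: eq_bigr => i _.
by rewrite !mxE mulrDr.
Qed.

Definition costr a xi : R := \int[mu]_x (a x * cos (dotp xi x)).
Definition sintr a xi : R := \int[mu]_x (a x * sin (dotp xi x)).

Lemma measurable_dotp : measurable_fun setT (fun z : X * X => dotp z.1 z.2).
Proof.
apply: measurable_sum => i; apply: measurable_funM.
- exact: (measurableT_comp (measurable_coord i) measurable_fst).
- exact: (measurableT_comp (measurable_coord i) measurable_snd).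
Qed.

Lemma measurable_cos_dotp2 : measurable_fun setT (fun z : X * X => cos (dotp z.1 z.2)).
Proof.
exact: (measurableT_comp (continuous_measurable_fun (@continuous_cos R)) measurable_dotp).
Qed.

Lemma measurable_sin_dotp2 : measurable_fun setT (fun z : X * X => sin (dotp z.1 z.2)).
Proof.
exact: (measurableT_comp (continuous_measurable_fun (@continuous_sin R)) measurable_dotp).
Qed.

Lemma measurable_costr a : measurable_fun setT a -> measurable_fun setT (costr a).
Proof.
move=> ma; apply: (@measurable_Rintegral _ _ _ _ _ mu (fun z => a z.2 * cos (dotp z.1 z.2))).
apply: measurable_funM; last exact: measurable_cos_dotp2.
exact: (measurableT_comp ma measurable_snd).
Qed.

Lemma measurable_sintr a : measurable_fun setT a -> measurable_fun setT (sintr a).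
Proof.
move=> ma; apply: (@measurable_Rintegral _ _ _ _ _ mu (fun z => a z.2 * sin (dotp z.1 z.2))).
apply: measurable_funM; last exact: measurable_sin_dotp2.
exact: (measurableT_comp ma measurable_snd).
Qed.

Let integrable_measurable a : mu.-integrable setT (EFin \o a) -> measurable_fun setT a.
Proof. by move=> /integrableP[/measurable_EFinP]. Qed.

Lemma integrable_acos a xi : mu.-integrable setT (EFin \o a) ->
  mu.-integrable setT (EFin \o (fun x => a x * cos (dotp xi x))).
Proof.
move=> ia; apply: integrableM1 => //; last by move=> x; exact: cos_max.
exact: (measurableT_comp measurable_cos_dotp2 (pair1_measurable xi)).
Qed.

Lemma integrable_asin a xi : mu.-integrable setT (EFin \o a) ->
  mu.-integrable setT (EFin \o (fun x => a x * sin (dotp xi x))).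
Proof.
move=> ia; apply: integrableM1 => //; last by move=> x; exact: sin_max.
exact: (measurableT_comp measurable_sin_dotp2 (pair1_measurable xi)).
Qed.

Let le_transform (g : R -> R) a xi : (forall t, `|g t| <= 1) ->
  mu.-integrable setT (EFin \o a) ->
  mu.-integrable setT (EFin \o (fun x => a x * g (dotp xi x))) ->
  `|\int[mu]_x (a x * g (dotp xi x))| <= \int[mu]_x `|a x|.
Proof.
move=> g1 ia iag; apply: (le_trans (le_normr_Rintegral _ iag)) => //.
apply: le_Rintegral => //; [exact: (integrable_norm iag)|exact: (integrable_norm ia)|].
by move=> x _; rewrite normrM ler_piMr.
Qed.

Lemma le_costr a xi : mu.-integrable setT (EFin \o a) ->
  `|costr a xi| <= \int[mu]_x `|a x|.
Proof.
by move=> ia; apply: le_transform => //; [exact: cos_max|exact: integrable_acos].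
Qed.

Lemma le_sintr a xi : mu.-integrable setT (EFin \o a) ->
  `|sintr a xi| <= \int[mu]_x `|a x|.
Proof.
by move=> ia; apply: le_transform => //; [exact: sin_max|exact: integrable_asin].
Qed.

(** By Rintegral_window, kernel N is the transform of the window on row vectors. *)
Definition kernel N (z : X) : R := \prod_i cker N (z ord0 i).
Definition bkernel N (z : X) : R := \prod_i bker N (z ord0 i).

Lemma le_kernel N z : 0 < N -> `|kernel N z| <= bkernel N z.
Proof.
move=> N0; rewrite /kernel normr_prod; apply: ler_prod => i _.
by rewrite normr_ge0 le_Rintegral_wker_cos.
Qed.

Lemma bkernel_ge0 N z : 0 <= N -> 0 <= bkernel N z.
Proof. by move=> N0; apply: prodr_ge0 => i _; exact: bker_ge0. Qed.

Lemma bkernelN N z : bkernel N (- z) = bkernel N z.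
Proof.
by apply: eq_bigr => i _; rewrite mxE /bker !mulNr mulrN opprK.
Qed.

Lemma measurable_bkernel2 N : measurable_fun setT (fun z : X * X => bkernel N (z.1 - z.2)).
Proof.
apply: measurable_prod => i _.
under eq_fun do rewrite !mxE.
apply: (measurableT_comp (measurable_bker N)); apply: measurable_funB.
- exact: (measurableT_comp (measurable_coord i) measurable_fst).
- exact: (measurableT_comp (measurable_coord i) measurable_snd).
Qed.

Lemma integral_bkernel N y : 0 < N ->
  (\int[mu]_x (bkernel N (x - y))%:E = ((16 * pi) ^+ n)%:E)%E.
Proof.
move=> N0.
have -> : (16 * pi) ^+ n = \prod_(i < n) (16 * pi : R) by rewrite prodr_const card_ord.
rewrite -(@ge0_integral_prod R n (fun i t => bker N (t - y ord0 i)) (fun=> 16 * pi)).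
- by apply: eq_integral => x _; congr EFin; apply: eq_bigr => i _; rewrite !mxE.
- move=> i; apply: (measurableT_comp (measurable_bker N)).
  exact: measurable_funB.
- by move=> i t; rewrite bker_ge0// ltW.
- by move=> i; exact: integral_bker.
Qed.

End real_transforms.

(** * A Plancherel-type inequality *)
Lemma integrableMb (R : realType) d (T : measurableType d)
    (mu : {measure set T -> \bar R}) (f g : T -> R) (c : R) :
  mu.-integrable setT (EFin \o f) -> measurable_fun setT g ->
  (forall x, `|g x| <= c) -> mu.-integrable setT (EFin \o (fun x => f x * g x)).
Proof.
move=> fi mg g1.
have mf : measurable_fun setT f by apply/measurable_EFinP; case/integrableP: fi.
have fi' : mu.-integrable setT (EFin \o (fun x => c * f x)).
  exact: (integrableZl measurableT _ fi).
apply: (le_integrable measurableT _ _ fi').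
  by apply/measurable_EFinP; exact: measurable_funM.
move=> x _; rewrite /= lee_fin !normrM mulrC ler_wpM2r//.
by rewrite (le_trans (g1 x))// ler_norm.
Qed.

Section plancherel_bound.
Context {R : realType} {n : nat}.
Local Notation X := 'rV[R]_n.
Local Notation mu := (lebesgue_rV R n).
Variable a : X -> R.
Hypothesis ia : mu.-integrable setT (EFin \o a).

Let ma : measurable_fun setT a.
Proof. by case/integrableP: ia => /measurable_EFinP. Qed.

Let ina : mu.-integrable setT (EFin \o (fun x => `|a x|)).
Proof. exact: (integrable_norm ia). Qed.

Let A := \int[mu]_x `|a x|.
Let A0 : 0 <= A. Proof. by apply: Rintegral_ge0. Qed.

(** The squared modulus of the Fourier transform of the real function a. *)
Let power xi := costr a xi ^+ 2 + sintr a xi ^+ 2.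

(** The integral over y of a y * cos (dotp xi (x - y)). *)
Let pair_term xi x := cos (dotp xi x) * costr a xi + sin (dotp xi x) * sintr a xi.

Let power_Rintegral xi : power xi = \int[mu]_x (a x * pair_term xi x).
Proof.
have ic := integrable_acos xi ia. have is_ := integrable_asin xi ia.
rewrite /pair_term; under eq_Rintegral => x _.
  rewrite mulrDr !mulrA; over.
rewrite RintegralD//; last 2 first.
- exact: (integrableZr measurableT (costr a xi) ic).
- exact: (integrableZr measurableT (sintr a xi) is_).
by rewrite !RintegralZr// /power !expr2.
Qed.

Let le_pair_term xi x : `|pair_term xi x| <= 2 * A.
Proof.
rewrite (le_trans (ler_normD _ _))// !normrM mulr_natl mulr2n lerD//.
- rewrite -[leRHS]mul1r ler_pM//; first exact: cos_max.
  exact: le_costr.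
- rewrite -[leRHS]mul1r ler_pM//; first exact: sin_max.
  exact: le_sintr.
Qed.

Section fixed_window.
Variable N : R.
Hypothesis N0 : 0 < N.

Let iW := integrable_window n N0.

Let G (z : X * X) := window N z.1 * (a z.2 * pair_term z.1 z.2).

Let mG : measurable_fun setT G.
Proof.
apply: measurable_funM; first exact: (measurableT_comp (measurable_window N) measurable_fst).
apply: measurable_funM; first exact: (measurableT_comp ma measurable_snd).
apply: measurable_funD; apply: measurable_funM.
- exact: measurable_cos_dotp2.
- exact: (measurableT_comp (measurable_costr ma) measurable_fst).
- exact: measurable_sin_dotp2.
- exact: (measurableT_comp (measurable_sintr ma) measurable_fst).
Qed.

Let ina2 : mu.-integrable setT (EFin \o (fun x => `|a x| * (2 * A))).
Proof. exact: (integrableZr measurableT (2 * A) ina). Qed.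

Let domG x y : `|G (x, y)| <= window N x * (`|a y| * (2 * A)).
Proof.
rewrite /G/= normrM ger0_norm ?window_ge0// ler_wpM2l ?window_ge0//.
by rewrite normrM ler_wpM2l// le_pair_term.
Qed.

Let H x (z : X * X) := window N z.1 * (a z.2 * cos (dotp z.1 (x - z.2))).

Let mH x : measurable_fun setT (H x).
Proof.
apply: measurable_funM; first exact: (measurableT_comp (measurable_window N) measurable_fst).
apply: measurable_funM; first exact: (measurableT_comp ma measurable_snd).
apply: (measurableT_comp (continuous_measurable_fun (@continuous_cos R))).
under eq_fun do rewrite dotpBr.
apply: measurable_funB; last exact: measurable_dotp.
by apply: (measurableT_comp (measurable_dotpl x) measurable_fst).
Qed.

Let domH x y z : `|H x (y, z)| <= window N y * `|a z|.
Proof.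
rewrite /H/= normrM ger0_norm ?window_ge0// ler_wpM2l ?window_ge0//.
by rewrite normrM ler_piMr// cos_max.
Qed.

(** Integrated against the window in xi, the cosine in the integral that pair_term
    represents becomes the kernel. *)
Let pair_term_window x : \int[mu]_xi (window N xi * pair_term xi x) =
  \int[mu]_y (a y * kernel N (x - y)).
Proof.
transitivity (\int[mu]_xi \int[mu]_y H x (xi, y)).
  apply: eq_Rintegral => xi _.
  have ic := integrable_acos xi ia. have is_ := integrable_asin xi ia.
  rewrite /H /= RintegralZl//; last first.
    apply: integrableM1 => //; last by move=> y; exact: cos_max.
    apply: (measurableT_comp (continuous_measurable_fun (@continuous_cos R))).
    under eq_fun do rewrite dotpBr.
    apply: measurable_funB => //.
    exact: (measurableT_comp measurable_dotp (pair1_measurable xi)).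
  congr (_ * _); rewrite /pair_term.
  rewrite /costr /sintr -!RintegralZl// -RintegralD//; last 2 first.
  - exact: (integrableZl measurableT _ ic).
  - exact: (integrableZl measurableT _ is_).
  apply: eq_Rintegral => y _; rewrite dotpBr cosB; ring.
rewrite (Rfubini_dominated (mH x) iW ina (domH x)).
apply: eq_Rintegral => y _; rewrite /H/=.
rewrite /kernel -(Rintegral_window (x - y) N0).1 -RintegralZl//; last first.
  apply: integrableM1 => //; last by move=> z; exact: cos_max.
  exact: measurable_cos_dotp.
by apply: eq_Rintegral => xi _; ring.
Qed.

Let mpair1 xi : measurable_fun setT (pair_term xi).
Proof.
apply: measurable_funD; apply: measurable_funM => //.
- exact: (measurableT_comp measurable_cos_dotp2 (pair1_measurable xi)).
- exact: (measurableT_comp measurable_sin_dotp2 (pair1_measurable xi)).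
Qed.

Let mpair2 x : measurable_fun setT (pair_term^~ x).
Proof.
apply: measurable_funD; apply: measurable_funM.
- exact: (measurableT_comp measurable_cos_dotp2 (pair2_measurable x)).
- exact: measurable_costr.
- exact: (measurableT_comp measurable_sin_dotp2 (pair2_measurable x)).
- exact: measurable_sintr.
Qed.

Let S x := \int[mu]_y (a y * kernel N (x - y)).

Let GS x : \int[mu]_xi G (xi, x) = a x * S x.
Proof.
rewrite /S -pair_term_window -RintegralZl//.
  by apply: eq_Rintegral => xi _; rewrite /G/=; ring.
exact: (integrableMb iW (mpair2 x) (fun xi => le_pair_term xi x)).
Qed.

Let power_window : \int[mu]_xi (window N xi * power xi) =
  \int[mu]_x (a x * S x).
Proof.
transitivity (\int[mu]_xi \int[mu]_x G (xi, x)).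
  apply: eq_Rintegral => xi _; rewrite power_Rintegral -RintegralZl//.
  exact: (integrableMb ia (mpair1 xi) (le_pair_term xi)).
rewrite (Rfubini_dominated mG iW ina2 domG).
by apply: eq_Rintegral => x _; exact: GS.
Qed.

Let iaS : mu.-integrable setT (EFin \o (fun x => a x * S x)).
Proof.
have := integrable_Rintegral2 mG iW ina2 domG.
by apply: eq_integrable => // x _; rewrite GS.
Qed.

Let iaK x : mu.-integrable setT (EFin \o (fun y => a y * kernel N (x - y))).
Proof.
have := integrable_Rintegral2 (mH x) iW ina (domH x).
apply: eq_integrable => // y _; rewrite /H/=; congr EFin.
rewrite /kernel -(Rintegral_window (x - y) N0).1 -RintegralZl//; last first.
  apply: integrableM1 => //; last by move=> z; exact: cos_max.
  exact: measurable_cos_dotp.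
by apply: eq_Rintegral => xi _; ring.
Qed.

Let B z := bkernel N (z.1 - z.2 : X).

Let B0 z : 0 <= B z. Proof. by rewrite bkernel_ge0// ltW. Qed.

Let mB : measurable_fun setT B. Proof. exact: measurable_bkernel2. Qed.

Let aB z := `|a z.1| * `|a z.2| * B z.
Let sqB1 z := a z.1 ^+ 2 / 2 * B z.
Let sqB2 z := a z.2 ^+ 2 / 2 * B z.

Let mna1 : measurable_fun setT (fun z : X * X => a z.1).
Proof. exact: (measurableT_comp ma measurable_fst). Qed.

Let mna2 : measurable_fun setT (fun z : X * X => a z.2).
Proof. exact: (measurableT_comp ma measurable_snd). Qed.

Let maB : measurable_fun setT (EFin \o aB).
Proof.
apply/measurable_EFinP; apply: measurable_funM => //.
by apply: measurable_funM; apply: measurableT_comp.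
Qed.

Let msqB1 : measurable_fun setT (EFin \o sqB1).
Proof.
apply/measurable_EFinP; apply: measurable_funM => //.
by apply: measurable_funM => //; exact: measurable_funX.
Qed.

Let msqB2 : measurable_fun setT (EFin \o sqB2).
Proof.
apply/measurable_EFinP; apply: measurable_funM => //.
by apply: measurable_funM => //; exact: measurable_funX.
Qed.

Let aB0 z : 0 <= aB z. Proof. by rewrite !mulr_ge0. Qed.
Let sqB10 z : 0 <= sqB1 z.
Proof. by rewrite /sqB1 mulr_ge0// divr_ge0// sqr_ge0. Qed.
Let sqB20 z : 0 <= sqB2 z.
Proof. by rewrite /sqB2 mulr_ge0// divr_ge0// sqr_ge0. Qed.

(* Schur's test is the inequality 2 |a x| |a y| <= a x ^ 2 + a y ^ 2. *)
Let le_aB z : aB z <= sqB1 z + sqB2 z.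
Proof.
rewrite -mulrDl ler_wpM2r//.
rewrite -[a z.1 ^+ 2]real_normK ?num_real// -[a z.2 ^+ 2]real_normK ?num_real//.
move: `|a z.1| `|a z.2| => s t; have := sqr_ge0 (s - t); nra.
Qed.

Let C := (16 * pi : R) ^+ n.

Local Open Scope ereal_scope.

Let C0 : 0 <= C%:E.
Proof. by rewrite lee_fin exprn_ge0// mulr_ge0// pi_ge0. Qed.

Let msq : measurable_fun setT (fun x => (a x ^+ 2 / 2)%:E).
Proof. by apply/measurable_EFinP; apply: measurable_funM => //; exact: measurable_funX. Qed.

Let sq0 x : 0 <= (a x ^+ 2 / 2)%:E.
Proof. by rewrite lee_fin divr_ge0// sqr_ge0. Qed.

Let int_sqB1 : \int[mu]_x \int[mu]_y (sqB1 (x, y))%:E =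
  C%:E * \int[mu]_x (a x ^+ 2 / 2)%:E.
Proof.
under eq_integral => x _.
  under eq_integral => y _ do rewrite EFinM/=.
  rewrite ge0_integralZl//; last 2 first.
  - by apply/measurable_EFinP; exact: (measurableT_comp mB (pair1_measurable x)).
  - by move=> y _; rewrite lee_fin.
  under eq_integral => y _ do rewrite /B/= -opprB bkernelN.
  rewrite integral_bkernel//.
  over.
rewrite ge0_integralZr//.
by rewrite muleC.
Qed.

Let int_sqB2 : \int[mu]_y \int[mu]_x (sqB2 (x, y))%:E =
  C%:E * \int[mu]_x (a x ^+ 2 / 2)%:E.
Proof.
under eq_integral => y _.
  under eq_integral => x _ do rewrite EFinM/=.
  rewrite ge0_integralZl//; last 2 first.
  - by apply/measurable_EFinP; exact: (measurableT_comp mB (pair2_measurable y)).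
  - by move=> x _; rewrite lee_fin.
  rewrite integral_bkernel//.
  over.
rewrite ge0_integralZr//.
by rewrite muleC.
Qed.

(** The double integral of a x * a y * kernel N (x - y) is dominated by the one of
    (a x ^ 2 + a y ^ 2) / 2 * bkernel N (x - y), in which one variable can be
    integrated out at the cost of the mass of bkernel N. *)
Lemma schur_window : (\int[mu]_xi (window N xi * power xi)%R)%:E <=
  C%:E * \int[mu]_x (a x ^+ 2)%:E.
Proof.
rewrite power_window.
apply: (@le_trans _ _ (`|\int[mu]_x (a x * S x)|%R%:E)).
  by rewrite lee_fin ler_norm.
rewrite (EFin_normr_Rintegral _ iaS)//.
apply: (le_trans (le_abse_integral mu measurableT _)).
  by case/integrableP: iaS.
have mF (f : X * X -> R) : measurable_fun setT (EFin \o f) -> (forall z, 0 <= f z)%R ->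
    measurable_fun setT (fun x => \int[mu]_y (f (x, y))%:E).
  move=> mf f0; apply: (@measurable_fun_fubini_tonelli_F _ _ _ _ _ mu _ mf).
  by move=> z; rewrite lee_fin.
apply: (@le_trans _ _ (\int[mu]_x \int[mu]_y (aB (x, y))%:E)).
  apply: ge0_le_integral => //.
  - by apply: measurableT_comp => //; case/integrableP: iaS.
  - exact: (mF aB).
  - move=> x _; rewrite /= normrM EFinM.
    rewrite (EFin_normr_Rintegral _ (iaK x))//.
    apply: (@le_trans _ _ (`|a x|%:E * \int[mu]_y `|(a y * kernel N (x - y))%:E|)).
      rewrite lee_wpmul2l//; apply: le_abse_integral => //.
      by case/integrableP: (iaK x).
    rewrite -ge0_integralZl//; last first.
      by apply: measurableT_comp => //; case/integrableP: (iaK x).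
    apply: ge0_le_integral => //.
    + apply: emeasurable_funM => //; apply: measurableT_comp => //.
      by case/integrableP: (iaK x).
    + exact: (measurableT_comp maB (pair1_measurable x)).
    + move=> y _; rewrite /= -EFinM lee_fin /aB/= -mulrA ler_wpM2l//.
      by rewrite normrM ler_wpM2l// le_kernel.
apply: (@le_trans _ _ (\int[mu]_x \int[mu]_y ((sqB1 (x, y))%:E + (sqB2 (x, y))%:E))).
  apply: ge0_le_integral => //.
  - by move=> x _; apply: integral_ge0 => y _; rewrite lee_fin.
  - exact: (mF aB).
  - apply: (mF (fun z => sqB1 z + sqB2 z)%R) => //.
      by apply/measurable_EFinP; apply: measurable_funD; exact/measurable_EFinP.
    by move=> z; rewrite addr_ge0.
  - move=> x _; apply: ge0_le_integral => //.
    + by move=> y _; rewrite lee_fin.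
    + exact: (measurableT_comp maB (pair1_measurable x)).
    + apply: emeasurable_funD.
        exact: (measurableT_comp msqB1 (pair1_measurable x)).
      exact: (measurableT_comp msqB2 (pair1_measurable x)).
    + by move=> y _; rewrite -EFinD lee_fin le_aB.
under eq_integral => x _.
  rewrite ge0_integralD//; last 4 first.
  - by move=> y _; rewrite lee_fin.
  - exact: (measurableT_comp msqB1 (pair1_measurable x)).
  - by move=> y _; rewrite lee_fin.
  - exact: (measurableT_comp msqB2 (pair1_measurable x)).
  over.
rewrite ge0_integralD//; last 4 first.
- by move=> x _; apply: integral_ge0 => y _; rewrite lee_fin.
- exact: (mF sqB1).
- by move=> x _; apply: integral_ge0 => y _; rewrite lee_fin.
- exact: (mF sqB2).
rewrite [X in _ + X](@fubini_tonelli _ _ _ _ _ mu mu (EFin \o sqB2))//.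
rewrite [X in _ + X](_ : _ = \int[mu]_y \int[mu]_x (sqB2 (x, y))%:E)//.
rewrite int_sqB1 int_sqB2 -ge0_muleDr ?integral_ge0//.
rewrite -ge0_integralD//.
by under eq_integral => x _ do rewrite -EFinD -splitr.
Qed.

End fixed_window.

Let mpower : measurable_fun setT power.
Proof.
apply: measurable_funD; apply: measurable_funX.
- exact: measurable_costr.
- exact: measurable_sintr.
Qed.

Let power0 xi : 0 <= power xi.
Proof. by rewrite addr_ge0// sqr_ge0. Qed.

(* The windows of half-width k + 1 increase to 1. *)
Let window_power (k : nat) xi : \bar R := (window k.+1%:R xi * power xi)%:E.

Let cvg_window (xi : X) : window k.+1%:R xi @[k --> \oo] --> (1 : R).
Proof.
have : \prod_(i < n) wker k.+1%:R (xi ord0 i) @[k --> \oo] --> \prod_(i < n) (1 : R).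
  apply: cvg_big => // [|i _]; first exact: mul_continuous.
  set x := xi ord0 i.
  have h : 1 - x * x / (k.+1%:R * k.+1%:R) @[k --> \oo] --> (1 - x * x * (0 * 0) : R).
    under eq_fun do rewrite invfM.
    apply: cvgB; first exact: cvg_cst.
    apply: cvgM; first exact: cvg_cst.
    by apply: cvgM; exact: cvg_harmonic.
  rewrite !mulr0 subr0 in h.
  apply: (squeeze_cvgr _ h); last exact: (cvg_cst (1 : R)).
  near=> k.
  by rewrite wker_le1 andbT /wker le_max lexx orbT.
by rewrite big1.
Unshelve. all: by end_near.
Qed.

Let nd_window (xi : X) : nondecreasing_seq (fun k => window k.+1%:R xi).
Proof.
move=> k l kl; apply: ler_prod => i _; rewrite wker_ge0/=.
rewrite /wker ge_max !le_max lexx/=; apply/orP; right; rewrite lerB// ler_wpM2l//.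
  by rewrite -expr2 sqr_ge0.
by rewrite lef_pV2 ?posrE ?mulr_gt0// ler_pM ?ler_nat.
Qed.

(** The bound of schur_window does not depend on the width of the window, so that
    it survives the limit by monotone convergence. *)
Lemma plancherel_le :
  (\int[mu]_xi (costr a xi ^+ 2 + sintr a xi ^+ 2)%:E <=
   ((16 * pi) ^+ n)%:E * \int[mu]_x (a x ^+ 2)%:E)%E.
Proof.
have mw k : measurable_fun setT (window_power k).
  by apply/measurable_EFinP; apply: measurable_funM => //; exact: measurable_window.
have lim_w xi : limn (window_power^~ xi) = (power xi)%:E.
  apply/cvg_lim => //; rewrite /window_power -[X in X%:E]mul1r.
  apply: cvg_EFin; first by near=> k.
  by apply: cvgM; [exact: cvg_window|exact: cvg_cst].
have := @cvg_monotone_convergence _ _ _ mu _ measurableT window_power mw.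
have w0 k x : setT x -> (0 <= window_power k x)%E.
  by move=> _; rewrite lee_fin mulr_ge0// window_ge0.
move=> /(_ w0) cvgw.
have {}cvgw : (\int[mu]_x window_power k x)%E @[k --> \oo] --> (\int[mu]_xi (power xi)%:E)%E.
  under [X in _ --> X]eq_integral do rewrite -lim_w.
  apply: cvgw => x _ k l kl; rewrite lee_fin ler_wpM2r//; exact: nd_window.
rewrite -(cvg_lim _ cvgw)//; apply: lime_le; first by apply/cvg_ex; eexists; exact: cvgw.
near=> k.
have := @schur_window k.+1%:R (ltr0Sn _ _).
rewrite /Rintegral fineK//.
apply: (integrable_fin_num measurableT).
apply: (@integrableMb _ _ _ _ _ _ ((A + A) ^+ 2)) => //.
  exact: integrable_window.
move=> xi; rewrite ger0_norm//.
have := le_costr xi ia; have := le_sintr xi ia; rewrite -/A /power.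
rewrite -[costr a xi ^+ 2]real_normK ?num_real// -[sintr a xi ^+ 2]real_normK ?num_real//.
move: `|costr _ _| `|sintr _ _| (normr_ge0 (costr a xi)) (normr_ge0 (sintr a xi)) => s t *; nra.
Unshelve. all: by end_near.
Qed.

End plancherel_bound.

(** * Interpolation at dyadic levels *)
Section dyadic.
Context {R : realType}.
Implicit Types (M t B r : R).

Definition dyadic M (k : nat) : R := M / 2 ^+ k.+1.

Lemma dyadic_gt0 M k : 0 < M -> 0 < dyadic M k.
Proof. by move=> M0; rewrite divr_gt0// exprn_gt0. Qed.

Lemma dyadicS M k : dyadic M k.+1 = dyadic M k / 2.
Proof. by rewrite /dyadic exprS invfM mulrA mulrAC. Qed.

Lemma dyadic_bracket M t : 0 < t -> t <= M ->
  exists k, dyadic M k < t /\ t <= 2 * dyadic M k.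
Proof.
move=> t0 tM; have M0 : 0 < M by exact: lt_le_trans tM.
have ex : exists k, dyadic M k < t.
  have /archi_boundP : 0 <= M / t by rewrite divr_ge0 ?ltW.
  set k := Num.bound _ => Mk; exists k.
  rewrite /dyadic ltr_pdivrMr ?exprn_gt0// mulrC -ltr_pdivrMr//.
  rewrite (lt_le_trans Mk)// -natrX ler_nat.
  by rewrite ltnW// (leq_trans (ltn_expl k (ltnSn 1)))// leq_exp2l.
case: (ex_minnP ex) => -[|k] tk kmin; [exists 0%N|exists k.+1]; split => //.
  by rewrite /dyadic expr1 mulrC divfK.
rewrite dyadicS mulrC divfK// leNgt; apply/negP => /kmin.
by rewrite ltnn.
Qed.

(** The terms with dyadic M k <= B form a geometric series with ratio 2^-r, whose
    first term is at most B^r. The proof telescopes: multiplied by 1 - 2^-r, each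
    term is the decrement of min (dyadic M k, B) ^ r. *)
Lemma dyadic_powR_sum M B r n : 0 < M -> 0 <= B -> 0 < r ->
  (1 - 2 `^ (- r)) * \sum_(k < n) (if dyadic M k <= B then dyadic M k `^ r else 0) <= B `^ r.
Proof.
move=> M0 B0 r0; set rho := 2 `^ (- r).
pose b k := Num.min (dyadic M k) B `^ r.
have dS k : dyadic M k.+1 <= dyadic M k.
  by rewrite dyadicS ler_pdivrMr// ler_peMr ?(ltW (dyadic_gt0 _ _))// ler1n.
have bS k : b k.+1 <= b k.
  rewrite /b ge0_ler_powR ?(ltW r0)// ?nnegrE ?le_min ?(ltW (dyadic_gt0 _ _))//.
  by rewrite !ge_min dS lexx orbT.
suff : (1 - rho) * \sum_(k < n) (if dyadic M k <= B then dyadic M k `^ r else 0)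
    <= b 0%N - b n.
  move=> /le_trans; apply; rewrite lerBlDr (@le_trans _ _ (B `^ r))//.
    rewrite /b ge0_ler_powR ?(ltW r0)// ?nnegrE ?le_min ?(ltW (dyadic_gt0 _ _))//.
    by rewrite ge_min lexx orbT.
  by rewrite lerDl powR_ge0.
elim: n => [|n IH]; first by rewrite big_ord0 mulr0 subrr.
rewrite big_ord_recr/= mulrDr.
have -> : b 0%N - b n.+1 = (b 0%N - b n) + (b n - b n.+1) by ring.
apply: lerD => //; case: ifPn => dB; last by rewrite mulr0 subr_ge0.
rewrite /b (min_l dB) (min_l (le_trans (dS n) dB)) mulrBl mul1r lerB//.
rewrite dyadicS powRM ?(ltW (dyadic_gt0 _ _))// mulrC /rho.
by rewrite -[2^-1]powR_inv1// -powRrM mulN1r.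
Qed.

End dyadic.

(** An additive operator T which maps L^1 to bounded functions with norm 1, and L^2
    to L^2, maps L^p to L^q. The assumption on u is normalized by P, a bound for
    the p-th power of the norm, so that no division by the norm occurs. *)
Section marcinkiewicz.
Context {R : realType} d1 d2 (X : measurableType d1) (Y : measurableType d2).
Variables (m1 : {measure set X -> \bar R}) (m2 : {measure set Y -> \bar R}).
Variable T : (X -> R) -> Y -> R.
Variable A : R.
Hypothesis A0 : 0 <= A.
Local Notation L1 f := (m1.-integrable setT (EFin \o f)).
Hypothesis measurable_T : forall f, L1 f -> measurable_fun setT (T f).
Hypothesis T_bounded : forall f y, L1 f -> `|T f y| <= \int[m1]_x `|f x|.
Hypothesis T_add : forall f g y, L1 f -> L1 g ->
  T (fun x => f x + g x) y = T f y + T g y.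
Hypothesis T_L2 : forall f, L1 f ->
  (\int[m2]_y (T f y ^+ 2)%:E <= A%:E * \int[m1]_x (f x ^+ 2)%:E)%E.

Variables (p : R) (u : X -> R) (P : R).
Hypotheses (p1 : 1 < p) (p2 : p < 2) (iu : L1 u) (P0 : 0 < P).
Hypothesis uP : (\int[m1]_x (`|u x| `^ p)%:E <= P%:E)%E.

Let q := p / (p - 1).

Let mu_ : measurable_fun setT u.
Proof. by case/integrableP: iu => /measurable_EFinP. Qed.

Let mnu : measurable_fun setT (fun x => `|u x|).
Proof. exact: measurableT_comp. Qed.

Let mup : measurable_fun setT (fun x => `|u x| `^ p).
Proof. exact: (measurableT_comp (@measurable_powR R _) mnu). Qed.

Let iup : m1.-integrable setT (EFin \o (fun x => `|u x| `^ p)).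
Proof.
apply/integrableP; split; first exact/measurable_EFinP.
under eq_integral => x _ do rewrite gee0_abs ?lee_fin ?powR_ge0//.
exact: le_lt_trans uP (ltry _).
Qed.

(* The height of truncation, |u x| ^ (p - 1) = 2 P / lam, is the one for which
   the integral of |u| over the large values is at most lam / 2. *)
Let small lam x := lam * `|u x| `^ (p - 1) <= 2 * P.

Let ul lam x := if small lam x then 0 else u x.
Let us lam x := if small lam x then u x else 0.

Let msmall lam : measurable_fun setT (small lam).
Proof.
apply: measurable_fun_ler => //; apply: measurable_funM => //.
exact: (measurableT_comp (@measurable_powR R _) mnu).
Qed.

Let iul lam : L1 (ul lam).
Proof.
apply: (le_integrable measurableT _ _ iu).
- by apply/measurable_EFinP; apply: measurable_fun_ifT.
- by move=> x _; rewrite /= lee_fin /ul; case: ifP => //; rewrite normr0.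
Qed.

Let ius lam : L1 (us lam).
Proof.
apply: (le_integrable measurableT _ _ iu).
- by apply/measurable_EFinP; apply: measurable_fun_ifT.
- by move=> x _; rewrite /= lee_fin /us; case: ifP => //; rewrite normr0.
Qed.

Let q_eq : (p - 1) * (q - 2) = 2 - p.
Proof. by rewrite /q; field; rewrite subr_eq0 gt_eqF. Qed.

Let q2 : 2 < q.
Proof. by rewrite /q ltr_pdivlMr ?subr_gt0//; move: p1 p2; lra. Qed.

Let le_T_ul (lam : R) y : 0 < lam -> `|T (ul lam) y| <= lam / 2.
Proof.
move=> lam0; apply: (le_trans (T_bounded y (iul lam))).
apply: (@le_trans _ _ (\int[m1]_x (lam / (2 * P) * `|u x| `^ p))).
  apply: le_Rintegral => //; first exact: (integrable_norm (iul lam)).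
  - exact: (integrableZl measurableT _ iup).
  move=> x _; rewrite /ul; case: ifPn => [_|].
    by rewrite normr0 mulr_ge0 ?powR_ge0// divr_ge0 ?(ltW lam0)// mulr_ge0// ltW.
  rewrite -ltNge => large.
  rewrite mulrAC ler_pdivlMr ?mulr_gt0//.
  have -> : `|u x| `^ p = `|u x| * `|u x| `^ (p - 1).
    by rewrite mulr_powRB1//; move: p1; lra.
  by rewrite [leRHS]mulrCA ler_wpM2l// ltW.
rewrite RintegralZl//.
apply: (@le_trans _ _ (lam / (2 * P) * P)).
  rewrite ler_wpM2l ?divr_ge0 ?(ltW lam0)// ?mulr_ge0 ?(ltW P0)//.
  rewrite -lee_fin /Rintegral fineK//.
  exact: (integrable_fin_num measurableT iup).
by rewrite le_eqVlt; apply/orP; left; apply/eqP; field; rewrite gt_eqF.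
Qed.

Let T_split lam y : T u y = T (ul lam) y + T (us lam) y.
Proof.
rewrite -T_add//; congr (T _ y); apply/funext => x.
by rewrite /ul /us; case: ifP; rewrite ?add0r ?addr0.
Qed.

(** Where |T u| exceeds lam, the large part of u contributes at most lam / 2, so
    that |T (us lam)| is at least lam / 2; Chebyshev's inequality and the bound
    on L^2 do the rest. *)
Let level_set (lam : R) : 0 < lam ->
  (\int[m2]_y (if (lam < `|T u y|)%R then 1 else 0)%:E <=
   (4 * A / lam ^+ 2)%:E * \int[m1]_x (us lam x ^+ 2)%:E)%E.
Proof.
move=> lam0.
apply: (@le_trans _ _ (\int[m2]_y (4 / lam ^+ 2 * T (us lam) y ^+ 2)%:E)%E).
  apply: ge0_le_integral => //.
  - by move=> y _; case: ifP.
  - apply/measurable_EFinP; apply: measurable_fun_ifT => //.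
    apply: measurable_fun_ltr => //; apply: measurableT_comp => //.
    exact: measurable_T.
  - apply/measurable_EFinP; apply: measurable_funM => //.
    by apply: measurable_funX; exact: measurable_T.
  - move=> y _; rewrite lee_fin; case: ifPn => [lamT|_]; last first.
      by rewrite mulr_ge0 ?divr_ge0 ?sqr_ge0.
    have h1 := le_T_ul y lam0.
    have h2 : lam / 2 <= `|T (us lam) y|.
      have := ler_normD (T (ul lam) y) (T (us lam) y).
      by rewrite -T_split; lra.
    rewrite mulrAC ler_pdivlMr ?exprn_gt0// mul1r.
    rewrite -[T _ _ ^+ 2]real_normK ?num_real//.
    by move: `|T (us lam) y| h2 => s; nra.
under eq_integral do rewrite EFinM.
rewrite ge0_integralZl//; last 3 first.
- by apply/measurable_EFinP; apply: measurable_funX; exact: measurable_T.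
- by move=> y _; rewrite lee_fin sqr_ge0.
- by rewrite lee_fin divr_ge0// sqr_ge0.
apply: (@le_trans _ _ ((4 / lam ^+ 2)%:E * (A%:E * \int[m1]_x (us lam x ^+ 2)%:E))%E).
  by rewrite lee_wpmul2l// ?T_L2// lee_fin divr_ge0// sqr_ge0.
by rewrite muleA -EFinM mulrAC.
Qed.

(* M bounds |T u|, and the summand 1 makes it positive even if u vanishes. *)
Let M := \int[m1]_x `|u x| + 1.

Let M0 : 0 < M. Proof. by rewrite ltr_wpDl// Rintegral_ge0. Qed.

Let r := q - 2.
Let r0 : 0 < r. Proof. by rewrite subr_gt0. Qed.

Let geo := 1 - 2 `^ (- r) : R.
Let geo0 : 0 < geo.
Proof.
rewrite subr_gt0 powRN invf_lt1 ?powR_gt0//.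
have : 1 `^ r < 2 `^ r by rewrite gt0_ltr_powR// ?nnegrE// ltr1n.
by rewrite powR1.
Qed.

Let lam_ k := dyadic M k.
Let lam0 k : 0 < lam_ k. Proof. exact: dyadic_gt0. Qed.

Let f k y := (2 * lam_ k) `^ q * (if lam_ k < `|T u y| then 1 else 0).

Let f0 k y : 0 <= f k y.
Proof. by rewrite mulr_ge0 ?powR_ge0//; case: ifP. Qed.

Let mset k : measurable_fun setT (fun y => if lam_ k < `|T u y| then 1 else 0 : R).
Proof.
apply: measurable_fun_ifT => //; apply: measurable_fun_ltr => //.
by apply: measurableT_comp => //; exact: measurable_T.
Qed.

Let mf k : measurable_fun setT (EFin \o f k).
Proof. by apply/measurable_EFinP; exact: measurable_funM. Qed.

Let g k x := lam_ k `^ r * us (lam_ k) x ^+ 2.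

Let g0 k x : 0 <= g k x.
Proof. by rewrite mulr_ge0 ?powR_ge0// sqr_ge0. Qed.

Let mus k : measurable_fun setT (us (lam_ k)).
Proof. exact: measurable_fun_ifT. Qed.

Let mg k : measurable_fun setT (EFin \o g k).
Proof.
by apply/measurable_EFinP; apply: measurable_funM => //; exact: measurable_funX.
Qed.

Let le_powT y : ((`|T u y| `^ q)%:E <= \sum_(k <oo) (f k y)%:E)%E.
Proof.
have [->|T0] := eqVneq (T u y) 0.
  rewrite normr0 powR0 ?gt_eqF//; last by move: q2; lra.
  by apply: nneseries_ge0 => k _ _; rewrite lee_fin.
have /dyadic_bracket : 0 < `|T u y| by rewrite normr_gt0.
move=> /(_ M) []; first by apply: (le_trans (T_bounded y iu)); rewrite lerDl.
move=> k [k1 k2].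
apply: (@le_trans _ _ (f k y)%:E).
  rewrite /f k1 mulr1 lee_fin ge0_ler_powR// ?nnegrE//; last first.
    by rewrite mulr_ge0// ltW.
  by move: q2; lra.
apply: le_trans (nneseries_lim_ge k.+1 _) => //.
  rewrite big_nat_recr//= leeDr// sume_ge0// => i _.
  by rewrite lee_fin.
by move=> i _ _; rewrite lee_fin.
Qed.

(** At fixed x only the levels below 2 P / |u x| ^ (p - 1) occur, and they sum up
    geometrically because r is positive, that is, because p < 2. *)
Let le_sum_g x n : \sum_(k < n) g k x <= geo^-1 * (2 * P) `^ r * `|u x| `^ p.
Proof.
have [u0|u0] := eqVneq (u x) 0.
  rewrite big1 => [|k _]; first by rewrite !mulr_ge0 ?powR_ge0// invr_ge0 ltW.
  by rewrite /g /us u0 if_same expr0n mulr0.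
have nu0 : 0 < `|u x| by rewrite normr_gt0.
have up0 : 0 < `|u x| `^ (p - 1) by rewrite powR_gt0.
set B := 2 * P / `|u x| `^ (p - 1).
have B0 : 0 <= B by rewrite divr_ge0 ?(ltW up0)// mulr_ge0// ltW.
have gE k : g k x = u x ^+ 2 * (if lam_ k <= B then lam_ k `^ r else 0).
  rewrite /g /us /small -ler_pdivlMr//.
  by case: ifP => _; [rewrite mulrC|rewrite expr0n mulr0 mulr0].
under eq_bigr do rewrite gE.
rewrite -mulr_sumr.
have := dyadic_powR_sum n M0 B0 r0; rewrite -/geo -ler_pdivlMl// => h.
apply: (@le_trans _ _ (u x ^+ 2 * (geo^-1 * B `^ r))).
  by rewrite ler_wpM2l ?sqr_ge0.
rewrite mulrCA -[leRHS]mulrA ler_wpM2l ?invr_ge0 ?(ltW geo0)//.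
have -> : u x ^+ 2 = `|u x| `^ 2.
  by rewrite powR_mulrn// real_normK ?num_real.
rewrite /B powRM ?invr_ge0 ?(ltW up0) ?mulr_ge0 ?(ltW P0)//.
rewrite mulrCA -[(_ `^ (p - 1))^-1]powR_inv1 ?(ltW up0)// -!powRrM -powRD ?(gt_eqF nu0) ?implybT//.
have -> : 2 + (p - 1) * (-1 * r) = p by rewrite mulN1r mulrN q_eq; ring.
by [].
Qed.

Definition marcinkiewicz_cst := 4 * A * 2 `^ q * geo^-1 * 2 `^ r.

Lemma marcinkiewicz_cst_ge0 : 0 <= marcinkiewicz_cst.
Proof. by rewrite !mulr_ge0 ?powR_ge0// invr_ge0 ltW. Qed.

Local Open Scope ereal_scope.

(** Compare |T u|^q with its values at the dyadic levels (layer cake), estimate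
    each level set, and exchange the sum over the levels with the integral over x. *)
Lemma marcinkiewicz_dual :
  \int[m2]_y (`|T u y| `^ q)%:E <= (marcinkiewicz_cst * P `^ (q - 1))%:E.
Proof.
have f0' k y : setT y -> 0 <= (f k y)%:E by rewrite lee_fin.
have g0' k x : setT x -> 0 <= (g k x)%:E by rewrite lee_fin.
apply: (@le_trans _ _ (\int[m2]_y \sum_(k <oo) (f k y)%:E)).
  apply: ge0_le_integral => //.
  - apply/measurable_EFinP; apply: (measurableT_comp (@measurable_powR R _)).
    by apply: measurableT_comp => //; exact: measurable_T.
  - by apply: ge0_emeasurable_sum => [k y _ _|k _]; [rewrite lee_fin|exact: mf].
rewrite integral_nneseries//.
set D := (4 * A * 2 `^ q)%R.
have D0 : (0 <= D)%R by rewrite !mulr_ge0 ?powR_ge0.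
apply: (@le_trans _ _ (\sum_(k <oo) D%:E * \int[m1]_x (g k x)%:E)).
  apply: lee_nneseries => [k _ _|k _].
    by apply: integral_ge0 => y _; rewrite lee_fin.
  under eq_integral do rewrite EFinM.
  rewrite ge0_integralZl//; last 3 first.
  + exact/measurable_EFinP.
  + by move=> y _; case: ifP.
  + by rewrite lee_fin powR_ge0.
  apply: (@le_trans _ _ (((2 * lam_ k) `^ q)%:E *
      ((4 * A / lam_ k ^+ 2)%:E * \int[m1]_x (us (lam_ k) x ^+ 2)%:E))).
    by rewrite lee_wpmul2l ?lee_fin ?powR_ge0// level_set.
  under [X in _ <= _ * X]eq_integral do rewrite EFinM.
  rewrite ge0_integralZl//; last 3 first.
  + by apply/measurable_EFinP; exact: measurable_funX.
  + by move=> y _; rewrite lee_fin sqr_ge0.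
  + by rewrite lee_fin powR_ge0.
  rewrite !muleA -!EFinM lee_wpmul2r//.
    by apply: integral_ge0 => x _; rewrite lee_fin sqr_ge0.
  rewrite lee_fin powRM ?(ltW (lam0 k))//.
  have powq a : (0 < a -> a `^ q = a ^+ 2 * a `^ r)%R.
    move=> a0; rewrite (_ : q = 2 + r)%R; last by rewrite /r; ring.
    by rewrite powRD ?powR_mulrn ?(ltW a0)// (gt_eqF a0) implybT.
  rewrite le_eqVlt; apply/orP; left; apply/eqP.
  rewrite /D !powq//.
  by field; rewrite gt_eqF.
rewrite nneseriesZl; last by move=> k _; apply: integral_ge0 => x _; rewrite lee_fin.
rewrite -integral_nneseries//.
apply: (@le_trans _ _ (D%:E * \int[m1]_x (geo^-1 * (2 * P) `^ r * `|u x| `^ p)%:E)).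
  rewrite lee_wpmul2l ?lee_fin//.
  apply: ge0_le_integral => //.
  - by move=> x _; apply: nneseries_ge0 => k _ _; rewrite lee_fin.
  - by apply: ge0_emeasurable_sum => [k x _ _|k _]; [rewrite lee_fin|exact: mg].
  - by apply/measurable_EFinP; exact: measurable_funM.
  - move=> x _; apply: lime_le; first by apply: is_cvg_nneseries => k _ _; rewrite lee_fin.
    near=> k; rewrite big_mkord sumEFin lee_fin; exact: le_sum_g.
under eq_integral do rewrite EFinM.
have c0 : (0 <= geo^-1 * (2 * P) `^ r)%R by rewrite mulr_ge0 ?powR_ge0// invr_ge0 ltW.
rewrite ge0_integralZl//; last exact/measurable_EFinP.
rewrite muleA -EFinM.
apply: (@le_trans _ _ ((D * (geo^-1 * (2 * P) `^ r))%:E * P%:E)).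
  by rewrite lee_wpmul2l// lee_fin mulr_ge0.
rewrite -EFinM lee_fin le_eqVlt; apply/orP; left; apply/eqP.
rewrite powRM ?(ltW P0)//.
have -> : (P `^ (q - 1) = P `^ r * P)%R.
  rewrite (_ : q - 1 = r + 1)%R; last by rewrite /r; ring.
  by rewrite powRD ?powRr1 ?(ltW P0)// (gt_eqF P0) implybT.
by rewrite /D /marcinkiewicz_cst; ring.
Unshelve. all: by end_near.
Qed.

End marcinkiewicz.

(** * Comparison of norms, and an abstract Hausdorff-Young inequality *)
Section Lnorm_comparison.
Context d (T : measurableType d) (R : realType).
Variable mu : {measure set T -> \bar R}.
Implicit Types (f g : T -> R) (p : R) (q : \bar R).
Local Open Scope ereal_scope.

Lemma LnormE p f :
  'N[mu]_p%:E[EFin \o f] = (\int[mu]_x (`|f x| `^ p)%:E) `^ p^-1.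
Proof.
by rewrite unlock.
Qed.

Lemma integral_powR_ge0 p f : 0 <= \int[mu]_x (`|f x| `^ p)%:E.
Proof. by apply: integral_ge0 => x _; rewrite lee_fin powR_ge0. Qed.

Lemma le_LnormZ q f g (c : R) : measurable_fun setT f -> measurable_fun setT g ->
  0 < q -> (0 <= c)%R -> (forall x, (`|f x| <= c * `|g x|)%R) ->
  'N[mu]_q[EFin \o f] <= c%:E * 'N[mu]_q[EFin \o g].
Proof.
move=> mf mg q0 c0 fg; case: q q0 => [p p0|_|//]; last first.
  rewrite unlock; case: ifPn => mu0; last by rewrite mule0.
  apply/ess_supP; have := @ess_sup_ge _ _ _ mu (abse \o (EFin \o g)).
  apply: filterS => x gx.
  apply: (@le_trans _ _ (c%:E * `|(EFin \o g) x|)); first by rewrite /= lee_fin.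
  by rewrite lee_wpmul2l.
rewrite lte_fin in p0.
have mpow (h : T -> R) : measurable_fun setT h -> measurable_fun setT (fun x => (`|h x| `^ p)%:E).
  move=> mh; apply/measurable_EFinP; apply: (measurableT_comp (@measurable_powR R _)).
  exact: measurableT_comp.
rewrite !LnormE.
have -> : c%:E = (c%:E `^ p) `^ p^-1.
  by rewrite -poweRrM mulfV ?gt_eqF// poweRe1// lee_fin.
rewrite -poweRM ?poweR_ge0//; last exact: integral_powR_ge0.
apply: gt0_ler_poweR; first by rewrite invr_ge0 ltW.
- by rewrite in_itv/= leey andbT integral_powR_ge0.
- by rewrite in_itv/= leey andbT mule_ge0 ?lee_fin ?powR_ge0 ?integral_powR_ge0.
rewrite poweR_EFin -ge0_integralZl//; last 2 first.
- exact: mpow.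
- by rewrite lee_fin powR_ge0.
apply: ge0_le_integral => //.
- exact: mpow.
- by apply: emeasurable_funM => //; exact: mpow.
move=> x _; rewrite -EFinM lee_fin -powRM// ge0_ler_powR ?(ltW p0)// nnegrE//.
by rewrite mulr_ge0.
Qed.

Lemma Lnorm_le p f (P : R) : (0 < p)%R -> (0 <= P)%R ->
  \int[mu]_x (`|f x| `^ p)%:E <= (P `^ p)%:E -> 'N[mu]_p%:E[EFin \o f] <= P%:E.
Proof.
move=> p0 P0 fP; rewrite LnormE.
have -> : P%:E = (P `^ p)%:E `^ p^-1.
  by rewrite poweR_EFin -powRrM mulfV ?gt_eqF// powRr1.
apply: gt0_ler_poweR; first by rewrite invr_ge0 ltW.
- by rewrite in_itv/= leey andbT integral_powR_ge0.
- by rewrite in_itv/= leey andbT lee_fin powR_ge0.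
by [].
Qed.

Lemma Lnorm_le_poweR p f : (0 < p)%R ->
  \int[mu]_x (`|f x| `^ p)%:E = 'N[mu]_p%:E[EFin \o f] `^ p.
Proof.
move=> p0; rewrite LnormE -poweRrM mulVf ?gt_eqF// poweRe1//.
exact: integral_powR_ge0.
Qed.

Lemma Lnormy_le f (c : R) : (0 <= c)%R -> (forall x, (`|f x| <= c)%R) ->
  'N[mu]_+oo[EFin \o f] <= c%:E.
Proof.
move=> c0 fc; rewrite unlock; case: ifPn => // _.
by apply: ess_sup_ler => x; rewrite lee_fin.
Qed.

End Lnorm_comparison.

Section hausdorff_young_abstract.
Context {R : realType} d1 d2 (X : measurableType d1) (Y : measurableType d2).
Variables (m1 : {measure set X -> \bar R}) (m2 : {measure set Y -> \bar R}).
Variable T : (X -> R) -> Y -> R.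
Variable A : R.
Hypothesis A0 : 0 <= A.
Local Notation L1 f := (m1.-integrable setT (EFin \o f)).
Hypothesis measurable_T : forall f, L1 f -> measurable_fun setT (T f).
Hypothesis T_bounded : forall f y, L1 f -> `|T f y| <= \int[m1]_x `|f x|.
Hypothesis T_add : forall f g y, L1 f -> L1 g ->
  T (fun x => f x + g x) y = T f y + T g y.
Hypothesis T_L2 : forall f, L1 f ->
  (\int[m2]_y (T f y ^+ 2)%:E <= A%:E * \int[m1]_x (f x ^+ 2)%:E)%E.

Local Open Scope ereal_scope.

(** The end points p = 1 and p = 2 are the assumptions. In between,
    marcinkiewicz_dual is applied with P slightly above the p-th power of the norm
    of u, because it asks for P > 0 and the norm may vanish. *)
Lemma hausdorff_young_abstract (p : R) : (1 <= p <= 2)%R ->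
  exists2 C : R, (0 < C)%R & forall u, L1 u ->
    'N[m2]_(hoelder_conjugate p%:E)[EFin \o T u] <= C%:E * 'N[m1]_p%:E[EFin \o u].
Proof.
move=> /andP[]; rewrite le_eqVlt => /predU1P[<- _|p1].
  exists 1%R => // u iu; rewrite hoelder_conjugate1 mul1e Lnorm1.
  apply: le_trans (_ : (\int[m1]_x `|u x|)%R%:E <= _).
    by apply: Lnormy_le => [|y]; [exact: Rintegral_ge0|exact: T_bounded].
  rewrite /Rintegral fineK//.
  exact: (integrable_fin_num measurableT (integrable_abse iu)).
rewrite le_eqVlt => /predU1P[->|p2].
  exists (Num.sqrt A + 1)%R => [|u iu]; first by rewrite ltr_wpDl// sqrtr_ge0.
  have mu_ : measurable_fun setT u by case/integrableP: iu => /measurable_EFinP.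
  rewrite hoelder_conjugate2 !LnormE.
  apply: (@le_trans _ _ ((A%:E * \int[m1]_x (`|u x| `^ 2)%:E) `^ 2^-1)).
    have sq (S : Type) (h : S -> R) x : (`|h x| `^ 2 = h x ^+ 2)%R.
      by rewrite powR_mulrn// real_normK ?num_real.
    apply: gt0_ler_poweR => //.
    - by rewrite in_itv/= leey andbT integral_powR_ge0.
    - by rewrite in_itv/= leey andbT mule_ge0 ?lee_fin ?integral_powR_ge0.
    under eq_integral do rewrite sq.
    under [X in _ <= _ * X]eq_integral do rewrite sq.
    exact: T_L2.
  rewrite poweRM//; last exact: integral_powR_ge0.
  rewrite poweR_EFin powR12_sqrt// lee_wpmul2r ?poweR_ge0// lee_fin.
  by rewrite lerDl.
set q := (p / (p - 1))%R.
have pB1 : (p - 1 != 0)%R by rewrite subr_eq0 gt_eqF.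
have qE : hoelder_conjugate p%:E = q%:E.
  by rewrite /hoelder_conjugate/= eqe gt_eqF ?(lt_trans _ p1)// -EFinD inver (negbTE pB1).
have q0 : (0 < q)%R by rewrite divr_gt0 ?subr_gt0// (lt_trans _ p1).
have p0 : (0 < p)%R by rewrite (lt_trans _ p1).
set c := marcinkiewicz_cst A p.
have c0 : (0 <= c)%R by exact: marcinkiewicz_cst_ge0.
exists (c `^ q^-1 + 1)%R => [|u iu]; first by rewrite ltr_wpDl// powR_ge0.
rewrite qE.
have [->|uoo] := eqVneq ('N[m1]_p%:E[EFin \o u]) +oo.
  by rewrite gt0_muley ?leey// lte_fin ltr_wpDl// powR_ge0.
have Nfin : 'N[m1]_p%:E[EFin \o u] \is a fin_num by rewrite ge0_fin_numE ?ltey ?Lnorm_ge0.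
rewrite -(fineK Nfin); set N := fine _.
have N0 : (0 <= N)%R by rewrite fine_ge0// Lnorm_ge0.
apply: (@le_trans _ _ (c `^ q^-1 * N)%:E); last first.
  by rewrite -EFinM lee_fin ler_wpM2r// lerDl.
apply/lee_addgt0Pr => e e0.
set c1 := (c `^ q^-1 + 1)%R.
have c10 : (0 < c1)%R by rewrite ltr_wpDl// powR_ge0.
have Ne0 : (0 < N + e / c1)%R by rewrite ltr_wpDl// divr_gt0.
apply: (@le_trans _ _ (c `^ q^-1 * (N + e / c1))%:E); last first.
  rewrite -EFinD lee_fin mulrDr lerD2l mulrA ler_pdivrMr// mulrC ler_wpM2l ?(ltW e0)//.
  by rewrite /c1 lerDl.
apply: Lnorm_le => //; first by rewrite mulr_ge0 ?powR_ge0 ?ltW.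
rewrite powRM ?powR_ge0 ?(ltW Ne0)// -powRrM mulVf ?gt_eqF// powRr1//.
have -> : ((N + e / c1) `^ q = ((N + e / c1) `^ p) `^ (q - 1))%R.
  by rewrite -powRrM; congr (_ `^ _)%R; rewrite /q; field.
apply: (marcinkiewicz_dual A0 measurable_T T_bounded T_add T_L2) => //.
  by rewrite powR_gt0.
rewrite Lnorm_le_poweR// -(fineK Nfin) poweR_EFin lee_fin ge0_ler_powR ?(ltW p0)// ?nnegrE ?(ltW Ne0)//.
by rewrite lerDl divr_ge0// ltW.
Qed.

End hausdorff_young_abstract.

(** * Complex-valued functions *)
Section complex_functions.
Context {R : realType}.
Implicit Types (z w : R[i]) (t : R).
Local Notation Re := complex.Re.
Local Notation Im := complex.Im.
Local Notation nc := Normc.normc.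

Lemma normc_nneg z : 0 <= nc z.
Proof. by case: z => a b; rewrite sqrtr_ge0. Qed.

Lemma normc_def_Re_Im z : nc z = Num.sqrt (Re z ^+ 2 + Im z ^+ 2).
Proof. by case: z. Qed.

Lemma ler_Re_normc z : `|Re z| <= nc z.
Proof.
by rewrite normc_def_Re_Im -sqrtr_sqr ler_wsqrtr// lerDl sqr_ge0.
Qed.

Lemma ler_Im_normc z : `|Im z| <= nc z.
Proof.
by rewrite normc_def_Re_Im -sqrtr_sqr ler_wsqrtr// lerDr sqr_ge0.
Qed.

Lemma ler_normc_Re_Im z : nc z <= `|Re z| + `|Im z|.
Proof.
rewrite normc_def_Re_Im -[leRHS]ger0_norm ?addr_ge0// -sqrtr_sqr ler_wsqrtr//.
rewrite -[Re z ^+ 2]real_normK ?num_real// -[Im z ^+ 2]real_normK ?num_real//.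
have := mulr_ge0 (normr_ge0 (Re z)) (normr_ge0 (Im z)).
by rewrite sqrrD; move: `|Re z| `|Im z| => s u; rewrite -mulr_natr; lra.
Qed.

Lemma ler_normcD z w : nc (z + w) <= nc z + nc w.
Proof. exact: le_normcD. Qed.

Lemma ReCM z w : Re (z * w) = Re z * Re w - Im z * Im w.
Proof. by case: z w => [a b] [c d]. Qed.

Lemma ImCM z w : Im (z * w) = Re z * Im w + Im z * Re w.
Proof. by case: z w => [a b] [c d]. Qed.

Lemma ReCD z w : Re (z + w) = Re z + Re w.
Proof. by case: z w => [a b] [c d]. Qed.

Lemma ImCD z w : Im (z + w) = Im z + Im w.
Proof. by case: z w => [a b] [c d]. Qed.

Lemma ReCN z : Re (- z) = - Re z.
Proof. by case: z. Qed.

Lemma ImCN z : Im (- z) = - Im z.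
Proof. by case: z. Qed.

Lemma complex_eq z w : Re z = Re w -> Im z = Im w -> z = w.
Proof. by case: z w => [a b] [c d] /= -> ->. Qed.

Lemma normc_expi t : nc (expi t) = 1.
Proof. by rewrite /expi /= cos2Dsin2 sqrtr1. Qed.

Lemma expiD t (s : R) : expi (t + s) = expi t * expi s.
Proof.
by apply: complex_eq; rewrite ?ReCM ?ImCM/= ?cosD ?sinD; ring.
Qed.

Lemma normc_expiB1 t : nc (expi t - 1) = `|2 * sin (t / 2)|.
Proof.
rewrite normc_def_Re_Im -sqrtr_sqr; congr Num.sqrt.
rewrite ReCD ImCD ReCN ImCN/= subr0.
have {1 2}-> : t = t / 2 + t / 2 by rewrite -splitr.
rewrite cosD sinD; have := cos2Dsin2 (t / 2).
move: (cos _) (sin _) => c s h.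
transitivity ((c ^+ 2 + s ^+ 2) ^+ 2 - 2 * (c ^+ 2 - s ^+ 2) + 1); first by ring.
have -> : c ^+ 2 = 1 - s ^+ 2 by rewrite -h; ring.
by ring.
Qed.

Variables (d : measure_display) (T : measurableType d).
Variable mu : {measure set T -> \bar R}.
Implicit Types (f g : T -> R[i]) (q : \bar R).

(** Measurability of complex functions in the form that Lp uses. *)
Definition cmeasurable f := measurable_fun setT (fun x => Re (f x)) /\
  measurable_fun setT (fun x => Im (f x)).

Lemma measurable_normc f : cmeasurable f -> measurable_fun setT (fun x => nc (f x)).
Proof.
case=> mr mi; under eq_fun do rewrite normc_def_Re_Im.
have -> : (fun x => Num.sqrt (Re (f x) ^+ 2 + Im (f x) ^+ 2)) =
    (fun x => (Re (f x) ^+ 2 + Im (f x) ^+ 2) `^ 2^-1).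
  by apply/funext => x; rewrite powR12_sqrt// addr_ge0// sqr_ge0.
apply: (measurableT_comp (@measurable_powR R _)).
by apply: measurable_funD; exact: measurable_funX.
Qed.

Lemma cmeasurableD f g : cmeasurable f -> cmeasurable g -> cmeasurable (fun x => f x + g x).
Proof.
move=> [fr fi] [gr gi]; split.
- by under eq_fun do rewrite ReCD; exact: measurable_funD.
- by under eq_fun do rewrite ImCD; exact: measurable_funD.
Qed.

Lemma cmeasurableN f : cmeasurable f -> cmeasurable (fun x => - f x).
Proof.
move=> [fr fi]; split.
- by under eq_fun do rewrite ReCN; exact: measurableT_comp.
- by under eq_fun do rewrite ImCN; exact: measurableT_comp.
Qed.

Lemma cmeasurableB f g : cmeasurable f -> cmeasurable g -> cmeasurable (fun x => f x - g x).
Proof. by move=> mf mg; apply: cmeasurableD => //; exact: cmeasurableN. Qed.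

Lemma cmeasurableM f g : cmeasurable f -> cmeasurable g -> cmeasurable (fun x => f x * g x).
Proof.
move=> [fr fi] [gr gi]; split.
- by under eq_fun do rewrite ReCM; apply: measurable_funB; exact: measurable_funM.
- by under eq_fun do rewrite ImCM; apply: measurable_funD; exact: measurable_funM.
Qed.

Local Notation N q f := ('N[mu]_q[EFin \o (fun x => nc (f x))])%E.

Lemma cNorm_triangle q f g : cmeasurable f -> cmeasurable g -> (1 <= q)%E ->
  (N q (fun x => f x + g x)%R <= N q f + N q g)%E.
Proof.
move=> mf mg q1.
apply: le_trans (eminkowski mu (measurable_normc mf) (measurable_normc mg) q1).
rewrite -[leRHS]mul1e; apply: le_LnormZ => //.
- exact: measurable_normc (cmeasurableD mf mg).
- by apply: measurable_funD; exact: measurable_normc.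
- by rewrite (lt_le_trans _ q1).
- by move=> x; rewrite mul1r !ger0_norm ?addr_ge0 ?normc_nneg// ler_normcD.
Qed.

Lemma le_cNormZ q f g (c : R) : cmeasurable f -> cmeasurable g -> (0 < q)%E -> 0 <= c ->
  (forall x, nc (f x) <= c * nc (g x)) -> (N q f <= c%:E * N q g)%E.
Proof.
move=> mf mg q0 c0 fg; apply: le_LnormZ => //; try exact: measurable_normc.
by move=> x; rewrite !ger0_norm ?normc_nneg.
Qed.

End complex_functions.

(** * The Hausdorff-Young inequality *)
Section hausdorff_young.
Context {R : realType} {n : nat}.
Local Notation X := 'rV[R]_n.
Local Notation mu := (lebesgue_rV R n).
Implicit Types (u f g G H : X -> R[i]) (x xi : X) (q : \bar R) (p : R).
Local Notation Re := complex.Re.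
Local Notation Im := complex.Im.
Local Notation nc := Normc.normc.
Local Notation L1 a := (mu.-integrable setT (EFin \o a)).

Lemma Lpnorm_ge0 q f : (0 <= Lpnorm q f)%E.
Proof. exact: Lnorm_ge0. Qed.

Lemma LpnormE q f : Lpnorm q f = 'N[mu]_q[EFin \o (fun x => nc (f x))]%E.
Proof. by []. Qed.

Lemma Lp_cmeasurable q f : Lp q f -> cmeasurable f.
Proof. by case. Qed.

Lemma Lp_lty q f : Lp q f -> (Lpnorm q f < +oo)%E.
Proof. by case. Qed.

Lemma Lp_mk q f : cmeasurable f -> (Lpnorm q f < +oo)%E -> Lp q f.
Proof. by case. Qed.

Lemma Lp1_integrable_normc u : Lp 1%E u -> L1 (fun x => nc (u x)).
Proof.
move=> [mr mi]; rewrite LpnormE Lnorm1 => oo; apply/integrableP; split => //.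
by apply/measurable_EFinP; exact: measurable_normc (conj mr mi).
Qed.

Lemma Lp1_integrable_Re u : Lp 1%E u -> L1 (fun x => Re (u x)).
Proof.
move=> Lu; have [mr mi _] := Lu.
apply: (le_integrable measurableT _ _ (Lp1_integrable_normc Lu)).
  exact/measurable_EFinP.
by move=> x _; rewrite /= lee_fin (ger0_norm (normc_nneg _)) ler_Re_normc.
Qed.

Lemma Lp1_integrable_Im u : Lp 1%E u -> L1 (fun x => Im (u x)).
Proof.
move=> Lu; have [mr mi _] := Lu.
apply: (le_integrable measurableT _ _ (Lp1_integrable_normc Lu)).
  exact/measurable_EFinP.
by move=> x _; rewrite /= lee_fin (ger0_norm (normc_nneg _)) ler_Im_normc.
Qed.

Lemma Re_fourierL1 u xi : Lp 1%E u -> Re (fourierL1 u xi) =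
  costr (fun x => Re (u x)) xi + sintr (fun x => Im (u x)) xi.
Proof.
move=> Lu; have ir := Lp1_integrable_Re Lu; have ii := Lp1_integrable_Im Lu.
rewrite /fourierL1 /cintegral /= /costr /sintr -RintegralD//; last 2 first.
- exact: integrable_acos.
- exact: integrable_asin.
by apply: eq_Rintegral => x _; rewrite ReCM /= cosN sinN; ring.
Qed.

Lemma Im_fourierL1 u xi : Lp 1%E u -> Im (fourierL1 u xi) =
  costr (fun x => Im (u x)) xi - sintr (fun x => Re (u x)) xi.
Proof.
move=> Lu; have ir := Lp1_integrable_Re Lu; have ii := Lp1_integrable_Im Lu.
rewrite /fourierL1 /cintegral /= /costr /sintr -RintegralB//; last 2 first.
- exact: integrable_acos.
- exact: integrable_asin.
by apply: eq_Rintegral => x _; rewrite ImCM /= cosN sinN; ring.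
Qed.

Lemma cmeasurable_fourierL1 u : Lp 1%E u -> cmeasurable (fourierL1 u).
Proof.
move=> Lu; have [mr mi _] := Lu; split.
- under eq_fun do rewrite Re_fourierL1//.
  by apply: measurable_funD; [exact: measurable_costr|exact: measurable_sintr].
- under eq_fun do rewrite Im_fourierL1//.
  by apply: measurable_funB; [exact: measurable_costr|exact: measurable_sintr].
Qed.

Lemma costr_add a b xi : L1 a -> L1 b ->
  costr (fun x => a x + b x) xi = costr a xi + costr b xi.
Proof.
move=> ia ib; rewrite /costr -RintegralD//; [|exact: integrable_acos..].
by apply: eq_Rintegral => x _; rewrite mulrDl.
Qed.

Lemma sintr_add a b xi : L1 a -> L1 b ->
  sintr (fun x => a x + b x) xi = sintr a xi + sintr b xi.
Proof.
move=> ia ib; rewrite /sintr -RintegralD//; [|exact: integrable_asin..].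
by apply: eq_Rintegral => x _; rewrite mulrDl.
Qed.

Let L1_measurable a : L1 a -> measurable_fun setT a.
Proof. by move=> /integrableP[/measurable_EFinP]. Qed.

Let A0 : 0 <= (16 * pi : R) ^+ n.
Proof. by rewrite exprn_ge0// mulr_ge0// pi_ge0. Qed.

Lemma costr_L2 a : L1 a ->
  (\int[mu]_xi (costr a xi ^+ 2)%:E <= ((16 * pi) ^+ n)%:E * \int[mu]_x (a x ^+ 2)%:E)%E.
Proof.
move=> ia; apply: le_trans (plancherel_le ia).
have mc := measurable_costr (L1_measurable ia).
have ms := measurable_sintr (L1_measurable ia).
apply: ge0_le_integral => //.
- by move=> x _; rewrite lee_fin sqr_ge0.
- by apply/measurable_EFinP; exact: measurable_funX.
- by apply/measurable_EFinP; apply: measurable_funD; exact: measurable_funX.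
- by move=> x _; rewrite lee_fin lerDl sqr_ge0.
Qed.

Lemma sintr_L2 a : L1 a ->
  (\int[mu]_xi (sintr a xi ^+ 2)%:E <= ((16 * pi) ^+ n)%:E * \int[mu]_x (a x ^+ 2)%:E)%E.
Proof.
move=> ia; apply: le_trans (plancherel_le ia).
have mc := measurable_costr (L1_measurable ia).
have ms := measurable_sintr (L1_measurable ia).
apply: ge0_le_integral => //.
- by move=> x _; rewrite lee_fin sqr_ge0.
- by apply/measurable_EFinP; exact: measurable_funX.
- by apply/measurable_EFinP; apply: measurable_funD; exact: measurable_funX.
- by move=> x _; rewrite lee_fin lerDr sqr_ge0.
Qed.

Local Open Scope ereal_scope.

(** The real and imaginary parts of the transform of u are sums of four cosine and
    sine transforms of the real and imaginary parts of u. *)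
Lemma hausdorff_young p : (1 <= p <= 2)%R ->
  exists2 C : R, (0 < C)%R & forall u, Lp 1 u ->
    Lpnorm (hoelder_conjugate p%:E) (fourierL1 u) <= C%:E * Lpnorm p%:E u.
Proof.
move=> p12.
have [C1 C10 HC] := hausdorff_young_abstract A0 (fun a ia => measurable_costr (L1_measurable ia))
  (fun a xi => @le_costr R n a xi) costr_add costr_L2 p12.
have [C2 C20 HS] := hausdorff_young_abstract A0 (fun a ia => measurable_sintr (L1_measurable ia))
  (fun a xi => @le_sintr R n a xi) sintr_add sintr_L2 p12.
have p1 : 1 <= p%:E by rewrite lee_fin; case/andP: p12.
have q1 := hoelder_conj_ge1 p1.
set q := hoelder_conjugate _ in HC HS q1 *.
have q0 : 0 < q by rewrite (lt_le_trans _ q1).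
exists (2 * (C1 + C2))%R => [|u Lu]; first by rewrite mulr_gt0// addr_gt0.
have ir := Lp1_integrable_Re Lu; have ii := Lp1_integrable_Im Lu.
have [mr mi _] := Lu.
have mu_ := measurable_normc (conj mr mi).
have leN (a : X -> R) : measurable_fun setT a -> (forall x, (`|a x| <= nc (u x))%R) ->
    'N[mu]_p%:E[EFin \o a] <= Lpnorm p%:E u.
  move=> ma au; rewrite -[leRHS]mul1e; apply: le_LnormZ => //.
  - by rewrite (lt_le_trans _ p1).
  - by move=> x; rewrite mul1r (ger0_norm (normc_nneg _)).
have Nr := leN _ mr (fun x => ler_Re_normc (u x)).
have Ni := leN _ mi (fun x => ler_Im_normc (u x)).
pose T1 xi := `|costr (fun x => Re (u x)) xi|%R.
pose T2 xi := `|sintr (fun x => Im (u x)) xi|%R.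
pose T3 xi := `|costr (fun x => Im (u x)) xi|%R.
pose T4 xi := `|sintr (fun x => Re (u x)) xi|%R.
have mT1 : measurable_fun setT T1 by apply: measurableT_comp => //; exact: measurable_costr.
have mT2 : measurable_fun setT T2 by apply: measurableT_comp => //; exact: measurable_sintr.
have mT3 : measurable_fun setT T3 by apply: measurableT_comp => //; exact: measurable_costr.
have mT4 : measurable_fun setT T4 by apply: measurableT_comp => //; exact: measurable_sintr.
have N_abs (T : X -> R) : 'N[mu]_q[EFin \o (fun x => `|T x|%R)] = 'N[mu]_q[EFin \o T].
  by rewrite -[RHS]Lnorm_abse.
have le1 C' T a : 'N[mu]_q[EFin \o T] <= C'%:E * 'N[mu]_p%:E[EFin \o a] ->
    (0 < C')%R -> 'N[mu]_p%:E[EFin \o a] <= Lpnorm p%:E u ->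
    'N[mu]_q[EFin \o (fun x => `|T x|%R)] <= C'%:E * Lpnorm p%:E u.
  move=> h C'0 h2; rewrite N_abs; apply: (le_trans h).
  by rewrite lee_wpmul2l// lee_fin ltW.
have N1 := le1 _ _ _ (HC _ ir) C10 Nr.
have N2 := le1 _ _ _ (HS _ ii) C20 Ni.
have N3 := le1 _ _ _ (HC _ ii) C10 Ni.
have N4 := le1 _ _ _ (HS _ ir) C20 Nr.
apply: (@le_trans _ _ ('N[mu]_q[EFin \o ((T1 \+ T2) \+ (T3 \+ T4))%R])).
  rewrite -[leRHS]mul1e; apply: le_LnormZ => //.
  - exact: measurable_normc (cmeasurable_fourierL1 Lu).
  - by apply: measurable_funD; exact: measurable_funD.
  move=> xi; rewrite mul1r (ger0_norm (normc_nneg _)).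
  have -> : ((T1 \+ T2) \+ (T3 \+ T4))%R xi = (T1 xi + T2 xi + (T3 xi + T4 xi))%R by [].
  rewrite [leRHS]ger0_norm; last by rewrite !addr_ge0 ?normr_ge0.
  apply: (le_trans (ler_normc_Re_Im _)).
  rewrite Re_fourierL1// Im_fourierL1// lerD//; first exact: ler_normD.
  exact: ler_normB.
apply: (le_trans (eminkowski _ _ _ q1)); [exact: measurable_funD..|].
rewrite (_ : (2 * (C1 + C2))%:E = (C1%:E + C2%:E) + (C1%:E + C2%:E)); last first.
  by rewrite -!EFinD; congr EFin; ring.
rewrite !ge0_muleDl ?adde_ge0 ?lee_fin ?(ltW C10) ?(ltW C20)//.
apply: leeD.
  by apply: (le_trans (eminkowski _ _ _ q1)) => //; exact: leeD.
by apply: (le_trans (eminkowski _ _ _ q1)) => //; exact: leeD.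
Qed.

(** The inequality passes to the limit along the approximating sequence that
    defines the Fourier transform on L^p. *)
Lemma is_fourier_Lpnorm_le p : (1 <= p <= 2)%R ->
  exists2 C : R, (0 < C)%R & forall g H, is_fourier p%:E g H ->
    Lpnorm (hoelder_conjugate p%:E) H <= C%:E * Lpnorm p%:E g.
Proof.
move=> p12; have [C C0 HY] := hausdorff_young p12; exists C => // g H.
have p1 : 1 <= p%:E by rewrite lee_fin; case/andP: p12.
have q1 := hoelder_conj_ge1 p1.
set q := hoelder_conjugate _ in HY q1 *.
case=> Lg LH [u [Lu cu cF]].
have mg := Lp_cmeasurable Lg; have mH := Lp_cmeasurable LH.
pose e1 n := Lpnorm p%:E (fun x => u n x - g x)%R.
pose e2 n := Lpnorm q (fun xi => fourierL1 (u n) xi - H xi)%R.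
have key k : Lpnorm q H <= e2 k + C%:E * (e1 k + Lpnorm p%:E g).
  have [Lu1 Lup] := Lu k; have muk := Lp_cmeasurable Lup.
  have mF := cmeasurable_fourierL1 Lu1.
  have -> : Lpnorm q H = Lpnorm q (fun xi => (H xi - fourierL1 (u k) xi) + fourierL1 (u k) xi)%R.
    by congr Lpnorm; apply/funext => xi; rewrite subrK.
  apply: (le_trans (cNorm_triangle _ _ _ q1)) => //; first exact: cmeasurableB.
  apply: leeD.
    rewrite /e2 -[leRHS]mul1e; apply: le_cNormZ => //; try exact: cmeasurableB.
      by rewrite (lt_le_trans _ q1).
    by move=> xi; rewrite mul1r -opprB normcN.
  apply: (le_trans (HY _ Lu1)); rewrite lee_wpmul2l ?lee_fin ?(ltW C0)//.
  have -> : Lpnorm p%:E (u k) = Lpnorm p%:E (fun x => (u k x - g x) + g x)%R.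
    by congr Lpnorm; apply/funext => x; rewrite subrK.
  by apply: (cNorm_triangle _ _ _ p1) => //; exact: cmeasurableB.
have lim : e2 k + C%:E * (e1 k + Lpnorm p%:E g) @[k --> \oo] --> 0 + C%:E * (0 + Lpnorm p%:E g).
  have gfin : Lpnorm p%:E g \is a fin_num by rewrite ge0_fin_numE ?Lpnorm_ge0// Lp_lty.
  apply: cvgeD => //.
  apply: cvgeZl => //; apply: cvgeD => //; last exact: cvg_cst.
move: lim; rewrite !add0e => lim.
rewrite -(cvg_lim _ lim)//; apply: lime_ge; first by apply/cvg_ex; eexists; exact: lim.
by near=> k; exact: key.
Unshelve. all: by end_near.
Qed.

End hausdorff_young.

(** * The Fourier transform of a difference *)
Section fourier_translation.
Context {R : realType} {n : nat}.
Local Notation X := 'rV[R]_n.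
Local Notation mu := (lebesgue_rV R n).
Implicit Types (u f g G H : X -> R[i]) (x y xi : X) (q : \bar R) (p : R).
Local Notation Re := complex.Re.
Local Notation Im := complex.Im.
Local Notation nc := Normc.normc.
Local Notation L1 a := (mu.-integrable setT (EFin \o a)).

Definition translate y f x := f (x + y).

Definition difference y f x := f (x + y) - f x.

Lemma cmeasurable_translate y f : cmeasurable f -> cmeasurable (translate y f).
Proof.
move=> [fr fi]; split.
- exact: (measurableT_comp fr (measurable_rV_add y)).
- exact: (measurableT_comp fi (measurable_rV_add y)).
Qed.

Lemma Lpnorm_translate p y f : cmeasurable f ->
  Lpnorm p%:E (translate y f) = Lpnorm p%:E f.
Proof.
move=> mf; rewrite !LpnormE !LnormE.
rewrite -(@integral_translate R n y (fun x => (`|nc (f x)| `^ p)%:E))//.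
apply/measurable_EFinP; apply: (measurableT_comp (@measurable_powR R _)).
by apply: measurableT_comp => //; exact: measurable_normc.
Qed.

Lemma Lp_translate p y f : Lp p%:E f -> Lp p%:E (translate y f).
Proof.
move=> Lf; have mf := Lp_cmeasurable Lf; apply: Lp_mk.
  exact: cmeasurable_translate.
by rewrite Lpnorm_translate// Lp_lty.
Qed.

Lemma LpB q f g : (1 <= q)%E -> Lp q f -> Lp q g -> Lp q (fun x => f x - g x).
Proof.
move=> q1 Lf Lg; have mf := Lp_cmeasurable Lf; have mg := Lp_cmeasurable Lg.
apply: Lp_mk; first exact: cmeasurableB.
apply: le_lt_trans (cNorm_triangle _ mf (cmeasurableN mg) q1) _.
rewrite lte_add_pinfty//; first exact: Lp_lty.
under eq_fun do rewrite normcN.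
exact: Lp_lty.
Qed.

Lemma Lp_difference p y f : 1 <= p -> Lp p%:E f -> Lp p%:E (difference y f).
Proof. by move=> p1 Lf; apply: LpB => //; exact: Lp_translate. Qed.

Lemma cintegralZ (c : R[i]) f : L1 (fun x => Re (f x)) -> L1 (fun x => Im (f x)) ->
  cintegral (fun x => c * f x) = c * cintegral f.
Proof.
move=> ir ii; have iZ (b : R) (h : X -> R) : L1 h -> L1 (fun x => b * h x).
  by move=> ih; exact: (integrableZl measurableT b ih).
apply: complex_eq; rewrite ?ReCM ?ImCM /=.
- under eq_Rintegral do rewrite ReCM.
  by rewrite RintegralB ?RintegralZl//; exact: iZ.
- under eq_Rintegral do rewrite ImCM.
  by rewrite RintegralD ?RintegralZl//; exact: iZ.
Qed.

Lemma cintegralB f g : L1 (fun x => Re (f x)) -> L1 (fun x => Im (f x)) ->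
  L1 (fun x => Re (g x)) -> L1 (fun x => Im (g x)) ->
  cintegral (fun x => f x - g x) = cintegral f - cintegral g.
Proof.
move=> fr fi gr gi; apply: complex_eq; rewrite ?ReCD ?ImCD ?ReCN ?ImCN /=.
- under eq_Rintegral do rewrite ReCD ReCN.
  by rewrite RintegralB.
- under eq_Rintegral do rewrite ImCD ImCN.
  by rewrite RintegralB.
Qed.

Lemma cintegral_translate y f : cmeasurable f ->
  cintegral (fun x => f (x + y)) = cintegral f.
Proof.
move=> [fr fi]; apply: complex_eq; rewrite /= /Rintegral; congr fine.
- by rewrite -[RHS](@integral_translate R n y (fun x => (Re (f x))%:E))//; exact/measurable_EFinP.
- by rewrite -[RHS](@integral_translate R n y (fun x => (Im (f x))%:E))//; exact/measurable_EFinP.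
Qed.

Lemma cmeasurable_expi_dotp xi : cmeasurable (fun x => expi (- dotp xi x)).
Proof.
split => /=.
- under eq_fun do rewrite cosN dotpC; exact: measurable_cos_dotp.
- under eq_fun do rewrite sinN dotpC; apply: measurableT_comp => //.
  exact: measurable_sin_dotp.
Qed.

Lemma Lp1_modulate xi u : Lp 1%E u -> Lp 1%E (fun x => expi (- dotp xi x) * u x).
Proof.
move=> Lu; have mu_ := Lp_cmeasurable Lu.
have mm := cmeasurableM (cmeasurable_expi_dotp xi) mu_.
apply: Lp_mk => //; apply: le_lt_trans (Lp_lty Lu).
rewrite -[leRHS]mul1e; apply: le_cNormZ => // x.
by rewrite mul1r Normc.normcM normc_expi mul1r.
Qed.

Lemma fourierL1_translate y u xi : Lp 1%E u ->
  fourierL1 (translate y u) xi = expi (dotp y xi) * fourierL1 u xi.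
Proof.
move=> Lu; have Lm := Lp1_modulate xi Lu.
have ir := Lp1_integrable_Re Lm; have ii := Lp1_integrable_Im Lm.
rewrite /fourierL1 -cintegralZ// -[RHS](cintegral_translate y); last first.
  have [mr mi] := Lp_cmeasurable Lm; split.
  - under eq_fun do rewrite ReCM; apply: measurable_funB; exact: measurable_funM.
  - under eq_fun do rewrite ImCM; apply: measurable_funD; exact: measurable_funM.
congr cintegral; apply/funext => x.
by rewrite mulrA -expiD dotpDr (dotpC y) opprD addrCA subrr addr0.
Qed.

Lemma fourierL1_difference y u xi : Lp 1%E u ->
  fourierL1 (difference y u) xi = (expi (dotp y xi) - 1) * fourierL1 u xi.
Proof.
move=> Lu; have Lm := Lp1_modulate xi Lu.
have Lm' := Lp1_modulate xi (Lp_translate y Lu).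
rewrite mulrBl mul1r -fourierL1_translate// /fourierL1 -cintegralB.
- by congr cintegral; apply/funext => x; rewrite mulrBr.
- exact: Lp1_integrable_Re.
- exact: Lp1_integrable_Im.
- exact: Lp1_integrable_Re.
- exact: Lp1_integrable_Im.
Qed.

Lemma cmeasurable_expiB1 y : cmeasurable (fun xi => expi (dotp y xi) - 1).
Proof.
split.
- under eq_fun do rewrite ReCD dotpC; apply: measurable_funD => //.
  exact: measurable_cos_dotp.
- under eq_fun do rewrite ImCD dotpC; apply: measurable_funD => //.
  exact: measurable_sin_dotp.
Qed.

Lemma normc_expiB1_le2 (t : R) : nc (expi t - 1) <= 2.
Proof. by rewrite normc_expiB1 normrM ger0_norm// ler_piMr// sin_max. Qed.

(** If u_k approximates f, then the differences of u_k approximate the difference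
    of f in L^p, and their transforms converge in L^q because the multiplier is
    bounded by 2. *)
Lemma is_fourier_difference p y f G : 1 <= p -> is_fourier p%:E f G ->
  is_fourier p%:E (difference y f) (fun xi => (expi (dotp y xi) - 1) * G xi).
Proof.
move=> p1 [Lf LG [u [Lu cu cF]]].
have p1' : (1 <= p%:E)%E by rewrite lee_fin.
have q1 := hoelder_conj_ge1 p1'.
set q := hoelder_conjugate _ in LG q1 cF *.
have q0 : (0 < q)%E by rewrite (lt_le_trans _ q1).
have mf := Lp_cmeasurable Lf; have mG := Lp_cmeasurable LG.
have me := cmeasurable_expiB1 y.
have bnd (h : X -> R[i]) : cmeasurable h ->
    (Lpnorm q (fun xi => ((expi (dotp y xi) - 1) * h xi)%R) <= 2%:E * Lpnorm q h)%E.
  move=> mh; apply: le_cNormZ => //; first exact: cmeasurableM.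
  by move=> xi; rewrite Normc.normcM ler_wpM2r ?normc_nneg ?normc_expiB1_le2.
split.
- exact: Lp_difference.
- apply: Lp_mk; first exact: cmeasurableM.
  apply: le_lt_trans (bnd _ mG) _; rewrite lte_mul_pinfty//.
  exact: Lp_lty.
have cvg2 (e : nat -> \bar R) : e k @[k --> \oo] --> 0%E -> (2%:E * e k)%E @[k --> \oo] --> 0%E.
  by move=> ce; rewrite -(mule0 2%:E); exact: cvgeZl.
exists (fun k => difference y (u k)); split.
- by move=> k; have [Lu1 Lup] := Lu k; split; exact: Lp_difference.
- apply: (squeeze_cvge _ (cvg_cst 0%E) (cvg2 _ cu)); near=> k.
  rewrite Lpnorm_ge0/=; have [Lu1 Lup] := Lu k; have muk := Lp_cmeasurable Lup.
  have -> : (fun x => difference y (u k) x - difference y f x) =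
      (fun x => translate y (fun z => u k z - f z) x + (- (u k x - f x))).
    by apply/funext => x; rewrite /difference /translate; ring.
  have muf := cmeasurableB muk mf.
  apply: (le_trans (cNorm_triangle _ (cmeasurable_translate y muf) (cmeasurableN muf) p1')).
  rewrite -LpnormE Lpnorm_translate//.
  under [X in (_ + Lnorm _ _ (EFin \o X))%E]eq_fun do rewrite normcN.
  by rewrite -LpnormE mule_natl mule2n.
- apply: (squeeze_cvge _ (cvg_cst 0%E) (cvg2 _ cF)); near=> k.
  rewrite Lpnorm_ge0/=; have [Lu1 Lup] := Lu k.
  under eq_fun do rewrite fourierL1_difference// -mulrBr.
  by apply: bnd; apply: cmeasurableB => //; exact: cmeasurable_fourierL1.
Unshelve. all: by end_near.
Qed.

Lemma fdiff_nat0 y f : fdiff_nat 0 y f = f.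
Proof.
apply/funext => x; rewrite /fdiff_nat big_ord_recl big_ord0 /= scale0r !addr0.
by rewrite expr0 bin0 !mul1r.
Qed.

(** Pascal's rule identifies the binomial sum with an iterated difference. *)
Lemma fdiff_natS k y f : fdiff_nat k.+1 y f = difference y (fdiff_nat k y f).
Proof.
apply/funext => x; rewrite /fdiff_nat /difference.
pose F j := f (x + j%:R *: y).
transitivity (\sum_(j < k.+1) (-1) ^+ (k - j) * 'C(k, j)%:R * F j.+1 -
   \sum_(j < k.+1) (-1) ^+ (k - j) * 'C(k, j)%:R * F j); last first.
  congr (_ - _); apply: eq_bigr => j _; congr (_ * f _).
  by rewrite -natr1 scalerDl scale1r -addrA (addrC y).
rewrite big_ord_recl subn0 bin0 mulr1.
under eq_bigr => j _ do rewrite /= /bump/= add1n subSS binS natrD mulrDr mulrDl.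
rewrite big_split/= addrA addrC; congr (_ + _).
rewrite big_ord_recr/= bin_small// mulr0 mul0r addr0.
rewrite [in RHS]big_ord_recl/= subn0 bin0 mulr1 opprD exprS mulN1r mulNr; congr (_ + _).
rewrite -sumrN; apply: eq_bigr => j _.
rewrite /bump/= add1n -!mulNr; congr (_ * _ * _).
by rewrite -(subnSK (ltn_ord j)) exprS mulN1r.
Qed.

Lemma is_fourier_fdiff_nat k p y f G : 1 <= p -> is_fourier p%:E f G ->
  is_fourier p%:E (fdiff_nat k y f) (fun xi => (expi (dotp y xi) - 1) ^+ k * G xi).
Proof.
move=> p1 FG; elim: k => [|k IH].
  by rewrite fdiff_nat0; under eq_fun do rewrite expr0 mul1r.
rewrite fdiff_natS; under eq_fun do rewrite exprS -mulrA.
exact: is_fourier_difference.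
Qed.

End fourier_translation.

(** * Lower bound for the norm of a difference *)
Section difference_symbol.
Context {R : realType} {n : nat}.
Local Notation X := 'rV[R]_n.
Local Notation mu := (lebesgue_rV R n).
Implicit Types (f g G : X -> R[i]) (x y xi : X) (p m : R).
Local Notation nc := Normc.normc.

Definition symbol m y xi : R := `|2 * sin (dotp y xi / 2)| `^ m.

Lemma symbol_ge0 m y xi : 0 <= symbol m y xi.
Proof. exact: powR_ge0. Qed.

Lemma normc_real (a : R) : nc (a%:C)%C = `|a|.
Proof. by rewrite /= expr0n/= addr0 sqrtr_sqr. Qed.

Lemma normc_cpowR (z : R[i]) m : m != 0 -> nc (cpowR z m) = nc z `^ m.
Proof.
move=> m0; rewrite /cpowR; case: eqP => [->|_].
  by rewrite Normc.normc0 powR0.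
by rewrite Normc.normcM normc_real normc_expi mulr1 ger0_norm// powR_ge0.
Qed.

Lemma normc_fdiff_symbol m y xi : m != 0 -> nc (fdiff_symbol m y xi) = symbol m y xi.
Proof.
move=> m0; rewrite /fdiff_symbol Normc.normcM normc_expi mulr1 normc_cpowR//.
by rewrite /symbol normc_def_Re_Im/= expr0n/= add0r sqrtr_sqr.
Qed.

Lemma normcX (z : R[i]) k : nc (z ^+ k) = nc z ^+ k.
Proof.
elim: k => [|k IH]; first by rewrite !expr0 Normc.normc1.
by rewrite !exprS Normc.normcM IH.
Qed.

Lemma normc_nat_symbol k y xi : nc ((expi (dotp y xi) - 1) ^+ k) = symbol k%:R y xi.
Proof. by rewrite normcX normc_expiB1 /symbol powR_mulrn. Qed.

Lemma fdiff_norm_ge0 p m y f : (0 <= fdiff_norm p%:E m y f)%E.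
Proof. by apply: le_ereal_inf_tmp => _ [g _ <-]; exact: Lpnorm_ge0. Qed.

(** A constant approximating sequence will do. *)
Lemma is_fourier1 f : Lp 1%E f -> is_fourier 1%E f (fourierL1 f).
Proof.
move=> Lf; have mF := cmeasurable_fourierL1 Lf.
have [C C0 HY] : exists2 C : R, 0 < C & forall u : X -> R[i], Lp 1%E u ->
    (Lpnorm (hoelder_conjugate 1) (fourierL1 u) <= C%:E * Lpnorm 1 u)%E.
  by apply: hausdorff_young; rewrite lexx ler1n.
split => //.
  apply: Lp_mk => //; apply: le_lt_trans (HY _ Lf) _.
  by rewrite lte_mul_pinfty ?lee_fin ?(ltW C0)//; exact: Lp_lty.
have N0 q : (0 < q)%E -> Lpnorm q (fun _ : X => 0 : R[i]) = 0%E.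
  move=> q0; rewrite /Lpnorm -[RHS](Lnorm0 mu (p := q)) ?gt_eqF//.
  by apply: eq_Lnorm => x /=; rewrite expr0n/= addr0 sqrtr0.
exists (fun=> f); split => //.
- under eq_fun => k.
    under [X in Lpnorm _ X]eq_fun do rewrite subrr.
    rewrite N0//; over.
  exact: cvg_cst.
- under eq_fun => k.
    under [X in Lpnorm _ X]eq_fun do rewrite subrr.
    rewrite N0//; last by rewrite hoelder_conjugate1.
    over.
  exact: cvg_cst.
Qed.

(** The second case is the default value, at which psi vanishes. *)
Lemma fourierP p f : Lp p%:E f ->
  is_fourier p%:E f (fourier p%:E f) \/ fourier p%:E f = (fun=> 0).
Proof.
rewrite /fourier; case: eqP => [->|_ _]; first by move=> Lf; left; exact: is_fourier1.
by case: xgetP => [G _ FG|]; [left|right].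
Qed.

(** Whether m is a natural number or not, every version of the difference has a
    Fourier transform whose modulus is symbol m y times that of the transform of
    f; the norm of the difference is an infimum over the versions. *)
Lemma fdiff_norm_ge p m : 1 <= p <= 2 -> 0 < m ->
  exists2 c : R, 0 < c & forall f, is_fourier p%:E f (fourier p%:E f) -> forall y,
    (c%:E * 'N[mu]_(hoelder_conjugate p%:E)
       [EFin \o (fun xi => symbol m y xi * nc (fourier p%:E f xi))%R]
     <= fdiff_norm p%:E m y f)%E.
Proof.
move=> p12 m0; have [C C0 HY] := @is_fourier_Lpnorm_le R n p p12.
have p1 : 1 <= p by case/andP: p12.
exists C^-1; first by rewrite invr_gt0.
move=> f FG y; apply: le_ereal_inf_tmp => _ [g gD <-].
rewrite lee_pdivrMl//.
have [H FH HE] : exists2 H, is_fourier p%:E g H &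
    forall xi, nc (H xi) = symbol m y xi * nc (fourier p%:E f xi).
  move: gD; rewrite /fdiff; case: ifPn => [mn|_] gD.
  - exists (fun xi => (expi (dotp y xi) - 1) ^+ Num.truncn m * fourier p%:E f xi).
      by rewrite gD; exact: is_fourier_fdiff_nat.
    by move=> xi; rewrite Normc.normcM normc_nat_symbol truncnK.
  - exists (fun xi => fdiff_symbol m y xi * fourier p%:E f xi) => //.
    by move=> xi; rewrite Normc.normcM normc_fdiff_symbol// gt_eqF.
have -> : (fun xi => symbol m y xi * nc (fourier p%:E f xi)) = (fun xi => nc (H xi)).
  by apply/funext => xi; rewrite HE.
exact: HY.
Qed.

Lemma measurable_symbol2 m : measurable_fun setT (fun z : X * X => symbol m z.1 z.2).
Proof.
apply: (measurableT_comp (@measurable_powR R _)); apply: measurableT_comp => //.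
apply: measurable_funM => //.
apply: (measurableT_comp (continuous_measurable_fun (@continuous_sin R))).
by apply: measurable_funM => //; exact: measurable_dotp.
Qed.

End difference_symbol.

(** * Euclidean geometry of row vectors *)
Section euclidean_geometry.
Context {R : realType} {n : nat}.
Local Notation X := 'rV[R]_n.
Local Notation mu := (lebesgue_rV R n).
Implicit Types (x y v xi : X) (j : 'I_n).

Lemma dotp_ge0 x : 0 <= dotp x x.
Proof. by apply: sumr_ge0 => i _; rewrite -expr2 sqr_ge0. Qed.

Lemma enorm_ge0 x : 0 <= enorm x.
Proof. exact: sqrtr_ge0. Qed.

Lemma enorm_sqr x : enorm x ^+ 2 = dotp x x.
Proof. by rewrite sqr_sqrtr// dotp_ge0. Qed.

Lemma enorm_eq0 x : (enorm x == 0) = (x == 0).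
Proof.
rewrite /enorm sqrtr_eq0; apply/idP/eqP => [x0|->]; last first.
  by rewrite /dotp big1// => i _; rewrite mxE mul0r.
have /eqP : dotp x x = 0 by apply/eqP; rewrite eq_le x0 dotp_ge0.
rewrite /dotp psumr_eq0; last by move=> i _; rewrite -expr2 sqr_ge0.
move=> /allP x00; apply/rowP => i; rewrite mxE.
by have := x00 i; rewrite mem_index_enum mulf_eq0 orbb => /(_ isT)/eqP.
Qed.

Lemma enorm_gt0 x : (0 < enorm x) = (x != 0).
Proof. by rewrite lt_def enorm_ge0 andbT enorm_eq0. Qed.

Lemma dotpDl x y xi : dotp (x + y) xi = dotp x xi + dotp y xi.
Proof. by rewrite dotpC dotpDr !(dotpC xi). Qed.

Lemma dotpZl (a : R) x y : dotp (a *: x) y = a * dotp x y.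
Proof. by rewrite /dotp mulr_sumr; apply: eq_bigr => i _; rewrite mxE mulrA. Qed.

Lemma dotpZr (a : R) x y : dotp x (a *: y) = a * dotp x y.
Proof. by rewrite dotpC dotpZl dotpC. Qed.

Lemma enormZ (a : R) x : enorm (a *: x) = `|a| * enorm x.
Proof.
by rewrite /enorm dotpZl dotpZr mulrA -expr2 sqrtrM ?sqr_ge0// sqrtr_sqr.
Qed.

Lemma cauchy_schwarz x y : `|dotp x y| <= enorm x * enorm y.
Proof.
wlog xy0 : x / 0 <= dotp x y.
  move=> H; case: (leP 0 (dotp x y)) => [|xy]; first exact: H.
  have := H (- x); rewrite -scaleN1r dotpZl enormZ mulN1r normrN normrN1 mul1r.
  by apply; rewrite oppr_ge0 ltW.
rewrite ger0_norm//.
have [->|x0] := eqVneq x 0.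
  by rewrite -(scale0r (0 : X)) dotpZl mul0r enormZ normr0 !mul0r.
have [->|y0] := eqVneq y 0.
  by rewrite -(scale0r (0 : X)) dotpZr mul0r enormZ normr0 mul0r mulr0.
have A0 : 0 < enorm x * enorm y by rewrite mulr_gt0// enorm_gt0.
rewrite -(ler_pM2l A0).
have := dotp_ge0 (enorm y *: x + (- enorm x) *: y).
rewrite !(dotpDl, dotpDr, dotpZl, dotpZr) -!enorm_sqr (dotpC y x).
by move: (dotp x y) (enorm x) (enorm y) => s A B; nra.
Qed.

Lemma dotp_delta j xi : dotp (delta_mx 0 j) xi = xi ord0 j.
Proof.
rewrite /dotp (bigD1 j)//= mxE !eqxx mul1r big1 ?addr0// => i ij.
by rewrite mxE eqxx/= (negbTE ij) mul0r.
Qed.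

Lemma ler_coord_enorm x j : `|x ord0 j| <= enorm x.
Proof.
rewrite -sqrtr_sqr /enorm ler_wsqrtr// /dotp (bigD1 j)//= -expr2 lerDl.
by apply: sumr_ge0 => i _; rewrite -expr2 sqr_ge0.
Qed.

Lemma ler_enorm x (c : R) : 0 <= c -> (forall i, `|x ord0 i| <= c) -> enorm x <= n%:R * c.
Proof.
move=> c0 xc; rewrite -[leRHS]ger0_norm ?mulr_ge0// -sqrtr_sqr ler_wsqrtr//.
apply: (@le_trans _ _ (\sum_(i < n) c ^+ 2)).
  apply: ler_sum => i _; rewrite -expr2 -[leLHS]real_normK ?num_real//.
  by rewrite ler_sqr ?nnegrE.
rewrite sumr_const card_ord exprMn -[leLHS]mulr_natl ler_wpM2r ?sqr_ge0//.
by rewrite -natrX ler_nat; case: (n) => // k; rewrite leq_pmulr.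
Qed.

(** Take the coordinate of largest modulus. *)
Lemma large_coord x : (0 < n)%N -> exists j, enorm x <= n%:R * `|x ord0 j|.
Proof.
move=> n0; have [j xj] : exists j, forall i, `|x ord0 i| <= `|x ord0 j|.
  case: (@arg_maxP _ _ _ (Ordinal n0) xpredT (fun i => `|x ord0 i|)) => // j _ jmax.
  by exists j => i; exact: jmax.
by exists j; exact: ler_enorm.
Qed.

Definition box (a : 'I_n -> R) (r : R) : set X :=
  [set x | forall i, a i <= x ord0 i <= a i + r].

Lemma measurable_box a r : measurable (box a r).
Proof.
have -> : box a r = \bigcap_(i in [set: 'I_n]) ((fun x : X => x ord0 i) @^-1` `[a i, a i + r]).
  apply/seteqP; split => x /=.
    by move=> bx i _ /=; rewrite in_itv/=; exact: bx.
  by move=> bx i; have := bx i I; rewrite /= in_itv.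
apply: fin_bigcap_measurable => // i _.
by rewrite -[X in measurable X]setTI; exact: measurable_coord.
Qed.

Lemma lebesgue_box a r : 0 < r -> mu (box a r) = (r ^+ n)%:E.
Proof.
move=> r0; have -> : mu (box a r) = (\int[mu]_x (\1_(box a r) x)%:E)%E.
  by rewrite integral_indic// ?setIT//; exact: measurable_box.
have -> : r ^+ n = \prod_(i < n) r by rewrite prodr_const card_ord.
rewrite -(@ge0_integral_prod R n (fun i t => \1_(`[a i, a i + r]%classic : set (measurableTypeR R)) t) (fun=> r)).
- apply: eq_integral => x _; congr EFin; rewrite indicE.
  case: (boolP (x \in box a r)) => [/set_mem bx|bx].
    rewrite big1// => i _; rewrite indicE mem_set//= in_itv/=; exact: bx.
  have [i bi] : exists i, ~~ (a i <= x ord0 i <= a i + r).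
    apply/existsP; rewrite -negb_forall; apply/negP => /forallP h.
    by move/negP: bx; apply; apply/mem_set.
  rewrite (bigD1 i)//= indicE memNset ?mul0r//= in_itv/=; exact/negP.
- by move=> i; exact: measurable_indic.
- by move=> i t; rewrite indicE.
- move=> i; rewrite integral_indic// setIT.
  rewrite [LHS]lebesgue_measure_itv/= lte_fin ltrDl r0 -EFinB.
  by rewrite addrAC subrr add0r.
Qed.

End euclidean_geometry.

(** * The average of the symbol over the directions *)
Section radial_slices.
Context {R : realType} {n : nat}.
Local Notation X := 'rV[R]_n.
Local Notation mu := (lebesgue_rV R n).
Implicit Types (x y v xi : X) (j : 'I_n).

Let d : R := n%:R.

Hypothesis n2 : (2 <= n)%N.

Let d2 : 2 <= d. Proof. by rewrite /d ler_nat. Qed.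
Let d0 : 0 < d. Proof. exact: lt_le_trans d2. Qed.

(* L is the size of the coordinates other than the j-th one; with d coordinates
   of size at most 2 L the vector stays in the unit ball. The smaller eta bounds
   the j-th coordinate, and 2 d eta = L makes the change of the length negligible
   in radial_variation. *)
Let L := (2 * d)^-1.
Let eta := L / (2 * d).

Let L0 : 0 < L. Proof. by rewrite invr_gt0 mulr_gt0. Qed.
Let eta0 : 0 < eta. Proof. by rewrite divr_gt0// mulr_gt0. Qed.
Let dL : d * L = 2^-1. Proof. by rewrite /L; field; rewrite gt_eqF. Qed.
Let etaL : eta * (2 * d) = L. Proof. by rewrite /eta divfK// gt_eqF// mulr_gt0. Qed.
Let eta_le : eta <= L.
Proof. by rewrite -etaL ler_peMr ?(ltW eta0)//; move: d2; lra. Qed.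

Definition slab j : X -> Prop := fun x =>
  - eta <= x ord0 j <= eta /\ forall i, i != j -> L <= x ord0 i <= 2 * L.

Definition start_box j := box (fun i => if i == j then - eta else L) eta.

Lemma start_box_slab j x (s : R) : 0 <= s <= eta -> start_box j x ->
  slab j (x + s *: delta_mx 0 j).
Proof.
move=> /andP[s0 s1] bx; split.
  have := bx j; rewrite eqxx !mxE !eqxx mulr1 => /andP[h1 h2].
  by apply/andP; split; lra.
move=> i ij; have := bx i; rewrite (negbTE ij) !mxE eqxx (negbTE ij) mulr0 addr0.
by move=> /andP[h1 h2]; rewrite h1/= (le_trans h2)//; move: eta_le; lra.
Qed.

Lemma slab_enorm_le1 j v : slab j v -> enorm v <= 1.
Proof.
move=> [vj vi]; have -> : 1 = d * (2 * L) by rewrite mulrCA dL divff.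
apply: ler_enorm => [|i]; first by rewrite mulr_ge0// ltW.
have [->|ij] := eqVneq i j.
  rewrite ler_norml; move: vj => /andP[h1 h2]; move: eta_le L0 => h3 h4.
  by apply/andP; split; lra.
have /andP[h1 h2] := vi _ ij.
by rewrite ger0_norm// (le_trans _ h1)// ltW.
Qed.

(** Here the dimension matters: some coordinate other than the j-th one keeps v
    away from the origin. *)
Lemma slab_enorm_ge j v : slab j v -> L <= enorm v.
Proof.
move=> [_ vi].
have [i ij] : exists i : 'I_n, i != j.
  have [j0|j0] := eqVneq (j : nat) 0%N.
    by exists (Ordinal n2); rewrite -val_eqE/= j0.
  by exists (Ordinal (ltnW n2)); rewrite -val_eqE/= eq_sym.
have /andP[h1 _] := vi _ ij.
by rewrite (le_trans h1)// (le_trans (ler_norm _))// ler_coord_enorm.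
Qed.

(** Let xi be dominated by its j-th coordinate. In the slab x is nearly orthogonal
    to the j-th axis, so that moving x by s along this axis hardly changes its
    length, while dotp x xi changes by s times xi_j. Hence the direction of x
    rotates relatively to xi at a rate comparable to the length of xi. *)
Lemma radial_variation j x xi (s : R) : 0 < s <= eta -> start_box j x ->
  enorm xi <= d * `|xi ord0 j| ->
  s * enorm xi / (2 * d) <=
    `|dotp (radial (x + s *: delta_mx 0 j)) xi - dotp (radial x) xi|
    <= 4 * d * s * enorm xi.
Proof.
move=> /andP[s0 s1] bx xij; set w := x + s *: _.
have sx : slab j x.
  rewrite -[x]addr0 -(scale0r (delta_mx 0 j)); apply: start_box_slab => //.
  by rewrite lexx ltW.
have sw : slab j w by apply: start_box_slab => //; rewrite s1 ltW.
have a1 := slab_enorm_ge sx; have a2 := slab_enorm_le1 sx.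
have b1 := slab_enorm_ge sw; have b2 := slab_enorm_le1 sw.
have ab : enorm w ^+ 2 - enorm x ^+ 2 = s * (2 * x ord0 j + s).
  rewrite !enorm_sqr /w !(dotpDl, dotpDr, dotpZl, dotpZr) (dotpC x) !dotp_delta.
  by rewrite mxE !eqxx/=; ring.
have dw : dotp w xi = dotp x xi + s * xi ord0 j.
  by rewrite /w dotpDl dotpZl dotp_delta.
have cs := cauchy_schwarz x xi.
have Lp : 0 < L := L0.
rewrite /radial !dotpZl dw.
have xj : `|2 * x ord0 j + s| <= 2 * eta.
  have := bx j; rewrite eqxx => /andP[h1 h2].
  by rewrite ler_norml; apply/andP; split; lra.
have := ler_coord_enorm xi j.
move: ab cs a1 a2 b1 b2 xij.
have := enorm_ge0 xi.
move: (enorm w) (enorm x) (dotp x xi) (xi ord0 j) (2 * x ord0 j + s) xj (enorm xi).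
move=> b a p e t te E E0 ab cs a1 a2 b1 b2 eE eE'.
have a0 : 0 < a by exact: lt_le_trans a1.
have b0 : 0 < b by exact: lt_le_trans b1.
have key : b^-1 * (p + s * e) - a^-1 * p = s / b * (e - p / a * (t / (a + b))).
  have -> : t = (b ^+ 2 - a ^+ 2) / s by rewrite ab; field; rewrite gt_eqF.
  by field; rewrite !gt_eqF ?addr_gt0.
rewrite key normrM (gtr0_norm (divr_gt0 s0 b0)).
have r1 : `|p / a * (t / (a + b))| <= E / (2 * d).
  rewrite normrM.
  have -> : E / (2 * d) = E * (eta / L) by rewrite -etaL; field; rewrite !gt_eqF.
  apply: ler_pM => //.
    by rewrite normrM normfV (gtr0_norm a0) ler_pdivrMr// mulrC.
  rewrite normrM normfV (gtr0_norm (addr_gt0 a0 b0)) ler_pdivrMr ?addr_gt0//.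
  apply: (le_trans te); rewrite mulrAC ler_pdivlMr//.
  rewrite (_ : 2 * eta * L = eta * (2 * L)); last by ring.
  by rewrite ler_wpM2l ?(ltW eta0)//; lra.
have dd : 0 < 2 * d by rewrite mulr_gt0.
set K := e - _.
have K1 : E / (2 * d) <= `|K|.
  have h1 : E / d <= `|e| by rewrite ler_pdivrMr// mulrC.
  have h2 : `|e| <= `|K| + `|p / a * (t / (a + b))|.
    by rewrite -[X in `|X| <= _](subrK (p / a * (t / (a + b)))) ler_normD.
  have h3 : E / d = E / (2 * d) + E / (2 * d) by field; rewrite gt_eqF.
  lra.
have K2 : `|K| <= 2 * E.
  have h2 := ler_normB e (p / a * (t / (a + b))); rewrite -/K in h2.
  have h3 : E / (2 * d) <= E by rewrite ler_pdivrMr// ler_peMr//; move: d2; lra.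
  lra.
have sb1 : s <= s / b by rewrite ler_pdivlMr// ler_piMr// ltW.
have sb2 : s / b <= s * (2 * d).
  rewrite ler_pdivrMr// -mulrA ler_peMr ?(ltW s0)//.
  have dL1 : 2 * d * L = 1 by rewrite -mulrA dL divff.
  by rewrite -[leLHS]dL1 ler_wpM2l// ltW.
apply/andP; split.
  rewrite -mulrA ler_pM//; first exact: ltW.
  by rewrite divr_ge0// ltW.
apply: (le_trans (ler_pM _ _ sb2 K2)) => //; first by rewrite ltW// divr_gt0.
by rewrite le_eqVlt; apply/orP; left; apply/eqP; ring.
Qed.

Lemma normr_sin_sub (a b : R) : `|sin (a - b)| <= `|sin a| + `|sin b|.
Proof.
rewrite sinB (le_trans (ler_normB _ _))// !normrM lerD//.
- by rewrite ler_piMr// cos_max.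
- by rewrite ler_piMl// cos_max.
Qed.

Let kappa := eta / (8 * d).
Let kappa0 : 0 < kappa. Proof. by rewrite divr_gt0// mulr_gt0. Qed.

(** Since sin (b - a) is at most |sin a| + |sin b|, two phases that are apart
    modulo pi cannot both have a small sine. The step s is chosen such that the
    two phases differ by at most 1, where sine is comparable to its argument, and
    by at least a multiple of min (1, h |xi|). *)
Lemma radial_dichotomy j xi (h : R) : 0 < h -> 0 < enorm xi ->
  enorm xi <= d * `|xi ord0 j| ->
  exists2 s : R, 0 <= s <= eta & forall x, start_box j x ->
    kappa * Num.min 1 (h * enorm xi) <= `|2 * sin (dotp (h *: radial x) xi / 2)| \/
    kappa * Num.min 1 (h * enorm xi) <=
      `|2 * sin (dotp (h *: radial (x + s *: delta_mx 0 j)) xi / 2)|.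
Proof.
move=> h0 E0 xij; set E := enorm xi; set rho := h * E.
have rho0 : 0 < rho by rewrite mulr_gt0.
have dd : 0 < 2 * d by rewrite mulr_gt0.
set s := Num.min eta (2 * d * rho)^-1.
have s0 : 0 < s by rewrite lt_min eta0 invr_gt0 mulr_gt0.
have s1 : s <= eta by rewrite ge_min lexx.
have s2 : 2 * d * (s * rho) <= 1.
  have -> : 2 * d * (s * rho) = s * (2 * d * rho) by ring.
  rewrite -ler_pdivlMr ?mulr_gt0// mul1r.
  by rewrite ge_min lexx orbT.
exists s => [|x bx]; first by rewrite (ltW s0).
have := @radial_variation j x xi s; rewrite s0 s1 => /(_ isT bx xij).
rewrite !(dotpZl h); set b := dotp _ xi; set a := dotp _ xi.
move=> /andP[v1 v2].
have diff : `|h * b / 2 - h * a / 2| = h / 2 * `|b - a|.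
  by rewrite -mulrBl -mulrBr mulrAC normrM ger0_norm// divr_ge0// ltW.
have d1 : `|h * b / 2 - h * a / 2| <= 1.
  rewrite diff; apply: le_trans s2.
  have -> : 2 * d * (s * rho) = h / 2 * (4 * d * s * E) by rewrite /rho; field.
  by rewrite ler_wpM2l// divr_ge0// ltW.
have d3 : 2 * (kappa * Num.min 1 rho) <= 2 * `|sin (h * b / 2 - h * a / 2)|.
  rewrite ler_pM2l//; apply: le_trans (normr_sin_ge d1).
  rewrite diff ler_pdivlMr//.
  apply: (@le_trans _ _ (h / 2 * (s * E / (2 * d)))); last first.
    by rewrite ler_wpM2l// divr_ge0// ltW.
  have -> : h / 2 * (s * E / (2 * d)) = s * rho / (4 * d).
    by rewrite /rho; field; rewrite gt_eqF.
  have -> : kappa * Num.min 1 rho * 2 = eta * Num.min 1 rho / (4 * d).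
    by rewrite /kappa; field; rewrite gt_eqF.
  rewrite ler_pM2r ?invr_gt0 ?mulr_gt0// /s.
  case: (leP eta (2 * d * rho)^-1) => _.
    by rewrite ler_pM2l// ge_min lexx orbT.
  rewrite invfM mulfVK ?gt_eqF//.
  apply: (@le_trans _ _ eta); first by rewrite ler_piMr ?(ltW eta0)// ge_min lexx.
  exact: eta_le.
have := normr_sin_sub (h * b / 2) (h * a / 2).
rewrite !normrM ger0_norm// => d4.
case: (leP (kappa * Num.min 1 rho) (2 * `|sin (h * a / 2)|)) => h1; first by left.
by right; lra.
Qed.

(** The unit ball without the origin, in the form in which it arises from the
    surface measure: the radial projection of 0 is 0, which is not on the sphere. *)
Definition punctured_ball : set X := unit_ball `&` (radial @^-1` sphere R n).

Lemma measurable_punctured_ball : measurable punctured_ball.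
Proof.
apply: measurableI; first exact: measurable_unit_ball.
rewrite -[X in measurable X]setTI; apply: measurable_radial => //.
have -> : sphere R n = enorm @^-1` [set 1] by [].
rewrite -[X in measurable X]setTI; apply: measurable_enorm => //.
Qed.

Lemma slab_punctured_ball j x : slab j x -> punctured_ball x.
Proof.
move=> sx; split; first exact: slab_enorm_le1 sx.
have e0 : 0 < enorm x by rewrite (lt_le_trans L0)// (slab_enorm_ge sx).
by rewrite /sphere /= /radial enormZ normfV gtr0_norm// mulVf// gt_eqF.
Qed.

Lemma measurable_rV_scale (h : R) : measurable_fun setT (fun x : X => h *: x).
Proof.
apply: measurable_fun_rV => i; under eq_fun do rewrite mxE.
by apply: measurable_funM => //; exact: measurable_coord.
Qed.

Lemma measurable_radial_symbol m (h : R) xi :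
  measurable_fun setT (fun x : X => symbol m (h *: radial x) xi).
Proof.
have m1 : measurable_fun setT (fun x : X => (h *: radial x, xi)).
  apply/measurable_fun_pair => //.
  exact: (measurableT_comp (measurable_rV_scale h) measurable_radial).
exact: (measurableT_comp (measurable_symbol2 m) m1).
Qed.

Lemma min1_powR (rho a : R) : 0 <= rho -> 0 < a ->
  Num.min 1 rho `^ a = Num.min 1 (rho `^ a).
Proof.
move=> rho0 a0; have p1 : 1 `^ a = 1 :> R by rewrite powR1.
have [r1|r1] := leP 1 rho.
  have h : 1 `^ a <= rho `^ a by rewrite ge0_ler_powR ?nnegrE// ltW.
  by rewrite p1 in h *; rewrite min_l.
have h : rho `^ a <= 1 `^ a by rewrite ge0_ler_powR ?nnegrE// ltW.
by rewrite p1 in h *; rewrite min_r.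
Qed.

(** By radial_dichotomy, start_box is covered by the set of the points with a large
    symbol and a translate of this set, whose measure is therefore at least half
    of that of the box. *)
Lemma sphere_symbol_ge (a : R) : 0 < a ->
  exists2 c : R, 0 < c & forall (h : R) xi, 0 < h ->
    ((c * Num.min 1 ((h * enorm xi) `^ a))%:E <=
     \int[mu]_(x in punctured_ball) (symbol a (h *: radial x) xi)%:E)%E.
Proof.
move=> a0; exists (kappa `^ a * (eta ^+ n / 2)).
  apply: mulr_gt0; first by rewrite powR_gt0.
  by apply: divr_gt0 => //; exact: exprn_gt0.
move=> h xi h0; have [->|xi0] := eqVneq xi 0.
  have -> : enorm (0 : X) = 0 by apply/eqP; rewrite enorm_eq0.
  rewrite mulr0 powR0 ?gt_eqF// min_r// mulr0.
  by apply: integral_ge0 => x _; rewrite lee_fin symbol_ge0.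
have E0 : 0 < enorm xi by rewrite enorm_gt0.
have [j xij] := large_coord xi (ltnW n2).
have [s /andP[s0 s1] dich] := radial_dichotomy h0 E0 xij.
set rho := h * enorm xi; set t := kappa * Num.min 1 rho.
have rho0 : 0 < rho by rewrite mulr_gt0.
have t0 : 0 < t by rewrite mulr_gt0// lt_min ltr01.
pose good := [set x : X | t `^ a <= symbol a (h *: radial x) xi].
have mgood : measurable good.
  have -> : good = (fun x : X => symbol a (h *: radial x) xi) @^-1` `[t `^ a, +oo[.
    by apply/seteqP; split => x /=; rewrite in_itv/= andbT.
  rewrite -[X in measurable X]setTI.
  exact: (measurable_radial_symbol a h xi).
pose shift : X := s *: delta_mx 0 j.
have mbox : measurable (start_box j) by exact: measurable_box.
have mP := measurable_punctured_ball.
pose E := good `&` punctured_ball.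
have mE : measurable E by exact: measurableI.
have mE' : measurable [set x | E (x + shift)].
  by rewrite -[X in measurable X]setTI; exact: measurable_rV_add.
have cover : start_box j `<=` E `|` [set x | E (x + shift)].
  move=> x bx.
  have sx : slab j x.
    rewrite -[x]addr0 -(scale0r (delta_mx 0 j)); apply: start_box_slab => //.
    by rewrite lexx ltW.
  have sx' : slab j (x + shift) by apply: start_box_slab => //; rewrite s0.
  by case: (dich x bx) => hx; [left|right]; split;
    try (apply: slab_punctured_ball; eassumption);
    rewrite /good/= ge0_ler_powR ?nnegrE ?(ltW a0) ?(ltW t0).
have muE : ((eta ^+ n / 2)%:E <= mu E)%E.
  have : ((eta ^+ n)%:E <= mu E + mu E)%E.
    rewrite -(lebesgue_box (fun i => if i == j then - eta else L) eta0).
    rewrite -[X in (_ <= _ + X)%E](lebesgue_rV_translate shift mE).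
    apply: le_trans (measureU2 _ mE mE').
    by apply: le_measure => //; rewrite inE//; exact: measurableU.
  case: (mu E) => [r| |]//=; rewrite ?leey// -EFinD !lee_fin.
  by move=> hr; rewrite ler_pdivrMr//; lra.
apply: (@le_trans _ _ ((t `^ a)%:E * mu E)%E).
  have -> : (kappa `^ a * (eta ^+ n / 2) * Num.min 1 (rho `^ a)) = t `^ a * (eta ^+ n / 2).
    have -> : t `^ a = kappa `^ a * Num.min 1 (rho `^ a).
      rewrite /t powRM; [|exact: ltW|by rewrite le_min ler01 ltW].
      by rewrite min1_powR// ltW.
    by rewrite mulrAC.
  by rewrite EFinM lee_wpmul2l// lee_fin powR_ge0.
rewrite -integral_cst//.
apply: (@le_trans _ _ (\int[mu]_(x in E) (symbol a (h *: radial x) xi)%:E)%E).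
  apply: ge0_le_integral => //.
  - by move=> x _; rewrite lee_fin powR_ge0.
  - apply/measurable_EFinP; apply: measurable_funTS; exact: measurable_radial_symbol.
  - by move=> x [gx _]; rewrite lee_fin.
apply: ge0_subset_integral => //.
- apply/measurable_EFinP; apply: measurable_funTS; exact: measurable_radial_symbol.
- by move=> x _; rewrite lee_fin symbol_ge0.
- by move=> x [].
Qed.

(** The surface measure is n times the image of Lebesgue measure on the unit ball
    under the radial projection. *)
Lemma surface_integral_ge (f : X -> \bar R) : measurable_fun setT f ->
  (forall y, (0 <= f y)%E) ->
  (n%:R%:E * \int[mu]_(x in punctured_ball) f (radial x) <=
   \int[surface_measure R n]_(y in sphere R n) f y)%E.
Proof.
move=> mf f0.
have msph : measurable (sphere R n).
  have -> : sphere R n = enorm @^-1` [set 1] by [].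
  rewrite -[X in measurable X]setTI; apply: measurable_enorm => //.
have mpre : measurable (radial @^-1` sphere R n : set X).
  by rewrite -[X in measurable X]setTI; exact: measurable_radial.
have mfr : measurable_fun setT (f \o @radial R n).
  by apply: measurableT_comp => //; exact: measurable_radial.
rewrite [leRHS](ge0_integral_pushforward (@measurable_radial R n))//; last first.
  exact: measurable_funTS.
set M := (X in (_ <= integral X _ _)%E).
apply: (@le_trans _ _ (\int[M]_(x in punctured_ball) f (radial x))%E); last first.
  apply: ge0_subset_integral => //.
  - exact: measurable_punctured_ball.
  - exact: measurable_funTS.
  - by move=> x [].
rewrite ge0_integral_mscale//; last 2 first.
- exact: measurable_punctured_ball.
- exact: measurable_funTS.
rewrite lee_wpmul2l//.
rewrite le_eqVlt; apply/orP; left; apply/eqP.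
apply: eq_measure_integral => A mA AD.
by rewrite /= /mrestr setIidl// => x /AD[].
Qed.

End radial_slices.

(** * Values and the essential supremum *)
Section pointwise_supremum.
Context {R : realType} {n : nat}.
Local Notation X := 'rV[R]_n.
Local Notation mu := (lebesgue_rV R n).
Implicit Types (x y xi : X).
Local Notation nc := Normc.normc.
Local Notation L1 a := (mu.-integrable setT (EFin \o a)).

Definition coord_cvg (z : nat -> X) (z0 : X) :=
  forall i, z k ord0 i @[k --> \oo] --> z0 ord0 i.

(** Every cube with vertex xi0 has positive measure, hence contains a point where
    |Phi| is at most its essential supremum; let the cubes shrink to xi0. *)
Lemma le_Lnormy (Phi : X -> R) xi0 : 0 <= Phi xi0 ->
  (forall z, coord_cvg z xi0 -> Phi (z k) @[k --> \oo] --> Phi xi0) ->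
  ((Phi xi0)%:E <= 'N[mu]_+oo[EFin \o Phi])%E.
Proof.
move=> Phi0 cPhi.
pose bx (k : nat) : set X := box (xi0 ord0) k.+1%:R^-1.
have mubx k : (0 < mu (bx k))%E by rewrite lebesgue_box// lte_fin exprn_gt0.
have muT : (0 < mu setT)%E.
  apply: lt_le_trans (mubx 0%N) _; apply: le_measure => //; rewrite inE//.
  exact: measurable_box.
rewrite unlock muT; set N := ess_sup _ _.
have [A [mA A0 PA]] := ess_sup_ge mu (abse \o (EFin \o Phi)).
have /choice [z zP] : forall k, exists z : X, bx k z /\ (`|(Phi z)%:E| <= N)%E.
  move=> k; apply: contrapT => /forallNP noz.
  have : bx k `<=` A.
    by move=> z bz; apply: PA => /= Pz; apply: (noz z).
  move=> /(le_measure mu); rewrite !inE => /(_ (measurable_box _ _) mA).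
  by move=> h; have := lt_le_trans (mubx k) h; rewrite [ltRHS]A0 ltxx.
have zcvg : coord_cvg z xi0.
  move=> i; apply: (squeeze_cvgr _ (cvg_cst (xi0 ord0 i))) => //.
    by near=> k; have [/(_ i) h _] := zP k; exact: h.
  rewrite -[X in _ --> X]addr0; apply: cvgD; first exact: cvg_cst.
  exact: cvg_harmonic.
have cP := cPhi _ zcvg.
have NE : (0 <= N)%E by apply: le_trans (zP 0%N).2.
case: N NE zP => [N _|_|//] zP; last by rewrite leey.
rewrite lee_fin; apply: (cvgr_to_le cP); near=> k.
have [_ h] := zP k; rewrite lee_fin in h.
by rewrite (le_trans _ h)// ler_norm.
Unshelve. all: by end_near.
Qed.

Lemma cvg_dotp (z : nat -> X) xi0 x : coord_cvg z xi0 ->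
  dotp (z k) x @[k --> \oo] --> dotp xi0 x.
Proof.
move=> zc; apply: cvg_big => // [|i _]; first exact: add_continuous.
by apply: cvgM; [exact: zc|exact: cvg_cst].
Qed.

Let cvg_transform (g : R -> R) (a : X -> R) (z : nat -> X) xi0 :
  continuous g -> (forall t, `|g t| <= 1) -> L1 a -> coord_cvg z xi0 ->
  (forall xi, measurable_fun setT (fun x => g (dotp xi x))) ->
  \int[mu]_x (a x * g (dotp (z k) x)) @[k --> \oo] -->
  \int[mu]_x (a x * g (dotp xi0 x)).
Proof.
move=> cg g1 ia zc mg.
have ma : measurable_fun setT a by case/integrableP: ia => /measurable_EFinP.
have mag xi : measurable_fun setT (fun x => (a x * g (dotp xi x))%:E).
  by apply/measurable_EFinP; exact: measurable_funM.
have bnd xi x : (`|(a x * g (dotp xi x))%:E| <= (EFin \o (fun x => `|a x|%R)) x)%E.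
  by rewrite /= lee_fin normrM ler_piMr.
have cv x : (a x * g (dotp (z k) x))%:E @[k --> \oo] --> (a x * g (dotp xi0 x))%:E.
  apply: cvg_EFin; first by near=> k.
  apply: cvgM; first exact: cvg_cst.
  apply: continuous_cvg; first exact: cg.
  exact: cvg_dotp.
have [i0 _ cI] := @dominated_convergence _ _ _ mu _ measurableT
  (fun k x => (a x * g (dotp (z k) x))%:E) _ _ (fun k => mag (z k)) (mag xi0)
  (aeW _ (fun x _ => cv x)) (integrable_norm ia) (aeW _ (fun x k _ => bnd (z k) x)).
apply: fine_cvg; rewrite fineK//.
exact: (integrable_fin_num measurableT i0).
Unshelve. all: by end_near.
Qed.

Lemma cvg_costr a (z : nat -> X) xi0 : L1 a -> coord_cvg z xi0 ->
  costr a (z k) @[k --> \oo] --> costr a xi0.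
Proof.
move=> ia zc; apply: cvg_transform => //.
- exact: continuous_cos.
- exact: cos_max.
- by move=> xi; exact: (measurableT_comp measurable_cos_dotp2 (pair1_measurable xi)).
Qed.

Lemma cvg_sintr a (z : nat -> X) xi0 : L1 a -> coord_cvg z xi0 ->
  sintr a (z k) @[k --> \oo] --> sintr a xi0.
Proof.
move=> ia zc; apply: cvg_transform => //.
- exact: continuous_sin.
- exact: sin_max.
- by move=> xi; exact: (measurableT_comp measurable_sin_dotp2 (pair1_measurable xi)).
Qed.

Lemma cvg_normc_fourierL1 f (z : nat -> X) xi0 : Lp 1%E f -> coord_cvg z xi0 ->
  nc (fourierL1 f (z k)) @[k --> \oo] --> nc (fourierL1 f xi0).
Proof.
move=> Lf zc; have ir := Lp1_integrable_Re Lf; have ii := Lp1_integrable_Im Lf.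
under eq_fun do rewrite normc_def_Re_Im Re_fourierL1// Im_fourierL1//.
rewrite normc_def_Re_Im Re_fourierL1// Im_fourierL1//.
apply: continuous_cvg; first exact: sqrt_continuous.
apply: cvgD; (under eq_fun do rewrite expr2; rewrite expr2; apply: cvgM).
- by apply: cvgD; [exact: cvg_costr|exact: cvg_sintr].
- by apply: cvgD; [exact: cvg_costr|exact: cvg_sintr].
- by apply: cvgB; [exact: cvg_costr|exact: cvg_sintr].
- by apply: cvgB; [exact: cvg_costr|exact: cvg_sintr].
Qed.

Lemma cvg_powR (t : nat -> R) (t0 m : R) : 0 < t0 -> t k @[k --> \oo] --> t0 ->
  t k `^ m @[k --> \oo] --> t0 `^ m.
Proof.
move=> t00 tc.
have -> : t0 `^ m = expR (m * ln t0) by rewrite /powR gt_eqF.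
have c : expR (m * ln (t k)) @[k --> \oo] --> expR (m * ln t0).
  apply: continuous_cvg; first exact: continuous_expR.
  apply: cvgM; first exact: cvg_cst.
  by apply: continuous_cvg => //; exact: continuous_ln.
apply: cvg_trans c; apply: near_eq_cvg; near=> k.
rewrite /powR gt_eqF//; near: k.
exact: (cvgr_gt t0).
Unshelve. all: by end_near.
Qed.

Lemma cvg_symbol m y (z : nat -> X) xi0 : 0 < symbol m y xi0 -> m != 0 -> coord_cvg z xi0 ->
  symbol m y (z k) @[k --> \oo] --> symbol m y xi0.
Proof.
move=> s0 m0 zc; apply: cvg_powR.
  rewrite lt_def normr_ge0 andbT; apply/eqP => h.
  by move: s0; rewrite /symbol h powR0// ltxx.
apply: continuous_cvg; first exact: norm_continuous.
apply: cvgM; first exact: cvg_cst.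
apply: continuous_cvg; first exact: continuous_sin.
apply: cvgM; last exact: cvg_cst.
by under eq_fun do rewrite dotpC; rewrite dotpC; exact: cvg_dotp.
Qed.

(** Both factors are continuous away from the zeros of the symbol, where there is
    nothing to prove. *)
Lemma symbol_fourierL1_le m y f xi : 0 < m -> Lp 1%E f ->
  ((symbol m y xi * nc (fourierL1 f xi))%:E <=
   'N[mu]_+oo[EFin \o (fun xi => symbol m y xi * nc (fourierL1 f xi))%R])%E.
Proof.
move=> m0 Lf.
have [s0|s0] := eqVneq (symbol m y xi) 0.
  by rewrite s0 mul0r; exact: Lnorm_ge0.
apply: (@le_Lnormy (fun xi => symbol m y xi * nc (fourierL1 f xi))).
  by rewrite mulr_ge0 ?symbol_ge0 ?normc_nneg.
move=> z zc; apply: cvgM; last exact: cvg_normc_fourierL1.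
by apply: cvg_symbol => //; rewrite ?gt_eqF// lt_def s0 symbol_ge0.
Qed.

End pointwise_supremum.

(** * From differences to the modulus of continuity *)
Section modulus_of_continuity.
Context {R : realType}.
Local Open Scope ereal_scope.
Local Notation nc := Normc.normc.

(** The integral of a nonnegative function is a supremum of integrals of simple
    functions, so that it is monotone without any measurability. This is used for
    the norm of a difference as a function of its direction. *)
Lemma ge0_le_integral_nonmeasurable d (T : measurableType d) (mu : {measure set T -> \bar R})
    (D : set T) (f g : T -> \bar R) :
  (forall x, D x -> 0 <= f x) -> (forall x, D x -> f x <= g x) ->
  \int[mu]_(x in D) f x <= \int[mu]_(x in D) g x.
Proof.
move=> f0 fg; have g0 x : D x -> 0 <= g x by move=> Dx; exact: le_trans (f0 x Dx) (fg x Dx).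
rewrite !ge0_integralE//; apply: ge_ereal_sup => _ [h hf <-].
apply: ereal_sup_ubound; exists h => // x.
apply: le_trans (hf x) _; rewrite !patchE; case: ifPn => // /set_mem Dx.
exact: fg.
Qed.

Variable n : nat.
Local Notation X := 'rV[R]_n.
Local Notation mu := (lebesgue_rV R n).
Implicit Types (f G : X -> R[i]) (p m t : R).

Lemma symbolM m q y (xi : X) : (symbol m y xi `^ q = symbol (m * q) y xi)%R.
Proof. by rewrite /symbol powRrM. Qed.

(** Tonelli exchanges the average over the directions y with the integral over
    the frequencies xi, and the average of the symbol at fixed xi is at least a
    multiple of the weight in psi. *)
Lemma weight_le_sphere_average (a : R) : (2 <= n)%N -> (0 < a)%R ->
  exists2 c : R, (0 < c)%R & forall (w : X -> R) (h : R),
    measurable_fun setT w -> (forall xi, 0 <= w xi)%R -> (0 < h)%R ->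
    c%:E * \int[mu]_xi (Num.min 1 ((h * enorm xi) `^ a) * w xi)%:E <=
    \int[surface_measure R n]_(y in sphere R n)
      \int[mu]_xi (symbol a (h *: y) xi * w xi)%:E.
Proof.
move=> n2 a0; have [c c0 Hc] := @sphere_symbol_ge R n n2 a a0.
exists (n%:R * c)%R => [|w h mw w0 h0]; first by rewrite mulr_gt0// ltr0n ltnW.
have msym : measurable_fun setT (fun z : X * X => symbol a (h *: z.1) z.2).
  have m1 : measurable_fun setT (fun z : X * X => (h *: z.1, z.2)).
    apply/measurable_fun_pair => //.
    exact: (measurableT_comp (measurable_rV_scale h) measurable_fst).
  exact: (measurableT_comp (measurable_symbol2 a) m1).
pose Psi (z : X * X) := (symbol a (h *: z.1) z.2 * w z.2)%R.
have mPsi : measurable_fun setT (EFin \o Psi).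
  apply/measurable_EFinP; apply: measurable_funM => //.
  exact: (measurableT_comp mw measurable_snd).
have Psi0 z : 0 <= (EFin \o Psi) z by rewrite lee_fin mulr_ge0 ?symbol_ge0.
pose Phi y := \int[mu]_xi (Psi (y, xi))%:E.
have mPhi : measurable_fun setT Phi.
  exact: (@measurable_fun_fubini_tonelli_F _ _ _ _ _ mu _ mPsi Psi0).
have Phi0 y : 0 <= Phi y by apply: integral_ge0 => xi _; exact: (Psi0 (y, xi)).
apply: (@le_trans _ _ (n%:R%:E * \int[mu]_(x in @punctured_ball R n) Phi (radial x))); last first.
  exact: (surface_integral_ge mPhi Phi0).
rewrite EFinM -muleA lee_wpmul2l//.
pose Psi' (z : X * X) := (\1_(@punctured_ball R n) z.1 * Psi (radial z.1, z.2))%R.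
have mPr : measurable_fun setT (fun z : X * X => (radial z.1, z.2)).
  by apply/measurable_fun_pair => //; exact: (measurableT_comp measurable_radial measurable_fst).
have mPsi' : measurable_fun setT (EFin \o Psi').
  apply/measurable_EFinP; apply: measurable_funM.
    have m1 := @measurable_indic _ X R setT _ (@measurable_punctured_ball R n).
    exact: (measurableT_comp m1 measurable_fst).
  by apply/measurable_EFinP; exact: (measurableT_comp mPsi mPr).
have Psi'0 z : 0 <= (EFin \o Psi') z.
  by rewrite lee_fin mulr_ge0 ?indicE// -lee_fin; exact: Psi0.
have -> : \int[mu]_(x in punctured_ball) Phi (radial x) =
    \int[mu]_x \int[mu]_xi (EFin \o Psi') (x, xi).
  rewrite integral_mkcond; apply: eq_integral => x _; rewrite patchE /Phi.
  case: ifPn => xP.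
    by apply: eq_integral => xi _; rewrite /= /Psi' indicE xP mul1r.
  by rewrite integral0_eq// => xi _; rewrite /= /Psi' indicE (negbTE xP) mul0r.
rewrite (fubini_tonelli _ mPsi' Psi'0) -ge0_integralZl//; last 3 first.
- apply/measurable_EFinP; apply: measurable_funM => //.
  apply: measurable_minr => //; apply: (measurableT_comp (@measurable_powR R _)).
  by apply: measurable_funM => //; exact: measurable_enorm.
- by move=> xi _; rewrite lee_fin mulr_ge0// le_min ler01 powR_ge0.
- by rewrite lee_fin ltW.
apply: ge0_le_integral_nonmeasurable => xi _.
  by rewrite -EFinM lee_fin !mulr_ge0 ?(ltW c0)// le_min ler01 powR_ge0.
have -> : \int[mu]_x (EFin \o Psi') (x, xi) =
    (w xi)%:E * \int[mu]_(x in punctured_ball) (symbol a (h *: radial x) xi)%:E.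
  rewrite -ge0_integralZl//; last 4 first.
  - exact: measurable_punctured_ball.
  - apply/measurable_EFinP; apply: measurable_funTS; exact: measurable_radial_symbol.
  - by move=> x _; rewrite lee_fin symbol_ge0.
  - by rewrite lee_fin.
  rewrite [RHS]integral_mkcond; apply: eq_integral => x _; rewrite patchE /= /Psi' indicE /Psi/=.
  by case: ifP => _; rewrite ?mul0r// mul1r mulrC EFinM.
apply: le_trans (lee_wpmul2l _ (Hc h xi h0)); last by rewrite lee_fin.
by rewrite -!EFinM lee_fin mulrA mulrC.
Qed.

(** The lower bound of fdiff_norm_ge, raised to the power q, is compared with the
    integrand of omega pointwise on the sphere. Its constant c1 is put into the
    weight w, together with the q-th power of the modulus of the transform. *)
Lemma le_psi_omega_gt1 p m : (2 <= n)%N -> (1 < p)%R -> (p <= 2)%R -> (0 < m)%R ->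
  exists2 c : R, (0 < c)%R & forall f, Lp p%:E f -> forall t, (0 < t)%R ->
    psi (hoelder_conjugate p%:E) m (fourier p%:E f) t <=
    c%:E * omega p%:E m (hoelder_conjugate p%:E) f (1 / t)%R.
Proof.
move=> n2 p1 p2 m0.
have p12 : (1 <= p <= 2)%R by rewrite (ltW p1).
have [c1 c10 H1] := @fdiff_norm_ge R n p m p12 m0.
set q := (p / (p - 1))%R.
have qE : hoelder_conjugate p%:E = q%:E.
  have pB1 : (p - 1 != 0)%R by rewrite subr_eq0 gt_eqF.
  by rewrite /hoelder_conjugate/= eqe gt_eqF ?(lt_trans _ p1)// -EFinD inver (negbTE pB1).
have q0 : (0 < q)%R by rewrite divr_gt0 ?subr_gt0// (lt_trans _ p1).
rewrite qE in H1 *.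
have [c2 c20 H2] := @weight_le_sphere_average (m * q) n2 (mulr_gt0 m0 q0).
set C := (c2 * c1 `^ q)%R.
have C0 : (0 < C)%R by rewrite mulr_gt0 ?powR_gt0.
exists (C^-1 `^ q^-1)%R => [|f Lf t t0]; first by rewrite powR_gt0 ?invr_gt0.
have [FG|->] := fourierP Lf; last first.
  rewrite /psi; under eq_integral do rewrite Normc.normc0 powR0 ?(gt_eqF q0)// mulr0.
  rewrite integral0 poweR0r ?invr_eq0 ?gt_eqF//.
  by rewrite mule_ge0 ?lee_fin ?powR_ge0 ?poweR_ge0.
have [_ LG _] := FG; have mG := Lp_cmeasurable LG.
set G := fourier p%:E f in FG LG mG *.
have mnG : measurable_fun setT (fun xi => nc (G xi) `^ q)%R.
  exact: (measurableT_comp (@measurable_powR R q) (measurable_normc mG)).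
have h0 : (0 < 1 / t)%R by rewrite divr_gt0.
have weight0 (xi : X) : (0 <= Num.min 1 ((enorm xi / t) `^ (m * q)))%R.
  by rewrite le_min ler01 powR_ge0.
rewrite /psi /omega -[(C^-1 `^ _)%:E]poweR_EFin -poweRM; last 2 first.
- by rewrite lee_fin invr_ge0 ltW.
- by apply: integral_ge0 => y _; exact: poweR_ge0.
apply: gt0_ler_poweR; first by rewrite invr_ge0 ltW.
- rewrite in_itv/= leey andbT; apply: integral_ge0 => xi _.
  by rewrite lee_fin mulr_ge0 ?powR_ge0.
- rewrite in_itv/= leey andbT mule_ge0 ?lee_fin ?invr_ge0 ?(ltW C0)//.
  by apply: integral_ge0 => y _; exact: poweR_ge0.
rewrite -lee_pdivrMl ?invr_gt0// invrK.
pose w xi := (c1 `^ q * nc (G xi) `^ q)%R.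
have w0 xi : (0 <= w xi)%R by rewrite mulr_ge0 ?powR_ge0.
have mw : measurable_fun setT w by exact: measurable_funM.
apply: (@le_trans _ _ (\int[surface_measure R n]_(y in sphere R n)
    \int[mu]_xi (symbol (m * q) ((1 / t) *: y) xi * w xi)%:E)).
  apply: le_trans (H2 w _ mw w0 h0).
  rewrite le_eqVlt; apply/orP; left; apply/eqP.
  rewrite /C EFinM -muleA -ge0_integralZl//; last 3 first.
  - apply/measurable_EFinP; apply: measurable_funM => //.
    apply: measurable_minr => //; apply: (measurableT_comp (@measurable_powR R _)).
    by apply: measurable_funM => //; exact: measurable_enorm.
  - by move=> xi _; rewrite lee_fin mulr_ge0 ?powR_ge0.
  - by rewrite lee_fin powR_ge0.
  congr (_ * _); apply: eq_integral => xi _.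
  by rewrite -EFinM mulrCA mul1r (mulrC _^-1)%R.
apply: ge0_le_integral_nonmeasurable => y _.
  by apply: integral_ge0 => xi _; rewrite lee_fin mulr_ge0 ?symbol_ge0.
have := H1 _ FG ((1 / t) *: y)%R.
have -> : \int[mu]_xi (symbol (m * q) ((1 / t) *: y) xi * w xi)%:E =
    (c1%:E * 'N[mu]_q%:E[EFin \o (fun xi => symbol m ((1 / t) *: y) xi * nc (G xi))%R]) `^ q.
  rewrite poweRM ?lee_fin ?(ltW c10) ?Lnorm_ge0// poweR_EFin -Lnorm_le_poweR//.
  have msym : measurable_fun setT (symbol m ((1 / t) *: y)).
    have m1 : measurable_fun setT (fun xi : X => ((1 / t) *: y, xi)).
      by apply/measurable_fun_pair.
    exact: (measurableT_comp (measurable_symbol2 m) m1).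
  rewrite -ge0_integralZl//; last 2 first.
  - apply/measurable_EFinP; apply: (measurableT_comp (@measurable_powR R q)).
    apply: (measurableT_comp (@normr_measurable R setT)).
    by apply: measurable_funM => //; exact: measurable_normc.
  - by rewrite lee_fin powR_ge0.
  apply: eq_integral => xi _; rewrite -EFinM; congr EFin.
  rewrite ger0_norm ?mulr_ge0 ?symbol_ge0 ?normc_nneg//.
  by rewrite powRM ?symbol_ge0 ?normc_nneg// symbolM /w mulrCA.
move=> h; apply: gt0_ler_poweR => //; first exact: ltW.
- by rewrite in_itv/= leey andbT mule_ge0 ?lee_fin ?(ltW c10) ?Lnorm_ge0.
- by rewrite in_itv/= leey andbT fdiff_norm_ge0.
Qed.

(** For p = 1 both sides are suprema. Given xi, take y parallel to xi with
    y.xi = min (1, |xi| / t); then |y| <= 1/t, and the symbol at (y, xi) is at least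
    2^-m times the weight because |sin (s/2)| >= s/4 for 0 <= s <= 1. *)
Lemma le_psi_omega_1 m : (0 < m)%R ->
  exists2 c : R, (0 < c)%R & forall f, Lp 1%:E f -> forall t, (0 < t)%R ->
    psi (hoelder_conjugate 1%:E) m (fourier 1%:E f) t <=
    c%:E * omega 1%:E m (hoelder_conjugate 1%:E) f (1 / t)%R.
Proof.
move=> m0; have [|c c0 Hc] := @fdiff_norm_ge R n 1 m _ m0; first by rewrite lexx ler1n.
rewrite hoelder_conjugate1 in Hc *.
exists (2 `^ m * c^-1)%R => [|f Lf t t0]; first by rewrite mulr_gt0 ?powR_gt0 ?invr_gt0.
have fE : fourier 1%:E f = fourierL1 f by rewrite /fourier eqxx.
have Ff : is_fourier 1%:E f (fourier 1%:E f) by rewrite fE; exact: is_fourier1.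
rewrite /psi fE /omega; apply: ge_ereal_sup => _ [xi _ <-].
set A := nc _; have A0 : (0 <= A)%R by exact: normc_nneg.
have [xi0|xi0] := eqVneq xi 0%R.
  have -> : enorm xi = 0%R by apply/eqP; rewrite enorm_eq0 xi0.
  rewrite mul0r powR0 ?gt_eqF// min_r// mul0r.
  rewrite mule_ge0 ?lee_fin ?mulr_ge0 ?powR_ge0 ?invr_ge0 ?(ltW c0)//.
  apply: (@le_trans _ _ (fdiff_norm 1%:E m 0%R f)); first exact: fdiff_norm_ge0.
  apply: ereal_sup_ubound; exists 0%R => //=.
  have -> : enorm (0 : X) = 0%R by apply/eqP; rewrite enorm_eq0.
  by rewrite divr_ge0// ltW.
have E0 : (0 < enorm xi)%R by rewrite enorm_gt0.
set rho := (enorm xi / t)%R; have rho0 : (0 < rho)%R by rewrite divr_gt0.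
set s : R := Num.min 1%R rho.
have s0 : (0 < s)%R by rewrite lt_min ltr01.
have s1 : (s <= 1)%R by rewrite ge_min lexx.
pose y := ((s / enorm xi ^+ 2) *: xi)%R.
have dy : dotp y xi = s.
  by rewrite dotpZl -enorm_sqr divfK// expf_neq0// gt_eqF.
have ey : (enorm y <= 1 / t)%R.
  rewrite enormZ ger0_norm ?divr_ge0 ?exprn_ge0 ?(ltW s0) ?(ltW E0)//.
  rewrite expr2 invfM mulrA divfK ?gt_eqF// ler_pdivrMr// mul1r mulrC.
  by rewrite ge_min lexx orbT.
have sy : (Num.min 1 (rho `^ m) <= 2 `^ m * symbol m y xi)%R.
  rewrite -min1_powR// ?(ltW rho0)// -/s /symbol dy -powRM//.
  rewrite ge0_ler_powR ?nnegrE ?(ltW m0) ?(ltW s0) ?mulr_ge0//.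
  have : (`|s / 2| <= 1)%R by rewrite ger0_norm; [lra|rewrite divr_ge0// ltW].
  move=> /normr_sin_ge; rewrite ger0_norm; last by rewrite divr_ge0// ltW.
  by rewrite normrM ger0_norm//; lra.
apply: (@le_trans _ _ ((2 `^ m)%:E * (symbol m y xi * A)%:E)).
  by rewrite -EFinM lee_fin mulrA ler_wpM2r.
rewrite (EFinM (2 `^ m)%R c^-1%R) -muleA lee_wpmul2l ?lee_fin ?powR_ge0//.
rewrite lee_pdivlMl//.
apply: (le_trans _ (ereal_sup_ubound _)); last by exists y; [exact: ey|reflexivity].
apply: le_trans (Hc _ Ff y).
by rewrite lee_wpmul2l ?lee_fin ?(ltW c0)// fE; exact: symbol_fourierL1_le.
Qed.

End modulus_of_continuity.

Theorem theorem1p1 (R : realType) (d : nat) (p m : R) :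
  (2 <= d)%N -> 1 <= p -> p <= 2 -> 0 < m ->
  exists2 c : R, 0 < c &
    forall f : 'rV[R]_d -> R[i], Lp p%:E f ->
    forall t : R, 0 < t ->
      (psi (hoelder_conjugate p%:E) m (fourier p%:E f) t
         <= c%:E * omega p%:E m (hoelder_conjugate p%:E) f (1 / t))%E.
Proof.
move=> d2; rewrite le_eqVlt => /orP[/eqP <- _|]; first exact: le_psi_omega_1.
exact: le_psi_omega_gt1.
Qed.
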